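(* Let $D$ be a digraph with $n$ vertices and let $k$ be a non-negative integer. There is an algorithm running in time $2^{O(k \log k)} \cdot n^{O(1)}$ that either produces a nice arboreal decomposition of $D$ of width at most $3k-2$, or outputs a $(k-1,k-1)$-linked set $T \subseteq V(D)$ with $|T| = 2k-1$.
   Context: All paths and walks are directed. For a digraph $D$ and $T \subseteq V(D)$ and a positive integer $r$, a $(T,r)$-balanced separator is a set $Z \subseteq V(D)$ such that every strong component of $D \setminus Z$ contains at most $r$ vertices of $T$. The set $T$ is $(k,r)$-linked if every $(T,r)$-balanced separator has size at least $k+1$. For $Z \subseteq V(D)$ and $S \subseteq V(D)\setminus Z$, $S$ is $Z$-guarded if there is no directed walk in $D\setminus Z$ whose first and last vertices are in $S$ and which uses a vertex of $V(D)\setminus(Z\cup S)$. An arborescence $R$ with root $r_0$ is an orientation of a tree containing a directed path from $r_0$ to every vertex. For $r \in V(R)$ and $e \in E(R)$ with head $r'$, write $r > e$ if there is a directed path from $r'$ to $r$ in $R$ (including $r=r'$), and $e \sim r$ if $r$ is the head or the tail of $e$. An arboreal decomposition of $D$ is a triple $(R,\mathcal X,\mathcal W)$ where $R$ is an arborescence, $\mathcal X=\{X_e : e\in E(R)\}$ and $\mathcal W=\{W_r: r\in V(R)\}$ are collections of subsets of $V(D)$ such that (i) $\mathcal W$ is a partition of $V(D)$ into non-empty sets, and (ii) for every $e\in E(R)$, the set $\bigcup\{W_r : r > e\}$ is $X_e$-guarded. It is nice if moreover (iii) for every $e \in E(R)$, $\bigcup\{W_r : r>e\}$ induces a strong component of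 $D\setminus X_e$, and (iv) for every $r\in V(R)$ with out-neighbours $r_1,\dots,r_\ell$ in $R$, $\left(\bigcup_{i} W_{r_i}\right)\cap\left(\bigcup_{e\sim r}X_e\right)=\emptyset$. The width of $(R,\mathcal X,\mathcal W)$ is the least integer $w$ such that $|W_r\cup\bigcup_{e\sim r}X_e|\le w+1$ for all $r\in V(R)$.
   Formalization: The formal theorem takes k ≥ 1 and n ≥ 1: for k = 0 no decomposition has width at most −2 and no set has −1 vertices, and the digraph with no vertices has neither an arboreal decomposition nor a set T of size 2k−1 ≥ 1. *)

(* Defs.v *)
From mathcomp Require Import all_boot.

Set Implicit Arguments.
Unset Strict Implicit.
Unset Printing Implicit Defensive.

(** * Digraphs, strong components, linked and guarded sets *)

(** A digraph is a relation [D : rel V] on a finite type. Deleting [Z] keeps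
    the vertices of [Z] in the type but removes every arc incident to them;
    the definitions below only ever start from vertices outside [Z]. *)
Definition del (V : finType) (D : rel V) (Z : {set V}) : rel V :=
  [rel x y | [&& x \notin Z, y \notin Z & D x y]].

Definition mutually_reachable (V : finType) (D : rel V) : rel V :=
  [rel x y | connect D x y && connect D y x].

(** The vertex sets of the strong components of [D \ Z]. *)
Definition strong_components (V : finType) (D : rel V) (Z : {set V}) :
    {set {set V}} :=
  equivalence_partition (mutually_reachable (del D Z)) (~: Z).

(** [(T, r)]-balanced separators; [r = 0] is allowed. *)
Definition balanced_separator (V : finType) (D : rel V) (T : {set V}) (r : nat)
    (Z : {set V}) : Prop :=
  forall C : {set V}, C \in strong_components D Z -> #|C :&: T| <= r.

Definition linked (V : finType) (D : rel V) (k r : nat) (T : {set V}) : Prop :=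
  forall Z : {set V}, balanced_separator D T r Z -> k + 1 <= #|Z|.

(** A walk is given by its first vertex [x] and the sequence [p] of its
    remaining vertices. *)
Definition guarded (V : finType) (D : rel V) (Z S : {set V}) : Prop :=
  [disjoint S & Z] /\
  ~ exists (x : V) (p : seq V),
      [/\ path (del D Z) x p, x \in S, last x p \in S &
          exists2 y : V, y \in x :: p & y \notin Z :|: S].

(** * Arborescences *)

Definition underlying (N : finType) (R : rel N) : rel N :=
  [rel x y | R x y || R y x].

(** For a symmetric irreflexive [g], the duplicate-free closed sequences of
    size at least 3 are exactly the cycles of the graph. *)
Definition is_tree (N : finType) (g : rel N) : Prop :=
  [/\ symmetric g, irreflexive g, forall x y : N, connect g x y &
      forall s : seq N, ucycle g s -> size s <= 2].

Definition arborescence (N : finType) (R : rel N) (r0 : N) : Prop :=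
  [/\ is_tree (underlying R),
      forall x y : N, R x y -> ~~ R y x &
      forall r : N, connect R r0 r].

(** The arc from [u] to [v] is the pair [(u, v)]; a pair [e] is an arc of [R]
    when [R e.1 e.2]. *)
Definition incident (N : finType) (e : N * N) (r : N) : bool :=
  (r == e.1) || (r == e.2).

(** * Arboreal decompositions *)

(** The family [X] is defined on all pairs of nodes, but only its values on the
    arcs of [R] are ever used. *)

(** The union of the [W r] for [r > e]. *)
Definition below (V N : finType) (R : rel N) (W : N -> {set V}) (e : N * N) :
    {set V} :=
  \bigcup_(r | connect R e.2 r) W r.

(** The union of the [X e] for [e ~ r]. *)
Definition guards (V N : finType) (R : rel N) (X : N * N -> {set V}) (r : N) :
    {set V} :=
  \bigcup_(e | R e.1 e.2 && incident e r) X e.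

Definition arboreal_decomposition (V N : finType) (D : rel V) (R : rel N)
    (X : N * N -> {set V}) (W : N -> {set V}) : Prop :=
  [/\ exists r0 : N, arborescence R r0,
      [/\ forall r : N, W r != set0,
          forall r r' : N, r != r' -> [disjoint W r & W r'] &
          \bigcup_r W r = [set: V]] &
      forall e : N * N, R e.1 e.2 -> guarded D (X e) (below R W e)].

Definition nice_arboreal_decomposition (V N : finType) (D : rel V) (R : rel N)
    (X : N * N -> {set V}) (W : N -> {set V}) : Prop :=
  [/\ arboreal_decomposition D R X W,
      forall e : N * N, R e.1 e.2 ->
        below R W e \in strong_components D (X e) &
      forall r : N, (\bigcup_(r' | R r r') W r') :&: guards R X r = set0].

(** The least [w] with [#|W r :|: guards R X r| <= w + 1] for all [r]; the
    predecessor is not truncated, since a decomposition has a node and its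
    sets [W r] are non-empty. *)
Definition width (V N : finType) (R : rel N) (X : N * N -> {set V})
    (W : N -> {set V}) : nat :=
  (\max_r #|W r :|: guards R X r|).-1.

(** * Model of computation *)

(** Algorithms are programs of a first-order, call-by-value functional language
    on binary trees (in the style of Jones, "Computability and Complexity from
    a Programming Perspective"). A program is a finite list of mutually
    recursive one-argument functions, and the running time is the number of
    evaluation steps. Each step takes constant time on a pointer machine: trees
    are shared and never compared or copied, and the length of the environment
    is bounded in terms of the program. The language is thus polynomially
    equivalent to Turing machines, so bounds [2^O(k log k) * n^O(1)] do not
    depend on the choice between them. *)

Inductive tree : Type :=
| Nil
| Node of tree & tree.

(** Variables are de Bruijn indices. [Case e e0 e1] continues with [e0] if the
    value of [e] is [Nil], and with [e1] if it is [Node l r], with [l] bound to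
    index 0 and [r] to index 1. [Call f e] applies the [f]-th function. *)
Inductive expr : Type :=
| Var of nat
| MkNil
| MkNode of expr & expr
| Case of expr & expr & expr
| Let of expr & expr
| Call of nat & expr.

Definition program : Type := seq expr.

(** [eval P env e v t]: in the environment [env], the expression [e] evaluates
    to [v] in [t] steps. *)
Inductive eval (P : program) : seq tree -> expr -> tree -> nat -> Prop :=
| EvalVar env i :
    eval P env (Var i) (nth Nil env i) 1
| EvalNil env :
    eval P env MkNil Nil 1
| EvalNode env e1 e2 v1 v2 t1 t2 :
    eval P env e1 v1 t1 -> eval P env e2 v2 t2 ->
    eval P env (MkNode e1 e2) (Node v1 v2) (t1 + t2).+1
| EvalCaseNil env e e0 e1 v t t0 :
    eval P env e Nil t -> eval P env e0 v t0 ->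
    eval P env (Case e e0 e1) v (t + t0).+1
| EvalCaseNode env e e0 e1 l r v t t1 :
    eval P env e (Node l r) t -> eval P (l :: r :: env) e1 v t1 ->
    eval P env (Case e e0 e1) v (t + t1).+1
| EvalLet env e1 e2 v1 v2 t1 t2 :
    eval P env e1 v1 t1 -> eval P (v1 :: env) e2 v2 t2 ->
    eval P env (Let e1 e2) v2 (t1 + t2).+1
| EvalCall env f e u v t1 t2 :
    eval P env e u t1 -> eval P [:: u] (nth MkNil P f) v t2 ->
    eval P env (Call f e) v (t1 + t2).+1.

(** Evaluation is syntax-directed, so a program has at most one output and one
    running time on each input. *)
Definition runs (P : program) (input output : tree) (t : nat) : Prop :=
  eval P [:: input] (Call 0 (Var 0)) output t.

(** * Encodings *)

Definition enc_bool (b : bool) : tree := if b then Node Nil Nil else Nil.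

Definition enc_seq (s : seq tree) : tree := foldr Node Nil s.

Definition enc_nat (n : nat) : tree := enc_seq (nseq n Nil).

(** Sets are given by their characteristic vectors, indexed by
    [0, 1, ..., n - 1] in this order. *)
Definition enc_set (n : nat) (A : {set 'I_n}) : tree :=
  enc_seq [seq enc_bool (x \in A) | x <- enum 'I_n].

Definition enc_rel (n : nat) (D : rel 'I_n) : tree :=
  enc_seq [seq enc_set [set y | D x y] | x <- enum 'I_n].

Definition enc_input (n : nat) (D : rel 'I_n) (k : nat) : tree :=
  Node (enc_nat k) (enc_rel D).

Definition enc_linked_set (n : nat) (T : {set 'I_n}) : tree :=
  Node (enc_bool false) (enc_set T).

(** The entries of [X] at pairs that are not arcs of [R] carry no meaning. *)
Definition enc_decomposition (n m : nat) (R : rel 'I_m)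
    (X : 'I_m * 'I_m -> {set 'I_n}) (W : 'I_m -> {set 'I_n}) : tree :=
  Node (enc_bool true)
    (Node (enc_rel R)
       (Node (enc_seq [seq enc_seq [seq enc_set (X (u, v)) | v <- enum 'I_m]
                      | u <- enum 'I_m])
             (enc_seq [seq enc_set (W r) | r <- enum 'I_m]))).

(* Main.v *)
(* A node with block [B] (a strong component of [D] minus its guard [X], [#|X| <= 2k-1]) is split by extending [X] to a set [T] of [2k-1] vertices, unless there are fewer vertices. If [T] has a balanced separator [Z] of size at most [k-1], add to it a vertex of [B]; the bag becomes [B :&: Z], and every strong component of [B] minus [Z] becomes a child block, guarded by [Z] together with the at most [k-1] vertices of [X] in its strong component of [D] minus [Z]. Otherwise [T] is linked.

A balanced separator is found by guessing the vertices of [T] in a topological order of the strong components, last component first, and separating the set [A] guessed so far from the rest of [T]. The side of the furthest minimum cut can be added to [A] by submodularity; then a vertex of the cut is either deleted or added to [A], which lowers the budget or raises the size of the cut. This gives a search tree of depth [6k] and degree at most [2k+2].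

The running time is handled by closure properties: the functions computable in time polynomial in [n * 2^(k log k)] are closed under composition, comprehension and quantification over the vertices, iteration, and the bounded search. *)

Require Import Defs.
From mathcomp Require Import all_boot zify.
Import Defs.

Set Implicit Arguments.
Unset Strict Implicit.
Unset Printing Implicit Defensive.

(** * Functions computable in FPT time *)

(** Why the last component comes first: once the guessed set is closed under the arcs that survive
    the deletion, a strong component meeting it lies inside it. Whatever the hypothetical separator
    deletes inside may then be exchanged, as long as the guessed part of [T] is balanced by itself.
    This justifies both the push to the furthest cut and forgetting how earlier components were cut
    out. Completeness follows a single branch of the search, along which a hypothetical separator
    stays compatible with the choices made and a measure drops.

    The other obstacle is that every ingredient must be a program of the small language. Minimum
    cuts are therefore obtained from bipartite matchings improved by single exchanges, so that no
    augmenting path is stored and every loop is an iteration of length [n]. *)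

Record inst := Inst {
  nvtx : nat;
  param : nat;
  arcs : rel 'I_nvtx;
  nvtx_gt0 : 0 < nvtx;
  param_gt0 : 0 < param }.

Definition input (I : inst) : tree := enc_input (@arcs I) (param I).

(** The factor 2 makes [scale] at least 2, so that constants are absorbed by raising the
    exponent. *)
Definition scale (I : inst) : nat :=
  2 * nvtx I * 2 ^ (param I * up_log 2 (param I)).

Lemma scale_ge2 I : 2 <= scale I.
Proof.
have := nvtx_gt0 I; have := expn_gt0 2 (param I * up_log 2 (param I)).
rewrite /scale /=; set a := 2 ^ _; nia.
Qed.

Lemma nvtx_le_scale I : nvtx I <= scale I.
Proof.
have := expn_gt0 2 (param I * up_log 2 (param I)).
rewrite /scale /=; set a := 2 ^ _; nia.
Qed.

Lemma param_le_exp2 k : 0 < k -> k <= 2 ^ (k * up_log 2 k).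
Proof.
case: k => // -[|k] // _; have := @up_log_gtn 2 k.+2 isT.
have: 0 < up_log 2 k.+2 by rewrite up_log_gt0.
move=> h _; apply: leq_trans (@ltnW _ _ (ltn_expl k.+2 (isT : 1 < 2))) _.
by rewrite leq_exp2l // leq_pmulr.
Qed.

Lemma param_le_scale I : param I <= scale I.
Proof.
apply: leq_trans (param_le_exp2 (param_gt0 I)) _.
have := nvtx_gt0 I; rewrite /scale; set a := 2 ^ _; nia.
Qed.

(** Carriers depend on the instance because vertices of different digraphs have different types. *)
Record ty := Ty { car : inst -> Type; enc : forall I, car I -> tree }.
Arguments enc : clear implicits.
Arguments enc {t} I _.

Definition unit_ty := @Ty (fun _ => unit) (fun _ _ => Nil).
Definition bool_ty := @Ty (fun _ => bool) (fun _ b => enc_bool b).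
Definition vtx_ty := @Ty (fun I => 'I_(nvtx I)) (fun _ v => enc_nat v).
Definition set_ty :=
  @Ty (fun I => {set 'I_(nvtx I)}) (fun _ A => enc_set A).
Definition prod_ty A B :=
  @Ty (fun I => (car A I * car B I)%type)
      (fun I x => Node (enc I x.1) (enc I x.2)).
Definition opt_ty A :=
  @Ty (fun I => option (car A I))
      (fun I x => if x is Some y then Node (enc I y) Nil else Nil).
Definition tab_ty A :=
  @Ty (fun I => 'I_(nvtx I) -> car A I)
      (fun I f => enc_seq [seq enc I (f v) | v <- enum 'I_(nvtx I)]).
Definition seq_ty A :=
  @Ty (fun I => seq (car A I)) (fun I s => enc_seq (map (enc I) s)).
(** The instance determines the number, so the carrier is trivial and only the unary encoding is
    data. Computability of the constant function [tt] into this type says that [m] can be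
    computed. *)
Definition cst_ty (m : inst -> nat) :=
  @Ty (fun _ => unit) (fun I _ => enc_nat (m I)).
Definition tree_ty := @Ty (fun _ => tree) (fun _ t => t).

(** An upper bound on the time, so that bounds compose without exact step counts. *)
Definition evt P env e v t := exists2 t', eval P env e v t' & t' <= t.

Lemma evt_le P env e v t t' : evt P env e v t -> t <= t' -> evt P env e v t'.
Proof. by case=> s h1 h2 h3; exists s => //; apply: leq_trans h3. Qed.

Lemma evt_var P env i v : nth Nil env i = v -> evt P env (Var i) v 1.
Proof. by move=> <-; exists 1 => //; constructor. Qed.

Lemma evt_nil P env : evt P env MkNil Nil 1.
Proof. by exists 1 => //; constructor. Qed.

Lemma evt_node P env e1 e2 v1 v2 t1 t2 :
  evt P env e1 v1 t1 -> evt P env e2 v2 t2 ->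
  evt P env (MkNode e1 e2) (Node v1 v2) (t1 + t2).+1.
Proof.
case=> s1 h1 l1 [s2 h2 l2]; exists (s1 + s2).+1; first by constructor.
by rewrite ltnS leq_add.
Qed.

Lemma evt_case0 P env e e0 e1 v t t0 :
  evt P env e Nil t -> evt P env e0 v t0 ->
  evt P env (Case e e0 e1) v (t + t0).+1.
Proof.
case=> s1 h1 l1 [s2 h2 l2]; exists (s1 + s2).+1; first by constructor.
by rewrite ltnS leq_add.
Qed.

Lemma evt_case1 P env e e0 e1 l r v t t1 :
  evt P env e (Node l r) t -> evt P (l :: r :: env) e1 v t1 ->
  evt P env (Case e e0 e1) v (t + t1).+1.
Proof.
case=> s1 h1 l1 [s2 h2 l2]; exists (s1 + s2).+1; first exact: EvalCaseNode h1 h2.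
by rewrite ltnS leq_add.
Qed.

Lemma evt_let P env e1 e2 v1 v2 t1 t2 :
  evt P env e1 v1 t1 -> evt P (v1 :: env) e2 v2 t2 ->
  evt P env (Let e1 e2) v2 (t1 + t2).+1.
Proof.
case=> s1 h1 l1 [s2 h2 l2]; exists (s1 + s2).+1; first exact: EvalLet h1 h2.
by rewrite ltnS leq_add.
Qed.

Lemma evt_call P env f e u v t1 t2 :
  evt P env e u t1 -> evt P [:: u] (nth MkNil P f) v t2 ->
  evt P env (Call f e) v (t1 + t2).+1.
Proof.
case=> s1 h1 l1 [s2 h2 l2]; exists (s1 + s2).+1; first exact: EvalCall h1 h2.
by rewrite ltnS leq_add.
Qed.

Definition Fst e := Case e MkNil (Var 0).
Definition Snd e := Case e MkNil (Var 1).

Lemma evt_fst P env e a b t :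
  evt P env e (Node a b) t -> evt P env (Fst e) a (t + 1).+1.
Proof. by move=> h; apply: evt_case1 h _; exact: evt_var. Qed.

Lemma evt_snd P env e a b t :
  evt P env e (Node a b) t -> evt P env (Snd e) b (t + 1).+1.
Proof. by move=> h; apply: evt_case1 h _; exact: evt_var. Qed.

Ltac ev1 := first
  [ eapply evt_var; simpl; reflexivity | eapply evt_nil | eapply evt_fst | eapply evt_snd
  | eapply evt_node ].
Ltac ev := repeat ev1.

(* Every function receives the global input next to its own argument, so that the digraph and [k] need not be passed around. *)
Definition computes P (j : nat) (A B : ty) (F : forall I, car A I -> car B I) c :=
  forall I (x : car A I),
    evt P [:: Node (input I) (enc I x)] (nth MkNil P j) (enc I (F I x))
        (scale I ^ c).

(* A computable function is given by a code generator that takes the offset at which its code is placed: programs are then linked by concatenation. *)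
Definition fpt (A B : ty) (F : forall I, car A I -> car B I) :=
  exists (gen : nat -> program) (c : nat),
  forall P Q1 Q2 d, size Q1 = d -> P = Q1 ++ gen d ++ Q2 -> computes P d F c.

(** Two slots are reserved at offset [d]: an entry point and an auxiliary function for a loop. The
    code of the two given functions follows, which fixes their addresses. *)
Lemma link (A1 B1 A2 B2 A B : ty) (F1 : forall I, car A1 I -> car B1 I)
  (F2 : forall I, car A2 I -> car B2 I) (G : forall I, car A I -> car B I)
  (b1 b2 : nat -> nat -> nat -> expr) :
  fpt F1 -> fpt F2 ->
  (forall c1 c2, exists c, forall P d i1 i2,
     nth MkNil P d = b1 d i1 i2 -> nth MkNil P d.+1 = b2 d i1 i2 ->
     computes P i1 F1 c1 -> computes P i2 F2 c2 -> computes P d G c) ->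
  fpt G.
Proof.
move=> [g1 [c1 h1]] [g2 [c2 h2]] /(_ c1 c2) [c hc].
pose i2 d := d.+2 + size (g1 d.+2).
exists (fun d => [:: b1 d d.+2 (i2 d); b2 d d.+2 (i2 d)] ++ g1 d.+2 ++ g2 (i2 d)), c.
move=> P Q1 Q2 d sz ->; apply: (hc _ _ d.+2 (i2 d)).
- by rewrite nth_cat sz ltnn subnn.
- by rewrite nth_cat sz ltnNge leqnSn subSnn.
- apply: (h1 _ (Q1 ++ [:: b1 d d.+2 (i2 d); b2 d d.+2 (i2 d)]) (g2 (i2 d) ++ Q2)).
    by rewrite size_cat sz addn2.
  by rewrite -!catA.
- apply: (h2 _ (Q1 ++ [:: b1 d d.+2 (i2 d); b2 d d.+2 (i2 d)] ++ g1 d.+2) Q2).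
    by rewrite !size_cat sz /i2 /=; lia.
  by rewrite -!catA.
Qed.

Lemma scale_exp_gt0 I a : 0 < scale I ^ a.
Proof. by rewrite expn_gt0 (ltnW (scale_ge2 I)). Qed.

Lemma scale_const I : 256 <= scale I ^ 8.
Proof. by apply: leq_trans (_ : 2 ^ 8 <= _) => //; rewrite leq_exp2r ?scale_ge2. Qed.

(** Positive numbers satisfy [x + y <= x * y + 1], and the extra exponent 8 gives a factor of at
    least 256 that pays for the local evaluation steps. *)
Lemma scale_expD I a b : scale I ^ a + scale I ^ b + 100 <= scale I ^ (a + b + 8).
Proof.
have ha := scale_exp_gt0 I a; have hb := scale_exp_gt0 I b; have h8 := scale_const I.
rewrite !expnD; move: (scale I ^ a) (scale I ^ b) (scale I ^ 8) ha hb h8 => x y z hx hy hz.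
have : x * y * 256 <= x * y * z by rewrite leq_pmul2l ?muln_gt0 ?hx.
have : x + y <= x * y + 1 by nia.
have : 0 < x * y by rewrite muln_gt0 hx.
lia.
Qed.

(** The cost of a loop of at most [scale I] rounds, each with one call and boundedly many other
    steps. *)
Lemma scale_loop I a : (scale I).+1 * (scale I ^ a + 100) + 100 <= scale I ^ (a + 10).
Proof.
have h2 := scale_ge2 I; have ha := scale_exp_gt0 I a; have h8 := scale_const I.
rewrite (expnD _ a) (expnD _ 2 8) -mulnn.
move: (scale I) (scale I ^ a) (scale I ^ 8) h2 ha h8 => s x z hs hx hz.
apply: leq_trans (_ : x * (s * s * 256) <= _); last by rewrite !leq_mul.
have : 1 <= s * x by rewrite muln_gt0 hx; lia.
have : s * x * 2 <= s * x * s by rewrite leq_mul.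
have : x * 2 <= x * s by rewrite leq_mul.
have : s * 1 <= s * x by rewrite leq_mul.
nia.
Qed.

(** The same code serves all types with equal encodings: a boolean is an option of unit, a set is a
    table of booleans. *)
Lemma fpt_cast A B B' (F : forall I, car A I -> car B I) (G : forall I, car A I -> car B' I) :
  fpt F -> (forall I x, enc I (F I x) = enc I (G I x)) -> fpt G.
Proof.
move=> [g [c h]] e; exists g, c => P Q1 Q2 d hd hP I x.
by rewrite -e; apply: h hd hP I x.
Qed.

Lemma fpt_base A B (F : forall I, car A I -> car B I) (b1 b2 : nat -> expr) :
  (exists c, forall P d,
     nth MkNil P d = b1 d -> nth MkNil P d.+1 = b2 d -> computes P d F c) ->
  fpt F.
Proof.
case=> c hc; exists (fun d => [:: b1 d; b2 d]), c => P Q1 Q2 d sz ->; apply: hc.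
- by rewrite nth_cat sz ltnn subnn.
- by rewrite nth_cat sz ltnNge leqnSn subSnn.
Qed.

Lemma fpt_id A : @fpt A A (fun I x => x).
Proof.
apply: (@fpt_base _ _ _ (fun _ => Snd (Var 0)) (fun _ => MkNil)).
exists 8 => P d h _ I x; rewrite h; eapply evt_le; first by ev.
by have := scale_const I; lia.
Qed.

Lemma fpt_leaf A B (F : forall I, car A I -> car B I) :
  (forall I x, enc I (F I x) = Nil) -> fpt F.
Proof.
move=> e; apply: (@fpt_base _ _ _ (fun _ => MkNil) (fun _ => MkNil)).
exists 8 => P d h _ I x; rewrite h e; eapply evt_le; first by ev.
by have := scale_const I; lia.
Qed.

Lemma link1 (A1 B1 A B : ty) (F1 : forall I, car A1 I -> car B1 I)
  (G : forall I, car A I -> car B I)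
  (b1 b2 : nat -> nat -> expr) :
  fpt F1 ->
  (forall c1, exists c, forall P d i1,
     nth MkNil P d = b1 d i1 -> nth MkNil P d.+1 = b2 d i1 ->
     computes P i1 F1 c1 -> computes P d G c) ->
  fpt G.
Proof.
move=> h1 h; apply: (@link _ _ _ _ _ _ _ _ _ (fun d i _ => b1 d i) (fun d i _ => b2 d i) h1 h1).
by move=> c1 c2; case: (h c1) => c hc; exists c => P d i1 i2 e1 e2 k1 _; apply: hc e1 e2 k1.
Qed.

Definition Arg := Snd (Var 0).
(** The argument of a call: the global input next to [e]. The index [i] is the number of variables
    bound since the function was entered. *)
Definition Gl i e := MkNode (Fst (Var i)) e.

Lemma fpt_comp A B C (F : forall I, car A I -> car B I) (G : forall I, car B I -> car C I) :
  fpt F -> fpt G -> fpt (fun I x => G I (F I x)).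
Proof.
move=> hF hG.
apply: (@link _ _ _ _ _ _ _ _ _ (fun _ i j => Call j (Gl 0 (Call i (Var 0))))
          (fun _ _ _ => MkNil) hF hG) => c1 c2.
exists (c1 + c2 + 8) => P d i1 i2 e _ k1 k2 I x; rewrite e.
eapply evt_le.
  eapply evt_call; last by apply: k2.
  apply: evt_node; first by ev.
  by eapply evt_call; [ev | apply: k1].
by have := scale_expD I c1 c2; lia.
Qed.

Lemma fpt_pair A B C (F : forall I, car A I -> car B I) (G : forall I, car A I -> car C I) :
  fpt F -> fpt G -> @fpt A (prod_ty B C) (fun I x => (F I x, G I x)).
Proof.
move=> hF hG.
apply: (@link _ _ _ _ _ _ _ _ _ (fun _ i j => MkNode (Call i (Var 0)) (Call j (Var 0)))
          (fun _ _ _ => MkNil) hF hG) => c1 c2.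
exists (c1 + c2 + 8) => P d i1 i2 e _ k1 k2 I x; rewrite e.
eapply evt_le.
  apply: evt_node; (eapply evt_call; [by ev | by [apply: k1 | apply: k2]]).
by have := scale_expD I c1 c2; lia.
Qed.

Lemma fpt_fst0 B C : @fpt (prod_ty B C) B (fun I x => x.1).
Proof.
apply: (@fpt_base _ _ _ (fun _ => Fst Arg) (fun _ => MkNil)).
exists 8 => P d h _ I x; rewrite h; eapply evt_le; first by ev.
by have := scale_const I; lia.
Qed.

Lemma fpt_snd0 B C : @fpt (prod_ty B C) C (fun I x => x.2).
Proof.
apply: (@fpt_base _ _ _ (fun _ => Snd Arg) (fun _ => MkNil)).
exists 8 => P d h _ I x; rewrite h; eapply evt_le; first by ev.
by have := scale_const I; lia.
Qed.

Lemma fpt_fst A B C (F : forall I, car A I -> car (prod_ty B C) I) :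
  fpt F -> @fpt A B (fun I x => (F I x).1).
Proof. by move=> h; apply: fpt_comp h (@fpt_fst0 B C). Qed.

Lemma fpt_snd A B C (F : forall I, car A I -> car (prod_ty B C) I) :
  fpt F -> @fpt A C (fun I x => (F I x).2).
Proof. by move=> h; apply: fpt_comp h (@fpt_snd0 B C). Qed.

Lemma fpt_match A B C (G : forall I, car A I -> car C I)
  (H : forall I, car (prod_ty A B) I -> car C I) :
  fpt G -> fpt H ->
  @fpt (prod_ty A (opt_ty B)) C (fun I x => if x.2 is Some y then H I (x.1, y) else G I x.1).
Proof.
move=> hG hH.
apply: (@link _ _ _ _ _ _ _ _ _
   (fun _ i j => Case (Snd Arg) (Call i (Gl 0 (Fst Arg)))
       (Call j (Gl 2 (MkNode (Fst (Snd (Var 2))) (Var 0)))))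
   (fun _ _ _ => MkNil) hG hH) => c1 c2.
exists (c1 + c2 + 8) => P d i1 i2 e _ k1 k2 I [x [y|]]; rewrite e /=.
- eapply evt_le.
    apply: evt_case1; first by ev.
    eapply evt_call; last by apply: (k2 I (x, y)).
    by ev.
  by have := scale_expD I c1 c2; lia.
- eapply evt_le.
    apply: evt_case0; first by ev.
    eapply evt_call; last by apply: k1.
    by ev.
  by have := scale_expD I c1 c2; lia.
Qed.

Lemma fpt_opt A B C (F : forall I, car A I -> option (car B I)) (G : forall I, car A I -> car C I)
  (H : forall I, car A I -> car B I -> car C I) :
  @fpt A (opt_ty B) F -> fpt G -> @fpt (prod_ty A B) C (fun I p => H I p.1 p.2) ->
  fpt (fun I x => if F I x is Some y then H I x y else G I x).
Proof.
by move=> hF hG hH; apply: fpt_comp (fpt_pair (fpt_id A) hF) (fpt_match hG hH).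
Qed.

Lemma fpt_if A C (F : forall I, car A I -> car bool_ty I) (G H : forall I, car A I -> car C I) :
  fpt F -> fpt G -> fpt H -> fpt (fun I x => if F I x then G I x else H I x).
Proof.
move=> hF hG hH.
have hF' : @fpt A (opt_ty unit_ty) (fun I x => if F I x then Some tt else None).
  by apply: (fpt_cast hF) => I x /=; case: (F I x).
have hG' : @fpt (prod_ty A unit_ty) C (fun I x => G I x.1).
  by apply: fpt_comp (fpt_fst (@fpt_id _)) hG.
by apply: (fpt_cast (@fpt_opt _ unit_ty _ _ _ (fun I x _ => G I x) hF' hH hG')) => I x; case: (F I x).
Qed.

Lemma fpt_tt A : @fpt A unit_ty (fun _ _ => tt).
Proof. by apply: fpt_leaf. Qed.

Lemma fpt_false A : @fpt A bool_ty (fun _ _ => false).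
Proof. by apply: fpt_leaf. Qed.

Lemma fpt_true A : @fpt A bool_ty (fun _ _ => true).
Proof. by apply: (fpt_cast (fpt_pair (fpt_tt A) (fpt_tt A))). Qed.

Lemma fpt_none A B : @fpt A (opt_ty B) (fun _ _ => None).
Proof. by apply: fpt_leaf. Qed.

Lemma fpt_some A B (F : forall I, car A I -> car B I) : fpt F -> @fpt A (opt_ty B) (fun I x => Some (F I x)).
Proof. by move=> h; apply: (fpt_cast (fpt_pair h (fpt_tt A))). Qed.

Lemma fpt_nil A B : @fpt A (seq_ty B) (fun _ _ => [::]).
Proof. by apply: fpt_leaf. Qed.

Lemma fpt_cons A B (F : forall I, car A I -> car B I) (G : forall I, car A I -> car (seq_ty B) I) :
  fpt F -> fpt G -> @fpt A (seq_ty B) (fun I x => F I x :: G I x).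
Proof. by move=> hF hG; apply: (fpt_cast (fpt_pair hF hG)). Qed.

Lemma fpt_neg A (F : forall I, car A I -> car bool_ty I) : fpt F -> @fpt A bool_ty (fun I x => ~~ F I x).
Proof. by move=> h; apply: (fpt_cast (fpt_if h (fpt_false A) (fpt_true A))) => I x; case: (F I x). Qed.

Lemma fpt_and A (F G : forall I, car A I -> car bool_ty I) :
  fpt F -> fpt G -> @fpt A bool_ty (fun I x => F I x && G I x).
Proof. by move=> hF hG; apply: (fpt_cast (fpt_if hF hG (fpt_false A))). Qed.

Lemma fpt_or A (F G : forall I, car A I -> car bool_ty I) :
  fpt F -> fpt G -> @fpt A bool_ty (fun I x => F I x || G I x).
Proof. by move=> hF hG; apply: (fpt_cast (fpt_if hF (fpt_true A) hG)). Qed.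

Lemma fpt_eq0 : @fpt (prod_ty vtx_ty vtx_ty) bool_ty (fun I x => x.1 == x.2).
Proof.
apply: (@fpt_base _ _ _
  (fun d => Case (Fst Arg)
     (Case (Snd Arg) (MkNode MkNil MkNil) MkNil)
     (Case (Snd (Snd (Var 2))) MkNil
        (Call d (Gl 4 (MkNode (Var 3) (Var 1))))))
  (fun _ => MkNil)).
exists 10 => P d e _.
have main g a b : evt P [:: Node g (Node (enc_nat a) (enc_nat b))]
    (nth MkNil P d) (enc_bool (a == b)) (a.+1 * 100).
  elim: a b => [|a IH] [|b] /=; rewrite e.
  - eapply evt_le; first by apply: evt_case0; [ev | apply: evt_case0; ev].
    by lia.
  - eapply evt_le; first by apply: evt_case0; [ev | apply: evt_case1; ev].
    by lia.
  - eapply evt_le; first by apply: evt_case1; [ev | apply: evt_case0; ev].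
    by lia.
  - eapply evt_le.
      apply: evt_case1; [by ev|]; apply: evt_case1; [by ev|].
      eapply evt_call; [by ev | by apply: IH].
    by lia.
move=> I [a b]; apply: evt_le (main _ _ _) _.
apply: leq_trans (scale_loop I 0); rewrite expn0.
have := ltn_ord a; have := nvtx_le_scale I; rewrite /=; lia.
Qed.

Lemma fpt_eq A (F G : forall I, car A I -> car vtx_ty I) :
  fpt F -> fpt G -> @fpt A bool_ty (fun I x => F I x == G I x).
Proof. by move=> hF hG; apply: fpt_comp (fpt_pair hF hG) fpt_eq0. Qed.

Lemma fpt_nth0 B : @fpt (prod_ty (tab_ty B) vtx_ty) B (fun I x => x.1 x.2).
Proof.
apply: (@fpt_base _ _ _
  (fun d => Case (Snd Arg) (Fst (Fst Arg))
     (Call d (Gl 2 (MkNode (Snd (Fst (Snd (Var 2)))) (Var 1)))))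
  (fun _ => MkNil)).
exists 10 => P d e _.
have main g i l : i < size l -> evt P [:: Node g (Node (enc_seq l) (enc_nat i))]
    (nth MkNil P d) (nth Nil l i) (i.+1 * 100).
  elim: i l => [|i IH] [|a l] //= h; rewrite e.
  - by eapply evt_le; [apply: evt_case0; ev | lia].
  - eapply evt_le.
      apply: evt_case1; [by ev|].
      eapply evt_call; [by ev | by apply: IH].
    by lia.
move=> I [f v] /=.
have hs : v < size [seq enc I (f v0) | v0 <- enum 'I_(nvtx I)].
  by rewrite size_map size_enum_ord.
have := main (input I) v _ hs; rewrite (nth_map v) ?size_enum_ord // nth_ord_enum => h.
apply: evt_le h _.
apply: leq_trans (scale_loop I 0); rewrite expn0.
have := ltn_ord v; have := nvtx_le_scale I; rewrite /=; lia.
Qed.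

Lemma fpt_nth A B (F : forall I, car A I -> car (tab_ty B) I) (G : forall I, car A I -> car vtx_ty I) :
  fpt F -> fpt G -> @fpt A B (fun I x => F I x (G I x)).
Proof. by move=> hF hG; apply: fpt_comp (fpt_pair hF hG) (fpt_nth0 B). Qed.

Lemma fpt_mem A (F : forall I, car A I -> car set_ty I) (G : forall I, car A I -> car vtx_ty I) :
  fpt F -> fpt G -> @fpt A bool_ty (fun I x => G I x \in F I x).
Proof.
move=> hF hG.
have hF' : @fpt A (tab_ty bool_ty) (fun I x v => v \in F I x) by apply: (fpt_cast hF).
exact: fpt_nth hF' hG.
Qed.

(** The list of rows of the adjacency matrix has length [n] and serves as loop counter; the current
    vertex is generated alongside as the unary number [j]. *)
Lemma fpt_pmap A B (F : forall I, car (prod_ty A vtx_ty) I -> car (opt_ty B) I) :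
  fpt F ->
  @fpt A (seq_ty B) (fun I x => pmap (fun v => F I (x, v)) (enum 'I_(nvtx I))).
Proof.
move=> hF.
apply: (@link1 _ _ _ _ _ _
  (fun d i => Call d.+1 (Gl 0 (MkNode (Snd (Fst (Var 0))) (MkNode MkNil Arg))))
  (fun d i => Case (Fst Arg) MkNil
     (Let (Call d.+1 (Gl 2 (MkNode (Var 1)
              (MkNode (MkNode MkNil (Fst (Snd (Snd (Var 2))))) (Snd (Snd (Snd (Var 2))))))))
       (Case (Call i (Gl 3 (MkNode (Snd (Snd (Snd (Var 3)))) (Fst (Snd (Snd (Var 3)))))))
          (Var 0) (MkNode (Var 0) (Var 2)))))
  hF) => c1.
exists (c1 + 10 + 8 + 8) => P d i e1 e2 k I x.
have main (s : seq 'I_(nvtx I)) (r : 'I_(nvtx I) -> tree) j :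
   map val s = iota j (size s) ->
   evt P [:: Node (input I) (Node (enc_seq (map r s)) (Node (enc_nat j) (enc I x)))]
     (nth MkNil P d.+1) (enc (t:=seq_ty B) I (pmap (fun v => F I (x, v)) s))
     ((size s).+1 * (scale I ^ c1 + 100)).
  elim: s j => [|v s IH] j /=; rewrite e2.
    by move=> _; eapply evt_le; [apply: evt_case0; ev | lia].
  case=> hv hs.
  have hF1 := k I (x, v); rewrite /= hv in hF1.
  have IH' := IH j.+1 hs.
  case E : (F I (x, v)) hF1 => [y|] hF1 /=.
  - eapply evt_le.
      apply: evt_case1; [by ev|]; apply: evt_let.
        by eapply evt_call; [ev | apply: IH'].
      apply: evt_case1; last by ev.
      by eapply evt_call; [ev | apply: hF1].
    by lia.
  - eapply evt_le.
      apply: evt_case1; [by ev|]; apply: evt_let.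
        by eapply evt_call; [ev | apply: IH'].
      apply: evt_case0; last by ev.
      by eapply evt_call; [ev | apply: hF1].
    by lia.
rewrite e1; eapply evt_le.
  eapply evt_call; first by rewrite /input /enc_input; ev.
  by apply: (main (enum 'I_(nvtx I)) _ 0); rewrite val_enum_ord size_enum_ord.
rewrite size_enum_ord.
apply: leq_trans (scale_expD I (c1 + 10) 8).
apply: leq_trans (_ : (scale I).+1 * (scale I ^ c1 + 100) + 100 + 100 <= _).
  have : (nvtx I).+1 * (scale I ^ c1 + 100) <= (scale I).+1 * (scale I ^ c1 + 100).
    by rewrite leq_mul // ltnS nvtx_le_scale.
  lia.
by have := scale_loop I c1; lia.
Qed.

Lemma fpt_tab A B (F : forall I, car A I -> 'I_(nvtx I) -> car B I) :
  @fpt (prod_ty A vtx_ty) B (fun I p => F I p.1 p.2) ->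
  @fpt A (tab_ty B) (fun I x v => F I x v).
Proof.
move=> /fpt_some/fpt_pmap h; apply: (fpt_cast h) => I x /=.
by elim: (enum _) => //= v s ->.
Qed.

Lemma fpt_set A (F : forall I, car A I -> 'I_(nvtx I) -> bool) :
  @fpt (prod_ty A vtx_ty) bool_ty (fun I p => F I p.1 p.2) ->
  @fpt A set_ty (fun I x => [set v | F I x v]).
Proof.
move=> /(@fpt_tab _ bool_ty) h; apply: (fpt_cast h) => I x /=; rewrite /enc_set; congr enc_seq.
by apply: eq_map => v; rewrite inE.
Qed.

Lemma fpt_ohead A B (F : forall I, car A I -> car (seq_ty B) I) :
  fpt F -> @fpt A (opt_ty B) (fun I x => ohead (F I x)).
Proof.
move=> h; suff h0 : @fpt (seq_ty B) (opt_ty B) (fun I s => ohead s) by exact: fpt_comp h h0.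
apply: (@fpt_base _ _ _ (fun _ => Case Arg MkNil (MkNode (Var 0) MkNil)) (fun _ => MkNil)).
exists 8 => P d e _ I [|y s] /=; rewrite e; eapply evt_le.
- by apply: evt_case0; ev.
- by have := scale_const I; lia.
- by apply: evt_case1; ev.
- by have := scale_const I; lia.
Qed.

Lemma pmap_some_if T (p : pred T) U (f : T -> U) (s : seq T) :
  pmap (fun v => if p v then Some (f v) else None) s = [seq f v | v <- s & p v].
Proof. by elim: s => //= v s ->; case: (p v). Qed.

Lemma fpt_seq A B (S : forall I, car A I -> {set 'I_(nvtx I)})
    (F : forall I, car A I -> 'I_(nvtx I) -> car B I) :
  @fpt A set_ty S -> @fpt (prod_ty A vtx_ty) B (fun I p => F I p.1 p.2) ->
  @fpt A (seq_ty B) (fun I x => [seq F I x v | v <- enum (S I x)]).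
Proof.
move=> hS hF.
have h1 : @fpt (prod_ty A vtx_ty) bool_ty (fun I x => x.2 \in S I x.1).
  apply: fpt_mem; last exact: fpt_snd (@fpt_id _).
  by apply: fpt_comp (fpt_fst (@fpt_id _)) hS.
have := fpt_pmap (fpt_if h1 (fpt_some hF) (fpt_none _ _)).
move=> h; apply: (fpt_cast h) => I x /=.
by rewrite pmap_some_if [in RHS]/enum_mem -enumT.
Qed.

Lemma fpt_pick A (F : forall I, car A I -> 'I_(nvtx I) -> bool) :
  @fpt (prod_ty A vtx_ty) bool_ty (fun I p => F I p.1 p.2) ->
  @fpt A (opt_ty vtx_ty) (fun I x => [pick v | F I x v]).
Proof.
move=> h; have := fpt_ohead (fpt_pmap (fpt_if h (fpt_some (fpt_snd (@fpt_id _))) (fpt_none _ _))).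
move=> h'; apply: (fpt_cast h') => I x /=.
by rewrite (pmap_some_if (fun v => F I x v) (fun v => v)) map_id /pick [in RHS]/enum_mem -enumT.
Qed.

Lemma fpt_ex A (F : forall I, car A I -> 'I_(nvtx I) -> bool) :
  @fpt (prod_ty A vtx_ty) bool_ty (fun I p => F I p.1 p.2) ->
  @fpt A bool_ty (fun I x => [exists v, F I x v]).
Proof.
move=> h.
have h' := @fpt_opt A vtx_ty bool_ty _ _ (fun I _ _ => true) (fpt_pick h) (fpt_false _) (fpt_true _).
apply: (fpt_cast h') => I x.
case: pickP => [v hv|hv]; congr enc_bool; apply/esym.
- by apply/existsP; exists v.
- by apply/existsP => -[v]; rewrite hv.
Qed.

Lemma fpt_arcs0 A : @fpt A (tab_ty set_ty) (fun I _ u => [set v | @arcs I u v]).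
Proof.
apply: (@fpt_base _ _ _ (fun _ => Snd (Fst (Var 0))) (fun _ => MkNil)).
exists 8 => P d e _ I x; rewrite e; eapply evt_le; first by rewrite /input /enc_input; ev.
by have := scale_const I; lia.
Qed.

Lemma fpt_arcs A (F G : forall I, car A I -> car vtx_ty I) :
  fpt F -> fpt G -> @fpt A bool_ty (fun I x => @arcs I (F I x) (G I x)).
Proof.
move=> hF hG; apply: (fpt_cast (fpt_mem (fpt_nth (fpt_arcs0 A) hF) hG)) => I x.
by rewrite inE.
Qed.

Lemma fpt_param A : @fpt A (cst_ty param) (fun _ _ => tt).
Proof.
apply: (@fpt_base _ _ _ (fun _ => Fst (Fst (Var 0))) (fun _ => MkNil)).
exists 8 => P d e _ I x; rewrite e; eapply evt_le; first by rewrite /input /enc_input; ev.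
by have := scale_const I; lia.
Qed.

Lemma fpt_cst_pred A m : @fpt A (cst_ty m) (fun _ _ => tt) ->
  @fpt A (cst_ty (fun I => (m I).-1)) (fun _ _ => tt).
Proof.
move=> h.
have h1 : @fpt (cst_ty m) (cst_ty (fun I => (m I).-1)) (fun _ _ => tt).
  apply: (@fpt_base _ _ _ (fun _ => Case Arg MkNil (Var 1)) (fun _ => MkNil)).
  exists 8 => P d e _ I [] /=; rewrite e; case: (m I) => [|m'] /=; eapply evt_le.
  - by apply: evt_case0; ev.
  - by have := scale_const I; lia.
  - by apply: evt_case1; ev.
  - by have := scale_const I; lia.
exact: fpt_comp h h1.
Qed.

Lemma fpt_cst_add A m1 m2 : (forall I, m1 I <= scale I) ->
  @fpt A (cst_ty m1) (fun _ _ => tt) -> @fpt A (cst_ty m2) (fun _ _ => tt) ->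
  @fpt A (cst_ty (fun I => m1 I + m2 I)) (fun _ _ => tt).
Proof.
move=> hm h1 h2.
have h : @fpt (prod_ty (cst_ty m1) (cst_ty m2)) (cst_ty (fun I => m1 I + m2 I)) (fun _ _ => tt).
  apply: (@fpt_base _ _ _
    (fun d => Case (Fst Arg) (Snd Arg)
       (MkNode MkNil (Call d (Gl 2 (MkNode (Var 1) (Snd (Snd (Var 2))))))))
    (fun _ => MkNil)).
  exists 10 => P d e _ I [[] []] /=.
  have main a b : evt P [:: Node (input I) (Node (enc_nat a) (enc_nat b))]
      (nth MkNil P d) (enc_nat (a + b)) (a.+1 * 100).
    elim: a => [|a IH]; rewrite e.
      by eapply evt_le; [apply: evt_case0; ev | lia].
    eapply evt_le.
      apply: evt_case1; [by ev|]; apply: evt_node; [by ev|].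
      by eapply evt_call; [ev | apply: IH].
    by lia.
  apply: evt_le (main _ _) _; apply: leq_trans (scale_loop I 0); rewrite expn0.
  by have := hm I; nia.
exact: fpt_comp (fpt_pair h1 h2) h.
Qed.

Lemma fpt_card_lt A (m : inst -> nat) (F : forall I, car A I -> car set_ty I) :
  @fpt A (cst_ty m) (fun _ _ => tt) -> fpt F ->
  @fpt A bool_ty (fun I x => #|F I x| < m I).
Proof.
move=> hm hF.
have h : @fpt (prod_ty set_ty (cst_ty m)) bool_ty (fun I x => #|x.1| < m I).
  apply: (@fpt_base _ _ _
    (fun d => Case (Fst Arg) (Case (Snd Arg) MkNil (MkNode MkNil MkNil))
       (Case (Var 0) (Call d (Gl 2 (MkNode (Var 1) (Snd (Snd (Var 2))))))
          (Case (Snd (Snd (Var 4))) MkNil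
             (Call d (Gl 6 (MkNode (Var 5) (Var 1)))))))
    (fun _ => MkNil)).
  exists 10 => P d e _ I [S []] /=.
  have main s b : evt P [:: Node (input I) (Node (enc_seq (map enc_bool s)) (enc_nat b))]
      (nth MkNil P d) (enc_bool (count id s < b)) ((size s).+1 * 100).
    elim: s b => [|[] s IH] b; rewrite e /=.
    - case: b => [|b]; eapply evt_le.
      + by apply: evt_case0; [ev | apply: evt_case0; ev].
      + by lia.
      + by apply: evt_case0; [ev | apply: evt_case1; ev].
      + by lia.
    - case: b => [|b]; eapply evt_le.
      + by apply: evt_case1; [ev|]; apply: evt_case1; [ev|]; apply: evt_case0; ev.
      + by lia.
      + apply: evt_case1; [by ev|]; apply: evt_case1; [by ev|]; apply: evt_case1; [by ev|].
        by eapply evt_call; [ev | apply: IH].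
      + by lia.
    - eapply evt_le.
        apply: evt_case1; [by ev|]; apply: evt_case0; [by ev|].
        by eapply evt_call; [ev | apply: IH].
      by lia.
  have -> : #|S| = count id [seq x \in S | x <- enum 'I_(nvtx I)].
    by rewrite count_map -size_filter cardE; congr size; rewrite [in LHS]/enum_mem -enumT; apply: eq_filter.
  rewrite /enc_set map_comp; apply: evt_le (main _ _) _.
  apply: leq_trans (scale_loop I 0); rewrite expn0 size_map size_enum_ord.
  by have := nvtx_le_scale I; nia.
exact: fpt_comp (fpt_pair hF hm) h.
Qed.

(** As in [fpt_pmap], the adjacency rows count the rounds. *)
Lemma fpt_iter0 A (F : forall I, car A I -> car A I) :
  fpt F -> fpt (fun I x => iter (nvtx I) (F I) x).
Proof.
move=> hF.
apply: (@link1 _ _ _ _ _ _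
  (fun d i => Call d.+1 (Gl 0 (MkNode (Snd (Fst (Var 0))) Arg)))
  (fun d i => Case (Fst Arg) (Snd Arg)
     (Call d.+1 (Gl 2 (MkNode (Var 1) (Call i (Gl 2 (Snd (Snd (Var 2)))))))))
  hF) => c1.
exists (c1 + 10 + 8 + 8) => P d i e1 e2 k I x.
have main (s : seq tree) y :
   evt P [:: Node (input I) (Node (enc_seq s) (enc I y))]
     (nth MkNil P d.+1) (enc I (iter (size s) (F I) y))
     ((size s).+1 * (scale I ^ c1 + 100)).
  elim: s y => [|a s IH] y; rewrite e2.
    by eapply evt_le; [apply: evt_case0; ev | lia].
  rewrite [size _]/= iterSr; eapply evt_le.
    apply: evt_case1; [by ev|].
    eapply evt_call; last by apply: IH.
    apply: evt_node; first by ev.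
    apply: evt_node; first by ev.
    by eapply evt_call; [ev | apply: k].
  by lia.
have := main [seq enc_set [set y | arcs x0 y] | x0 <- enum 'I_(nvtx I)] x.
rewrite size_map size_enum_ord => {}main.
rewrite e1; eapply evt_le.
  eapply evt_call; last by apply: main.
  by rewrite /input /enc_input; ev.
apply: leq_trans (scale_expD I (c1 + 10) 8).
apply: leq_trans (_ : (scale I).+1 * (scale I ^ c1 + 100) + 100 + 100 <= _).
  have : (nvtx I).+1 * (scale I ^ c1 + 100) <= (scale I).+1 * (scale I ^ c1 + 100).
    by rewrite leq_mul // ltnS nvtx_le_scale.
  lia.
by have := scale_loop I c1; lia.
Qed.

(** The number of rounds is written as a cardinal to match algorithms defined over an arbitrary
    finite type. *)
Lemma fpt_iter E A (S : forall I, car E I -> car A I -> car A I)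
    (X : forall I, car E I -> car A I) :
  @fpt (prod_ty E A) A (fun I p => S I p.1 p.2) -> fpt X ->
  @fpt E A (fun I x => iter #|'I_(nvtx I)| (S I x) (X I x)).
Proof.
move=> hS hX.
have h1 : @fpt (prod_ty E A) (prod_ty E A) (fun I p => (p.1, S I p.1 p.2)).
  by apply: fpt_pair hS; apply: fpt_fst (@fpt_id _).
have := fpt_snd (fpt_comp (fpt_pair (@fpt_id E) hX) (fpt_iter0 h1)) => h.
apply: (fpt_cast h) => I x; rewrite card_ord; congr enc.
suff -> n : iter n (fun p : car E I * car A I => (p.1, S I p.1 p.2)) (x, X I x) =
    (x, iter n (S I x) (X I x)) by [].
by elim: n => //= n ->.
Qed.

(** * Depth-first search of bounded depth *)

Section Search.

Variables (St : Type) (final : St -> bool) (succ : St -> seq St).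

(** The fuel bounds the depth only: siblings are visited with the same fuel. *)
Fixpoint search (f : nat) : seq St -> option St :=
  fix go l :=
    if f is f'.+1 then
      if l is h :: t then
        if final h then Some h
        else if search f' (succ h) is Some r then Some r else go t
      else None
    else None.

Lemma searchP f l :
  search f l = if f is f'.+1 then
      if l is h :: t then
        if final h then Some h
        else if search f' (succ h) is Some r then Some r else search f t
      else None
    else None.
Proof. by case: f l => [|f] [|h t]. Qed.

Lemma search_sound (Inv : St -> Prop) f l r :
  (forall s s', Inv s -> ~~ final s -> List.In s' (succ s) -> Inv s') ->
  (forall s, List.In s l -> Inv s) ->
  search f l = Some r -> Inv r /\ final r.
Proof.
move=> hI; elim: f l => [|f IHf] [|h t] //.
elim: t h => [|a t IHt] h hl; rewrite searchP.
  case hh : (final h); first by case=> <-; split => //; apply: hl; left.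
  case E: search => [r'|] // er; rewrite er in E; apply: IHf E => s hs.
  by apply: hI hs; [apply: hl; left | rewrite hh].
case hh : (final h); first by case=> <-; split => //; apply: hl; left.
case E: search => [r'|]; last by apply: IHt => s hs; apply: hl; right.
move=> er; rewrite er in E; apply: IHf E => s hs.
by apply: hI hs; [apply: hl; left | rewrite hh].
Qed.

(** [C m s] promises a final state at depth at most [m] below [s]; one successor has to inherit the
    promise with a smaller [m]. The search may still succeed earlier on another branch. *)
Lemma search_complete (C : nat -> St -> Prop) f l s m :
  (forall m s, C m s -> ~~ final s ->
     exists s' m', [/\ List.In s' (succ s), m' < m & C m' s']) ->
  List.In s l -> C m s -> m < f -> search f l <> None.
Proof.
move=> hC; elim: f l s m => [|f IHf] // l s m hs hm hf.
elim: l hs => // h t IHt [->|hs]; rewrite searchP.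
  case hh : (final s) => //.
  have [s' [m' [h1 h2 h3]]] := hC _ _ hm (negbT hh).
  have := IHf _ _ _ h1 h3 (leq_trans h2 hf).
  by case: search.
by case: (final h) => //; case: (search f) => //; apply: IHt.
Qed.

End Search.

Lemma fpt_search St (b f : inst -> nat) e
    (final : forall I, car St I -> car bool_ty I)
    (succ : forall I, car St I -> car (seq_ty St) I) :
  fpt final -> fpt succ ->
  (forall I s, size (succ I s) <= b I) ->
  (forall I, (b I).+2 ^ (f I) <= scale I ^ e) ->
  @fpt (prod_ty (cst_ty f) St) (opt_ty St)
     (fun I x => search (final I) (succ I) (f I) [:: x.2]).
Proof.
move=> hF hS hb hf.
apply: (@link _ _ _ _ _ _ _ _ _
  (fun d i j => Call d.+1 (Gl 0 (MkNode (Fst Arg) (MkNode (Snd Arg) MkNil))))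
  (fun d i j => Case (Fst Arg) MkNil
     (Case (Snd (Snd (Var 2))) MkNil
        (Case (Call i (Gl 4 (Var 0)))
           (Let (Call d.+1 (Gl 4 (MkNode (Var 3) (Call j (Gl 4 (Var 0))))))
              (Case (Var 0)
                 (Call d.+1 (Gl 5 (MkNode (Fst (Snd (Var 5))) (Var 2))))
                 (Var 2)))
           (MkNode (Var 2) MkNil))))
  hF hS) => c1 c2.
exists ((c1 + c2 + 8 + 8 + 8 + e) + (c1 + c2 + 8 + 8 + 8 + e) + 8) => P d i1 i2 e1 e2 k1 k2 I [[] x].
set K := scale I ^ c1 + scale I ^ c2 + 300.
(* The base exceeds the branching by two: a node pays [K] for itself, and the list of its at most
   [b] successors counts one more for its end. *)
have main n l : evt P [:: Node (input I) (Node (enc_nat n) (enc (t:=seq_ty St) I l))]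
     (nth MkNil P d.+1) (enc (t:=opt_ty St) I (search (final I) (succ I) n l))
     ((size l).+1 * (K * (b I).+2 ^ n)).
  elim: n l => [|n IHn] l.
    rewrite e2 searchP /=; eapply evt_le; first by apply: evt_case0; ev.
    by rewrite /K muln1; nia.
  have pos : 0 < (b I).+2 ^ n by rewrite expn_gt0.
  elim: l => [|h t IHt].
    rewrite e2 searchP /=; eapply evt_le.
      by apply: evt_case1; [ev|]; apply: evt_case0; ev.
    by rewrite expnS /K; nia.
  have hfin := k1 I h; have hsuc := k2 I h.
  rewrite e2 searchP [size _]/=.
  have hn : (size (succ I h)).+1 * (K * (b I).+2 ^ n) <= (b I).+1 * (K * (b I).+2 ^ n).
    by rewrite leq_mul2r ltnS hb orbT.
  have hK : K <= K * (b I).+2 ^ n by rewrite leq_pmulr.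
  case: (final I h) hfin => hfin.
    eapply evt_le.
      apply: evt_case1; [by ev|]; apply: evt_case1; [by ev|]; apply: evt_case1; last by ev.
      by eapply evt_call; [ev | apply: hfin].
    by rewrite expnS; move: hK; rewrite /K; nia.
  case E: (search _ _ n (succ I h)) => [r|].
    eapply evt_le.
      apply: evt_case1; [by ev|]; apply: evt_case1; [by ev|]; apply: evt_case0.
        by eapply evt_call; [ev | apply: hfin].
      apply: evt_let.
        eapply evt_call; last by [have := IHn (succ I h); rewrite E; apply].
        apply: evt_node; [by ev|]; apply: evt_node; [by ev|].
        by eapply evt_call; [ev | apply: hsuc].
      by apply: evt_case1; ev.
    rewrite expnS; move: hn hK; rewrite {1 3}/K; set X := K * _; set Y := size _.
    by rewrite mulnCA -/X => *; nia.
  eapply evt_le.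
    apply: evt_case1; [by ev|]; apply: evt_case1; [by ev|]; apply: evt_case0.
      by eapply evt_call; [ev | apply: hfin].
    apply: evt_let.
      eapply evt_call; last by [have := IHn (succ I h); rewrite E; apply].
      apply: evt_node; [by ev|]; apply: evt_node; [by ev|].
      by eapply evt_call; [ev | apply: hsuc].
    apply: evt_case0; [by ev|].
    by eapply evt_call; [ev | apply: IHt].
  rewrite expnS [K * (_ * _)]mulnCA; move: hn hK; set X := K * _.
  have -> : K = scale I ^ c1 + scale I ^ c2 + 300 by [].
  by nia.
rewrite e1; eapply evt_le.
  by eapply evt_call; [ev | apply: (main (f I) [:: x])].
rewrite /K.
have hA : scale I ^ c1 + scale I ^ c2 + 300 <= scale I ^ (c1 + c2 + 8 + 8 + 8).
  have := scale_expD I c1 c2; have := scale_expD I (c1 + c2 + 8) 8.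
  by have := scale_const I; lia.
have hM := leq_mul hA (hf I); rewrite -expnD in hM.
have := scale_expD I (c1 + c2 + 8 + 8 + 8 + e) (c1 + c2 + 8 + 8 + 8 + e).
by rewrite [size _]/=; lia.
Qed.

(** * Furthest minimum cuts *)

Definition outN (V : finType) (G : rel V) (X : {set V}) : {set V} :=
  [set y | (y \notin X) && [exists x, (x \in X) && G x y]].

Section MinCut.

Variables (V : finType) (G : rel V) (A U : {set V}).

Implicit Types (S X Y : {set V}) (M : V -> option V).

(* Minimum cuts as Hall deficiencies: for [X] disjoint from [A], [#|outN G (A :|: X)| - #|outN G A|] is [#|NH X| - #|X|], where [NH X] is the neighbourhood of [X] in the bipartite graph [hedge]. A matching maps a right vertex to its left mate. *)
Definition hedge x w := [&& w \notin A, w \notin outN G A & (w == x) || G x w].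

Definition okw M S w := if M w is Some y then y \in S else true.

(** One backward step of alternating reachability: some neighbour of [x] is unmatched or has its
    mate in [S]. *)
Definition qstep M S : {set V} :=
  [set x | [&& x \notin A, x \notin U & [exists w, hedge x w && okw M S w]]].

Definition free M x :=
  [&& x \notin A, x \notin U & ~~ [exists w, if M w is Some y then y == x else false]].

Definition low_step M S :=
  if [exists a, free M a && (a \in qstep M S)] then S else qstep M S.

(* the left vertices at alternating distance less than that of every free vertex *)
Definition low M := iter #|V| (low_step M) set0.

(** The first edge of a shortest augmenting path: a nearest free vertex [a] takes over [w]. Either
    [w] was unmatched and the matching grows, or the former mate of [w] becomes free at a smaller
    distance. *)
Definition rotate M : V -> option V :=
  if [pick a | free M a && (a \in qstep M (low M))] is Some a then
    if [pick w | hedge a w && okw M (low M) w] is Some w then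
      fun w' => if w' == w then Some a else M w'
    else M
  else M.

(** The additional call makes [#|V|.+1] rotations. [matching] repeats this equally often, and the
    square of [#|V|.+1] exceeds every potential. *)
Definition rotates M := rotate (iter #|V| rotate M).

Definition matching := rotates (iter #|V| rotates (fun _ => None)).

(* [Q] is the set of left vertices with an alternating path to an unmatched right vertex. *)
Definition maxside : {set V} :=
  let Q := iter #|V| (qstep matching) set0 in
  [set x | (x \in A) || (x \notin U) && (x \notin Q)].

Let Q M i := iter i (qstep M) set0.
Let n := #|V|.

Lemma qstep_mono M S S' : S \subset S' -> qstep M S \subset qstep M S'.
Proof.
move=> /subsetP h; apply/subsetP => x; rewrite !inE => /and3P[-> -> /existsP[w /andP[h1 h2]]] /=.
by apply/existsP; exists w; rewrite h1 /=; move: h2; rewrite /okw; case: (M w) => // y /h.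
Qed.

Lemma QS M i : Q M i \subset Q M i.+1.
Proof. by elim: i => [|i IH]; [exact: sub0set | exact: qstep_mono]. Qed.

Lemma Q_le M i j : i <= j -> Q M i \subset Q M j.
Proof.
move=> /subnK <-; elim: (j - i) => [|m IH]; first by rewrite add0n.
rewrite addSn.
exact: subset_trans IH (QS _ _).
Qed.

Lemma Q_fix M : Q M n.+1 = Q M n.
Proof. by have := @fixsetK _ (qstep M); apply => S S'; apply: qstep_mono. Qed.

Lemma Q_le_n M i : Q M i \subset Q M n.
Proof.
elim: i => [|i IH]; first exact: sub0set.
by rewrite -Q_fix; apply: qstep_mono.
Qed.

Definition freeQ M i := [exists a, free M a && (a \in Q M i)].

Lemma lowE M : exists i, [/\ i <= n, low M = Q M i,
  forall j, j <= i -> ~~ freeQ M j & freeQ M i.+1 \/ ~~ freeQ M n].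
Proof.
suff: forall m, exists i, [/\ i <= m, iter m (low_step M) set0 = Q M i,
  forall j, j <= i -> ~~ freeQ M j & freeQ M i.+1 \/ i = m].
  move=> /(_ n) [i [h1 h2 h3 h4]]; exists i; split=> //.
  by case: h4 => h4; [left | right; rewrite -h4 h3].
elim=> [|m [i [h1 h2 h3 h4]]].
  exists 0; split=> // [|]; last by right.
  by move=> j; rewrite leqn0 => /eqP->; apply/existsP => -[a]; rewrite inE andbF.
rewrite iterS h2 /low_step -/(Q M i.+1) -/(freeQ M i.+1).
case: ifP => h.
  by exists i; split=> //; [apply: leq_trans h1 _ | left].
case: h4 => h4; first by rewrite h4 in h.
exists i.+1; split=> //; last by right; rewrite h4.
by move=> j; rewrite leq_eqVlt => /orP[/eqP->|/h3 //]; rewrite h.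
Qed.

Definition is_matching M :=
  (forall w x, M w = Some x -> [&& x \notin A, x \notin U & hedge x w]) /\
  (forall w w' x, M w = Some x -> M w' = Some x -> w = w').

(** Lexicographic: first the size of the matching, then the nearness of the free vertices. The
    layers increase, so those containing a free vertex form a final segment of the indices. *)
Definition potential M :=
  #|[set w | isSome (M w)]| * n.+1 + #|[set i : 'I_n.+1 | freeQ M i]|.

Lemma freeQ_card M : #|[set i : 'I_n.+1 | freeQ M i]| <= n.
Proof.
rewrite -ltnS -[X in _ < X]card_ord -cardsT; apply/proper_card/properP.
split; first exact: subsetT.
by exists ord0 => //; rewrite !inE; apply/existsP => -[a]; rewrite inE andbF.
Qed.

Lemma potential_ub M : potential M < n.+1 * n.+1.
Proof.
have h1 : #|[set w | isSome (M w)]| <= n by apply: max_card.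
have h2 := freeQ_card M.
by rewrite /potential; nia.
Qed.

Lemma freeP M x : reflect ([/\ x \notin A, x \notin U & forall w, M w <> Some x]) (free M x).
Proof.
apply: (iffP and3P) => -[h1 h2 h3]; split=> //.
  by move=> w hw; case/negP: h3; apply/existsP; exists w; rewrite hw.
by apply/existsP => -[w]; case E: (M w) => [y|] // /eqP e; apply: (h3 w); rewrite E e.
Qed.

Lemma rotate_matching M : is_matching M -> is_matching (rotate M).
Proof.
move=> hM; rewrite /rotate; case: pickP => [a|] // ha.
case: pickP => [w|] // hw; case: hM => h1 h2.
have /andP[/freeP[a1 a2 a3] _] := ha; have /andP[w1 _] := hw.
split=> [w' x|w' w'' x].
  by case: eqP => [-> [<-]|_ /h1 //]; rewrite a1 a2.
case: eqP => [->|_]; case: eqP => [->|_] //; last exact: h2.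
- by case=> <- /a3.
- by move=> e [ax]; case: (a3 w'); rewrite ax.
Qed.

Lemma rotate_stable M : ~~ freeQ M n -> rotate M = M.
Proof.
move=> h; rewrite /rotate; case: pickP => [a /andP[h1 h2]|//].
case: (lowE M) => i [hi hl _ _]; case/negP: h; apply/existsP; exists a.
rewrite h1; have /subsetP := Q_le_n M i.+1; apply.
by rewrite /= -hl.
Qed.

Lemma rotate_potential M : is_matching M -> freeQ M n ->
  potential M < potential (rotate M).
Proof.
move=> [hM1 hM2] hn; rewrite {2}/potential /rotate.
case: (lowE M) => i [hi hl hlow [hi1|]]; last by rewrite hn.
case: pickP => [a|/(_ _) none]; last first.
  by case/existsP: hi1 => a; rewrite -[Q M i.+1]/(qstep M (Q M i)) -hl none.
move=> /andP[/freeP[a1 a2 a3]]; rewrite hl => ha.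
case: pickP => [w|none]; last first.
  by move: ha; rewrite inE => /and3P[_ _ /existsP[w]]; rewrite none.
move=> /andP[hw]; pose M' w' := if w' == w then Some a else M w'; rewrite -/M'.
(* If [w] was unmatched, the gain of [n.+1] outweighs any loss in the second summand, which is at
   most [n]. *)
case E: (M w) => [y|] hy; last first.
  have : [set w' | isSome (M' w')] = w |: [set w' | isSome (M w')].
    by apply/setP => w'; rewrite !inE /M'; case: eqP.
  move=> ->; rewrite cardsU1 inE E /=.
  have : #|[set i : 'I_n.+1 | freeQ M i]| < n.+1.
    by rewrite ltnS freeQ_card.
  by rewrite /potential; nia.
have -> : [set w' | isSome (M' w')] = [set w' | isSome (M w')].
  by apply/setP => w'; rewrite !inE /M'; case: eqP => // ->; rewrite E.
rewrite /potential ltn_add2l; apply/proper_card/properP.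
rewrite /okw E in hy.
have [j hj hjmin] : exists2 j, y \in Q M j & forall l, y \in Q M l -> j <= l.
  have ex : exists l, y \in Q M l by exists i.
  by exists (ex_minn ex); case: ex_minnP.
(* Layers up to [j] survive: only the mate of [w] changes, and [w] was of no use before its old mate
   [y] appeared in layer [j]. *)
have sub l : l <= j -> Q M l \subset Q M' l.
  elim: l => [|l IH] lj; first exact: sub0set.
  apply/subsetP => x; rewrite !inE => /and3P[-> -> /existsP[w' /andP[h1 h2]]] /=.
  apply/existsP; exists w'; rewrite h1 /=; move: h2; rewrite /okw /M'.
  case: eqP => [->|_].
    by rewrite E => /hjmin; rewrite leqNgt lj.
  by case: (M w') => // x'; apply: (subsetP (IH (ltnW lj))).
have fy : free M' y.
  have /and3P[y1 y2 _] := hM1 _ _ E.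
  apply/freeP; split=> // w'; rewrite /M'; case: eqP => [_ [ay]|ne h].
    by case: (a3 w); rewrite ay.
  by apply: ne; apply: hM2 h E.
(* Thus [y], now free, lies in layer [i], where no vertex was free before. *)
have fi l : i <= l -> freeQ M' l.
  move=> hil; apply/existsP; exists y; rewrite fy /=.
  have /subsetP := Q_le M' (leq_trans (hjmin _ hy) hil); apply.
  exact: (subsetP (sub _ (leqnn j))).
split.
  apply/subsetP => l; rewrite !inE => hl'; apply: fi.
  by rewrite leqNgt; apply/negP => h; have := hlow l (ltnW h); rewrite hl'.
exists (Ordinal (hi : i < n.+1)); first by rewrite inE fi.
by rewrite inE /= hlow.
Qed.

Lemma iter_rotate m M : is_matching M ->
  is_matching (iter m rotate M) /\
  (m <= potential (iter m rotate M) \/ ~~ freeQ (iter m rotate M) n).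
Proof.
move=> hM; elim: m => [|m [h1 h2]]; first by split=> //; left.
split=> /=; first exact: rotate_matching.
case E: (freeQ (iter m rotate M) n).
  by left; case: h2; rewrite ?E // => h; apply: leq_ltn_trans h (rotate_potential h1 E).
by right; rewrite rotate_stable E.
Qed.

Lemma matchingE : matching = iter (n.+1 * n.+1) rotate (fun _ => None).
Proof.
have h m M : iter m rotates M = iter (m * n.+1) rotate M.
  elim: m => // m IH; rewrite iterS IH /rotates mulSn iterD -/n.
  by rewrite -[n.+1]/(1 + n) iterD.
by rewrite /matching -iterS h.
Qed.

Lemma matching_max : is_matching matching /\ ~~ freeQ matching n.
Proof.
have h0 : is_matching (fun _ => None) by [].
have [h1 []] := iter_rotate (n.+1 * n.+1) h0; rewrite -matchingE in h1 * => h2; split=> //.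
by have := potential_ub matching; rewrite ltnNge h2.
Qed.

Let NH Y := [set w | [exists x, (x \in Y) && hedge x w]].

(** The closed out-neighbourhood of [A :|: Y] is the disjoint union of that of [A] and of [NH Y]. *)
Lemma card_outN_split Y : [disjoint Y & A] ->
  #|Y| + #|outN G (A :|: Y)| = #|outN G A| + #|NH Y|.
Proof.
move=> dis.
have cl S : #|S :|: outN G S| = #|S| + #|outN G S|.
  by rewrite cardsU disjoint_setI0 ?cards0 ?subn0 // disjoint_subset; apply/subsetP => x; rewrite !inE => ->.
have e : (A :|: Y) :|: outN G (A :|: Y) = (A :|: outN G A) :|: NH Y.
  apply/setP => w; rewrite !inE; case wA: (w \in A) => //=.
  case wN: [exists x, (x \in A) && G x w] => /=.
    case: (w \in Y) => //=.
    by case/existsP: wN => x /andP[h1 h2]; apply/existsP; exists x; rewrite inE h1.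
  apply/idP/existsP.
    case/orP => [wY|/andP[_ /existsP[x /andP[]]]].
      by exists w; rewrite wY /hedge wA !inE wA wN eqxx.
    rewrite inE => /orP[xA xw|xY xw].
      by case/existsP: wN; exists x; rewrite xA.
    by exists x; rewrite xY /hedge !inE wA wN xw orbT.
  case=> x /andP[xY /and3P[_ _ /orP[/eqP->|xw]]]; first by rewrite xY.
  by case: (w \in Y) => //=; apply/existsP; exists x; rewrite inE xY orbT.
have := cl (A :|: Y); rewrite e cardsU disjoint_setI0; last first.
  rewrite disjoint_subset; apply/subsetP => w; rewrite !inE => h.
  apply/existsP => -[x /andP[_ /and3P[h1 h2 _]]].
  by move: h h2; rewrite (negbTE h1) !inE h1 /= => ->.
rewrite cards0 subn0 cl cardsU disjoint_setI0; last by rewrite disjoint_sym.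
by rewrite cards0 subn0; lia.
Qed.

(** Koenig duality. Outside [A], the side [X] contains all free vertices, and [NH X] is matched into
    [X], since a neighbour that is unmatched or has its mate in [Q] would put its vertex into [Q].
    So the deficiency [#|X| - #|NH X|] is at least the number of free vertices, which bounds that of
    every competitor from above. *)
Lemma maxside_spec : [disjoint A & U] ->
  [/\ A \subset maxside, [disjoint maxside & U] &
   forall Y, A \subset Y -> [disjoint Y & U] ->
     #|outN G maxside| <= #|outN G Y| /\
     (~~ (Y \subset maxside) -> #|outN G maxside| < #|outN G Y|)].
Proof.
move=> disAU; have [[hM1 hM2] stable] := matching_max.
pose M := matching; rewrite -/M in hM1 hM2 stable.
have sA : A \subset maxside by apply/subsetP => x; rewrite !inE => ->.
have dU : [disjoint maxside & U].
  rewrite disjoint_subset; apply/subsetP => x; rewrite !inE => /orP[xA|/andP[]//].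
  by exact: (negbT (disjointFr disAU xA)).
split=> // Y AY YU.
pose F := [set x | free M x].
pose W Y := [set w | if M w is Some x then x \in Y else false].
have cW S : [disjoint S & A] -> [disjoint S & U] -> #|W S| = #|S :\: F|.
  move=> SA SU; pose f w := if M w is Some x then x else w.
  have -> : S :\: F = f @: W S.
    apply/setP => x; rewrite !inE; apply/andP/imsetP.
      case=> /freeP h xS; case E: [exists w, M w == Some x].
        case/existsP: E => w /eqP E; exists w; last by rewrite /f E.
        by rewrite inE E.
      case: h; split; [by rewrite (disjointFr SA) | by rewrite (disjointFr SU)|].
      by move=> w hw; case/existsP: E; exists w; rewrite hw.
    case=> w; rewrite inE /f; case E: (M w) => [y|] // yS ->; split=> //.
    by apply/freeP => -[_ _ /(_ w)].
  rewrite card_in_imset // => w w'; rewrite !inE /f.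
  case E: (M w) => [y|] // _; case E': (M w') => [y'|] // _ yy.
  by apply: hM2 E _; rewrite E' yy.
have WN S : [disjoint S & A] -> [disjoint S & U] -> W S \subset NH S.
  move=> SA SU; apply/subsetP => w; rewrite !inE; case E: (M w) => [x|] // xS.
  by apply/existsP; exists x; rewrite xS; have /and3P[_ _ ->] := hM1 _ _ E.
pose X := maxside :\: A.
have eX : maxside = A :|: X by rewrite /X setDE setUIr setUCr setIT; apply/esym/setUidPr.
have XA : [disjoint X & A] by rewrite disjoint_subset; apply/subsetP => x; rewrite !inE => /andP[].
have XU : [disjoint X & U] by apply: disjointWl dU; exact: subsetDl.
have XQ x : x \in X -> x \notin Q M n by rewrite !inE => /andP[/negbTE-> /= /andP[]].
have FX : F \subset X.
  apply/subsetP => x; rewrite inE => xF; have /freeP[h1 h2 h3] := xF.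
  rewrite !inE (negbTE h1) h2 /=; apply/negP => hQ; case/negP: stable.
  by apply/existsP; exists x; rewrite xF; apply: hQ.
have NX : NH X \subset W X.
  apply/subsetP => w; rewrite inE => /existsP[x /andP[xX hw]].
  have := XQ _ xX; rewrite -Q_fix inE => /negP nq.
  have xA : x \notin A by rewrite (disjointFr XA).
  have xU : x \notin U by rewrite (disjointFr XU).
  rewrite inE; case E: (M w) => [y|]; last first.
    case: nq; rewrite xA xU /=; apply/existsP; exists w.
    by rewrite hw /okw E.
  have /and3P[y1 y2 _] := hM1 _ _ E.
  rewrite !inE (negbTE y1) y2 /=; apply/negP => hy; case: nq; rewrite xA xU /=.
  by apply/existsP; exists w; rewrite hw /okw E.
have cX : #|NH X| + #|F| <= #|X|.
  have := subset_leq_card NX; rewrite cW // cardsD (setIidPr FX).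
  by have := subset_leq_card FX; clear; lia.
pose Y' := Y :\: A.
have eY : Y = A :|: Y' by rewrite /Y' setDE setUIr setUCr setIT; apply/esym/setUidPr.
have YA : [disjoint Y' & A] by rewrite disjoint_subset; apply/subsetP => x; rewrite !inE => /andP[].
have YU' : [disjoint Y' & U] by apply: disjointWl YU; exact: subsetDl.
have cY : #|Y'| <= #|W Y'| + #|F|.
  rewrite cW // cardsD; have := subset_leq_card (subsetIr Y' F).
  by have := subset_leq_card (subsetIl Y' F); clear; lia.
have cWN := subset_leq_card (WN Y' YA YU').
have e1 := card_outN_split XA; have e2 := card_outN_split YA.
rewrite -eX in e1; rewrite -eY in e2.
split; first by clear -e1 e2 cX cY cWN; lia.
(* A competitor [Y] that is also minimum has all of [NH Y'] matched into [Y']. A vertex of [Y'] in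
   layer [m.+1] would then have a neighbour whose mate is in [Y'] and in layer [m]; so [Y'] avoids
   [Q], that is, [Y] lies inside [maxside]. *)
move=> nsub; rewrite ltnNge; apply/negP => le.
have NW : NH Y' \subset W Y'.
  suff /eqP-> : W Y' == NH Y' by [].
  by rewrite eqEcard WN //=; clear -e1 e2 cX cY cWN le; lia.
case/negP: nsub; apply/subsetP => y yY; rewrite inE.
case yA: (y \in A) => //=; rewrite (disjointFr YU) //=.
have {yY yA}: y \in Y' by rewrite !inE yA.
suff: forall m z, z \in Y' -> z \notin Q M m by apply.
elim=> [|m IH] z zY; first by rewrite inE.
rewrite -[Q M m.+1]/(qstep M (Q M m)) inE; apply/and3P => -[_ _ /existsP[w /andP[h1 h2]]].
have : w \in W Y' by apply: (subsetP NW); rewrite inE; apply/existsP; exists z; rewrite zY.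
by rewrite inE; move: h2; rewrite /okw; case: (M w) => [x|//] xQ /IH; rewrite xQ.
Qed.

End MinCut.

(** Passing to closed out-neighbourhoods turns this into two inclusions: that of a union lies in the
    union, that of an intersection in the intersection. *)
Lemma card_outN_submod (V : finType) (G : rel V) (X Y : {set V}) :
  #|outN G (X :|: Y)| + #|outN G (X :&: Y)| <= #|outN G X| + #|outN G Y|.
Proof.
have cl S : #|S :|: outN G S| = #|S| + #|outN G S|.
  by rewrite cardsU disjoint_setI0 ?cards0 ?subn0 // disjoint_subset; apply/subsetP => x; rewrite !inE => ->.
have in_cl S x : (x \in S :|: outN G S) = (x \in S) || [exists y, (y \in S) && G y x].
  by rewrite !inE; case: (x \in S).
have h1 : #|(X :|: Y) :|: outN G (X :|: Y)| <= #|(X :|: outN G X) :|: (Y :|: outN G Y)|.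
  apply/subset_leq_card/subsetP => x; rewrite [in X in _ -> X]inE !in_cl inE.
  case/orP => [/orP[->|->]//|]; first by rewrite !orbT.
  case/existsP => y; rewrite inE => /andP[/orP[h|h] xy].
    by apply/orP; left; apply/orP; right; apply/existsP; exists y; rewrite h.
  by apply/orP; right; apply/orP; right; apply/existsP; exists y; rewrite h.
have h2 : #|(X :&: Y) :|: outN G (X :&: Y)| <= #|(X :|: outN G X) :&: (Y :|: outN G Y)|.
  apply/subset_leq_card/subsetP => x; rewrite [in X in _ -> X]inE !in_cl inE.
  case/orP => [/andP[-> ->]//|].
  case/existsP => y; rewrite inE => /andP[/andP[h h'] xy].
  by apply/andP; split; apply/orP; right; apply/existsP; exists y; rewrite ?h ?h'.
have := cardsUI (X :|: outN G X) (Y :|: outN G Y).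
have := cardsUI X Y.
by rewrite !cl in h1 h2 *; lia.
Qed.

(** * Finding balanced separators *)

Lemma disjointI (V : finType) (A B : {set V}) :
  (forall x, x \in A -> x \notin B) -> [disjoint A & B].
Proof. by move=> h; rewrite disjoint_subset; apply/subsetP => x /h. Qed.

Lemma in_outN (V : finType) (G : rel V) (X : {set V}) y :
  (y \in outN G X) = (y \notin X) && [exists x, (x \in X) && G x y].
Proof. by rewrite inE. Qed.

Section Balanced.

Variables (V : finType) (D : rel V).

Implicit Types (S T X Y Z : {set V}).

Lemma mutE (G : rel V) x y :
  mutually_reachable G x y = connect G x y && connect G y x.
Proof. by []. Qed.

(** [S] only selects which members are counted; the connecting paths may leave it. *)
Definition scc_in (G : rel V) S x : {set V} :=
  [set y in S | mutually_reachable G x y].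

Lemma in_scc_in (G : rel V) S x y :
  (y \in scc_in G S x) = [&& y \in S, connect G x y & connect G y x].
Proof. by rewrite inE. Qed.

Definition balanced (G : rel V) S r := forall x, #|scc_in G S x| <= r.

(** [connect] is reflexive at deleted vertices too, hence the condition [x != y]. *)
Lemma connect_del_notin Z x y : connect (del D Z) x y -> x != y -> (x \notin Z) && (y \notin Z).
Proof.
case/connectP; case/lastP => [_ ->|p z]; first by rewrite eqxx.
rewrite rcons_path last_rcons => /andP[pth h] -> _; have /and3P[lZ zZ _] := h.
by case: p pth lZ {h} => /= [_ ->|u p /andP[/and3P[-> _ _] _] _].
Qed.

Lemma connect_delS Z Z' x y : Z \subset Z' -> connect (del D Z') x y -> connect (del D Z) x y.
Proof.
move=> /subsetP h; apply: connect_sub => u v /and3P[h1 h2 h3]; apply: connect1.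
by apply/and3P; split=> //; [apply: contra h1 | apply: contra h2]; apply: h.
Qed.

Lemma balanced_separatorE T r Z :
  balanced_separator D T r Z <-> balanced (del D Z) (T :\: Z) r.
Proof.
have equiv : {in ~: Z & &, equivalence_rel (mutually_reachable (del D Z))}.
  move=> x y z _ _ _; split; first by rewrite mutE connect0.
  case/andP => h1 h2; apply/idP/idP => /andP[h3 h4]; apply/andP; split.
  - exact: connect_trans h2 h3.
  - exact: connect_trans h4 h1.
  - exact: connect_trans h1 h3.
  - exact: connect_trans h4 h2.
split=> h.
  move=> x; case xZ: (x \in Z).
    rewrite (_ : scc_in _ _ _ = set0) ?cards0 //; apply/setP => y; rewrite !inE.
    apply/negP => /andP[/andP[yZ _] /andP[xy _]].
    have := connect_del_notin xy; rewrite xZ /=.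
    by case: eqP => [e|_ /(_ isT)//]; rewrite -e xZ in yZ.
  pose C := [set y in ~: Z | mutually_reachable (del D Z) x y].
  have hC : C \in strong_components D Z by apply: imset_f; rewrite inE xZ.
  apply: leq_trans (h _ hC); apply: subset_leq_card; apply/subsetP => y.
  by rewrite !inE => /andP[/andP[-> ->] ->].
move=> C /imsetP[x _ ->]; apply: leq_trans (h x); apply: subset_leq_card.
by apply/subsetP => y; rewrite !inE => /andP[/andP[-> ->] ->].
Qed.

Lemma closed_connect (G : rel V) X x y :
  (forall u v, u \in X -> G u v -> v \in X) -> connect G x y -> x \in X -> y \in X.
Proof.
move=> h /connectP[p pth ->]; elim: p x pth => //= z p IH x /andP[xz pth] xX.
by apply: IH => //; apply: h xz.
Qed.

(** A path that enters [X] cannot leave it, so a path ending outside avoids [X] altogether. *)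
Lemma avoid_connect (G G' : rel V) X x y :
  (forall u v, u \in X -> G u v -> v \in X) ->
  (forall u v, u \notin X -> v \notin X -> G u v -> G' u v) ->
  connect G x y -> y \notin X -> connect G' x y.
Proof.
move=> hX hG /connectP[p pth ->]; elim: p x pth => //= z p IH x /andP[xz pth] yX.
apply: connect_trans (IH _ pth yX).
have h u : u \in X -> ~ connect G u (last z p).
  by move=> uX /(closed_connect hX)/(_ uX); rewrite (negbTE yX).
have zl : connect G z (last z p) by apply/connectP; exists p.
apply: connect1; apply: hG => //; apply/negP => /h.
  by apply; apply: connect_trans zl; apply: connect1.
by apply.
Qed.

Lemma scc_in_sub (G G' : rel V) S S' x :
  (forall y, connect G x y -> connect G' x y) -> (forall y, connect G y x -> connect G' y x) ->
  S \subset S' -> #|scc_in G S x| <= #|scc_in G' S' x|.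
Proof.
move=> h1 h2 /subsetP hS; apply: subset_leq_card; apply/subsetP => y.
by rewrite !in_scc_in => /and3P[/hS-> /h1-> /h2->].
Qed.

(** The exchange of [Z1] for [Z2]. A strong component meeting the closed set [Y] lies inside it,
    where deleting [Z] suffices; one that misses [Y] stays connected after deleting [Z :|: Z1],
    which adds nothing outside [Y]. *)
Lemma balanced_swap T r Z Z1 Z2 Y :
  (forall u v, u \in Y -> del D (Z :|: Z2) u v -> v \in Y) ->
  (forall u, u \notin Y -> u \notin Z -> u \in Z1 -> u \in Z2) ->
  balanced (del D Z) ((Y :&: T) :\: Z) r ->
  balanced (del D (Z :|: Z1)) (T :\: (Z :|: Z1)) r ->
  balanced (del D (Z :|: Z2)) (T :\: (Z :|: Z2)) r.
Proof.
move=> hY h12 hin hout x.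
case E: [exists y, (y \in Y) && mutually_reachable (del D (Z :|: Z2)) x y].
  case/existsP: E => y /andP[yY /andP[xy yx]].
  apply: leq_trans (hin x); apply: subset_leq_card; apply/subsetP => z.
  rewrite !in_scc_in !inE negb_or => /andP[/andP[/andP[-> _] ->] /andP[xz zx]].
  rewrite !(connect_delS (subsetUl Z Z2)) // !andbT /=.
  by apply: (closed_connect hY) yY; apply: connect_trans yx xz.
have nY z : mutually_reachable (del D (Z :|: Z2)) x z -> z \notin Y.
  by move=> h; apply/negP => zY; case/existsP: E; exists z; rewrite zY.
have xY : x \notin Y by apply: nY; rewrite mutE connect0.
have sub u v : u \notin Y -> v \notin Y -> del D (Z :|: Z2) u v -> del D (Z :|: Z1) u v.
  have aux w : w \notin Y -> w \notin Z :|: Z2 -> w \notin Z :|: Z1.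
    move=> wY; rewrite !inE !negb_or => /andP[wZ wZ2]; rewrite wZ /=.
    by apply: contra wZ2; apply: h12.
  by move=> uY vY /and3P[h1 h2 h3]; apply/and3P; split=> //; apply: aux.
apply: leq_trans (hout x); apply: subset_leq_card; apply/subsetP => z.
rewrite in_scc_in in_setD => /andP[/andP[zZ zT] xz]; have zY := nY _ xz; case/andP: xz => xz zx.
rewrite in_scc_in in_setD zT (avoid_connect hY sub xz zY) (avoid_connect hY sub zx xY) !andbT.
move: zZ; rewrite !inE !negb_or => /andP[zZ zZ2]; rewrite zZ /=.
by apply: contra zZ2; apply: h12.
Qed.

End Balanced.

Section Separator.

Variables (V : finType) (D : rel V) (k : nat).

(* In a search state [((T, Z), (A, P))], [Z] is the part of the separator chosen so far; the rest of it must avoid [A] and separate [A] from the remaining vertices of [T]; [P] collects the vertices of [T] added to [A] since [A] was last closed under arcs. *)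
Definition state (U : finType) : Type := (({set U} * {set U}) * ({set U} * {set U}))%type.

Implicit Types (s : state V) (T X Y Z A : {set V}).

Definition add_vtx (U : finType) (X : {set U}) (v : U) := [set x | (x \in X) || (x == v)].

Definition rest s : {set V} :=
  [set x | (x \in s.1.1) && ~~ ((x \in s.2.1) || (x \in s.1.2))].

Lemma in_rest s x :
  (x \in rest s) = (x \in s.1.1) && ~~ ((x \in s.2.1) || (x \in s.1.2)).
Proof. by rewrite inE. Qed.

Definition final s := ~~ [exists v, v \in rest s].

Definition side s := maxside (del D s.1.2) s.2.1 (rest s).

Definition cut s := outN (del D s.1.2) (side s).

(** The limit on [P] is what bounds the components that avoid the part of [A] closed earlier. *)
Definition picks s : seq (state V) :=
  if #|s.2.2| < k.-1 then
    [seq (s.1, (add_vtx s.2.1 t, add_vtx s.2.2 t)) | t <- enum (rest s)]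
  else [::].

Definition moves s : seq (state V) :=
  if [pick v | v \in cut s] is Some v then
    (* A cut vertex in [T] belongs to [rest s]; it may join [A] only through [picks], which charges
       it to [P]. *)
    let l := if v \in s.1.1 then picks s
             else (s.1, (add_vtx (side s) v, s.2.2)) :: picks s in
    if #|s.1.2| < k.-1 then ((s.1.1, add_vtx s.1.2 v), s.2) :: l else l
  else (s.1, (side s, set0)) :: picks s.

(** The test makes the bound on the branching hold for every state, as [fpt_search] demands. *)
Definition succ s : seq (state V) := if #|s.1.1| < k + k then moves s else [::].

Definition init T : state V := ((T, set0), (set0, set0)).

Definition find_separator T := search final succ (6 * k) [:: init T].

Lemma size_succ s : size (succ s) <= 2 * k + 2.
Proof.
rewrite /succ; case: ifP => // hT.
have hp : size (picks s) <= 2 * k.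
  rewrite /picks; case: ifP => // _; rewrite size_map -cardE.
  apply: leq_trans (_ : #|s.1.1| <= _); last lia.
  by apply: subset_leq_card; apply/subsetP => x; rewrite inE => /andP[].
rewrite /moves; case: pickP => [v _|_] /=; last lia.
by case: ifP; case: ifP => _ _ /=; lia.
Qed.

Let r := k.-1.

(** [A0] is [A] as it was at the last closing; every vertex of [T] added since and not deleted is
    recorded in [P]. *)
Definition Inv s :=
  [/\ #|s.2.2| <= r, #|s.1.2| <= r & exists A0 : {set V},
   [/\ A0 \subset s.2.1,
    forall x y, x \in A0 -> connect (del D s.1.2) x y -> y \in s.1.1 :\: s.1.2 -> y \in A0,
    balanced (del D s.1.2) ((A0 :&: s.1.1) :\: s.1.2) r &
    ((s.2.1 :&: s.1.1) :\: s.1.2) :\: A0 \subset s.2.2]].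

(** A component meeting [A0] has its undeleted vertices of [T] in [A0], where balance is known; any
    other meets [A :&: T] in [P] only. *)
Lemma Inv_balanced s : Inv s -> balanced (del D s.1.2) ((s.2.1 :&: s.1.1) :\: s.1.2) r.
Proof.
move=> [hP _ [A0 [h1 h2 h3 h4]]] x.
case E: [exists a, (a \in A0) && mutually_reachable (del D s.1.2) x a].
  case/existsP: E => a /andP[aA /andP[xa ax]].
  apply: leq_trans (h3 x); apply: subset_leq_card; apply/subsetP => y.
  rewrite !in_scc_in !inE => /andP[/andP[yZ /andP[yA yT]] /andP[xy yx]].
  rewrite yZ yT xy yx !andbT; apply: (h2 a y) => //; last by rewrite inE yZ yT.
  exact: connect_trans ax xy.
apply: leq_trans hP; apply: subset_leq_card; apply/subsetP => y.
rewrite in_scc_in => /andP[yS xy]; apply: (subsetP h4); rewrite inE yS andbT.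
by apply/negP => yA; case/existsP: E; exists y; rewrite yA.
Qed.

Lemma rest_disjoint s : [disjoint s.2.1 & rest s].
Proof. by rewrite disjoint_subset; apply/subsetP => x; rewrite !inE => ->; rewrite andbF. Qed.

Lemma in_side s : [/\ s.2.1 \subset side s, [disjoint side s & rest s] &
   forall Y, s.2.1 \subset Y -> [disjoint Y & rest s] ->
     #|cut s| <= #|outN (del D s.1.2) Y| /\
     (~~ (Y \subset side s) -> #|cut s| < #|outN (del D s.1.2) Y|)].
Proof. exact: maxside_spec (rest_disjoint s). Qed.

Lemma disjoint_rest_sub s Y : [disjoint Y & rest s] ->
  (Y :&: s.1.1) :\: s.1.2 \subset (s.2.1 :&: s.1.1) :\: s.1.2.
Proof.
move=> h; apply/subsetP => x; rewrite !inE => /andP[xZ /andP[xY xT]].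
by have := disjointFr h xY; rewrite inE xT (negbTE xZ) orbF /= => /negbFE->.
Qed.

Lemma scc_in_S (G : rel V) (S S' : {set V}) x n : S \subset S' -> #|scc_in G S' x| <= n -> #|scc_in G S x| <= n.
Proof. by move=> h; apply: leq_trans; apply: scc_in_sub. Qed.

Lemma card_add_vtx X (v : V) : v \notin X -> #|add_vtx X v| = #|X|.+1.
Proof.
move=> h; rewrite (_ : add_vtx X v = v |: X) ?cardsU1 ?h //.
by apply/setP => x; rewrite !inE orbC.
Qed.

Lemma card_add_vtx_le X (v : V) : #|add_vtx X v| <= #|X|.+1.
Proof.
case h : (v \in X); last by rewrite card_add_vtx ?h.
rewrite (_ : add_vtx X v = X) //; apply/setP => x; rewrite !inE.
by case: eqP => [->|]; rewrite ?h ?orbF.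
Qed.

Lemma In_picks s s' : List.In s' (picks s) ->
  #|s.2.2| < r /\ exists2 t, t \in rest s & s' = (s.1, (add_vtx s.2.1 t, add_vtx s.2.2 t)).
Proof.
rewrite /picks; case: ifP => // h hin; split=> //.
move: hin; have : {subset enum (rest s) <= rest s} by move=> x; rewrite mem_enum.
elim: (enum _) => //= t l IH hl [<-|/IH]; first by exists t => //; apply: hl; rewrite inE eqxx.
by apply=> x xl; apply: hl; rewrite inE xl orbT.
Qed.

Lemma In_picks_mem s t : #|s.2.2| < r -> t \in rest s ->
  List.In (s.1, (add_vtx s.2.1 t, add_vtx s.2.2 t)) (picks s).
Proof.
rewrite /picks => ->; rewrite -mem_enum; elim: (enum _) => //= u l IH.
by rewrite inE => /orP[/eqP->|/IH]; [left | right].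
Qed.

Lemma in_cut s v : v \in cut s -> [/\ v \notin side s, v \notin s.1.2 & v \notin s.2.1].
Proof.
rewrite inE => /andP[h1 /existsP[x /andP[_ /and3P[_ h2 _]]]]; split=> //.
by apply: contra h1; apply: subsetP; case: (in_side s).
Qed.

Lemma cut0_closed s : cut s = set0 ->
  forall u v, u \in side s -> del D s.1.2 u v -> v \in side s.
Proof.
move=> h u v uX uv; apply: contraFT (in_set0 v) => vX.
by rewrite -h inE vX; apply/existsP; exists u; rewrite uX.
Qed.

Lemma Inv_succ s s' : Inv s -> List.In s' (succ s) -> Inv s'.
Proof.
move=> hI; rewrite /succ; case: ifP => // _; have hbal := Inv_balanced hI.
have [sA sU _] := in_side s.
have [hP hZ [A0 [h1 h2 h3 h4]]] := hI.
have hpick : List.In s' (picks s) -> Inv s'.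
  move=> /In_picks [hr [t tr ->]]; split=> //=.
    exact: leq_trans (card_add_vtx_le _ _) hr.
  exists A0; split=> //.
    by apply: subset_trans h1 _; apply/subsetP => x; rewrite !inE => ->.
  apply/subsetP => x; rewrite !inE => /and3P[x0 xZ /andP[/orP[xA|->] xT]]; last by rewrite orbT.
  by rewrite (subsetP h4) // !inE x0 xZ xA.
rewrite /moves; case: pickP => [v vS|none]; last first.
  have cut0 : cut s = set0 by apply/setP => v; rewrite none inE.
  case=> [<-|//]; split; rewrite /= ?cards0 //.
  exists (side s); split=> //=.
  - by move=> x y xX xy _; apply: closed_connect (cut0_closed cut0) xy xX.
  - by move=> x; apply: scc_in_S (disjoint_rest_sub sU) (hbal x).
  - by apply/subsetP => x; rewrite !inE => /and3P[/negbTE->].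
have [v1 v2 v3] := in_cut vS.
have hpush : v \notin s.1.1 -> Inv (s.1, (add_vtx (side s) v, s.2.2)).
  move=> vT; split=> //=; exists A0; split=> //.
    by apply: subset_trans (subset_trans h1 sA) _; apply/subsetP => x; rewrite !inE => ->.
  apply/subsetP => x; rewrite 4!inE => /and3P[x0 xZ /andP[/orP[xX|/eqP->] xT]]; last by rewrite xT in vT.
  apply: (subsetP h4); rewrite inE x0; apply: (subsetP (disjoint_rest_sub sU)).
  by rewrite in_setD in_setI xZ xX.
have hdel : #|s.1.2| < r -> Inv ((s.1.1, add_vtx s.1.2 v), s.2).
  have sub : s.1.2 \subset add_vtx s.1.2 v by apply/subsetP => x; rewrite !inE => ->.
  move=> hr; split=> //=; first exact: leq_trans (card_add_vtx_le _ _) hr.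
  exists A0; split=> //.
  - move=> x y xA /(connect_delS sub) xy; rewrite inE => /andP[yZ yT]; apply: h2 xA xy _.
    by rewrite inE yT andbT; apply: contra yZ; apply: subsetP.
  - move=> x; apply: leq_trans (h3 x); apply: scc_in_sub => [y|y|]; try exact: connect_delS.
    by apply: setDS.
  - by apply: subset_trans h4; apply: setSD; apply: setDS.
case: ifP => hr; case: ifP => vT /=.
- by case=> [<-|//]; apply: hdel.
- by case=> [<-|[<-|//]]; [apply: hdel | apply: hpush; rewrite vT].
- by [].
- by case=> [<-|//]; apply: hpush; rewrite vT.
Qed.

(* The size of the minimum cut counts as progress only once the current block [Y :&: rest s] is used up, since picking a vertex may lower it. *)
Definition measure s Y :=
  if [exists y, (y \in Y) && (y \in rest s)] then 2 * #|rest s| + 2 * (r - #|s.1.2|)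
  else 2 * #|rest s| + 1 + 2 * (r - #|s.1.2|) - #|cut s|.

(** A certificate that [s] can be completed: deleting [Z1] as well yields a balanced separator and
    closes [Y] under arcs, and the vertices of [T] that [Y] still has to contribute fit into the
    current [P]. *)
Definition Extends s Z1 Y :=
  [/\ s.2.1 \subset Y, outN (del D s.1.2) Y \subset Z1, [disjoint Z1 & Y],
      #|s.1.2| + #|Z1| <= r & #|Y :&: rest s| + #|s.2.2| <= r] /\
  balanced (del D (s.1.2 :|: Z1)) (s.1.1 :\: (s.1.2 :|: Z1)) r.

Definition Consistent m s :=
  [/\ #|s.1.1| < k + k, Inv s & exists Z1 Y, Extends s Z1 Y /\ m = measure s Y].

Lemma step_pick s Z1 Y t : Extends s Z1 Y -> t \in Y -> t \in rest s ->
  let s' := (s.1, (add_vtx s.2.1 t, add_vtx s.2.2 t)) in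
  [/\ #|s.2.2| < r, Extends s' Z1 Y & measure s' Y < measure s Y].
Proof.
move=> [[h1 h2 h3 h4 h5] h6] tY tr s'.
have cr : #|Y :&: rest s| = #|Y :&: rest s'|.+1.
  rewrite (cardsD1 t) inE tY tr /= add1n; congr (#|pred_of_set _|.+1).
  by apply/setP => x; rewrite !inE /=; case: eqP => [->|]; rewrite ?orbT ?orbF /= ?andbF.
have cr' : #|rest s| = #|rest s'|.+1.
  rewrite (cardsD1 t) tr /= add1n; congr (#|pred_of_set _|.+1).
  by apply/setP => x; rewrite !inE /=; case: eqP => [->|]; rewrite ?orbT ?orbF /= ?andbF.
split.
- by rewrite cr in h5; move: h5; clear; lia.
- split=> //; split=> //=.
    by apply/subsetP => x; rewrite inE => /orP[/(subsetP h1)//|/eqP->].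
  by have := card_add_vtx_le s.2.2 t; rewrite cr in h5; rewrite -/s'; move: h5; clear; lia.
(* The coefficient 2 pays for the summand 1 that appears when the block is used up. *)
- rewrite /measure; have -> : [exists y, (y \in Y) && (y \in rest s)].
    by apply/existsP; exists t; rewrite tY.
  by rewrite cr'; case: ifP => _; rewrite /=; clear; lia.
Qed.

(** Components meeting the closed set [side s] are controlled by the invariant; the others meet [T]
    within [rest s], which has at most [r] vertices. *)
Lemma balanced_rest s Z1 : Inv s -> cut s = set0 -> rest s \subset Z1 -> #|Z1| <= r ->
  balanced (del D s.1.2) (s.1.1 :\: s.1.2) r.
Proof.
move=> hI cut0 rZ hZ x; have [sA sU _] := in_side s.
have hcl := cut0_closed cut0.
case E: [exists a, (a \in side s) && mutually_reachable (del D s.1.2) x a].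
  case/existsP: E => a /andP[aA /andP[xa ax]].
  apply: leq_trans (scc_in_S (disjoint_rest_sub sU) (Inv_balanced hI x)).
  apply: subset_leq_card; apply/subsetP => y.
  rewrite in_scc_in in_setD => /andP[/andP[yZ yT] /andP[xy yx]].
  rewrite in_scc_in xy yx !andbT in_setD in_setI yZ yT andbT.
  by apply: (closed_connect hcl) aA; apply: connect_trans ax xy.
apply: leq_trans hZ; apply: subset_leq_card; apply/subsetP => y.
rewrite in_scc_in in_setD => /andP[/andP[yZ yT] xy]; apply: (subsetP rZ); rewrite inE yT negb_or yZ andbT.
apply/negP => /(subsetP sA) yA; case/existsP: E; exists y; rewrite yA; exact: xy.
Qed.

Lemma Consistent_close s Z1 Y : Inv s -> Extends s Z1 Y -> [disjoint Y & rest s] ->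
  cut s = set0 -> ~~ final s ->
  let s' := (s.1, (side s, set0)) in
  exists Z2 Y2, Extends s' Z2 Y2 /\ measure s' Y2 < measure s Y.
Proof.
move=> hI [[h1 h2 h3 h4 h5] h6] hY cut0; rewrite negbK => hfin s'.
have [sA sU _] := in_side s; have hcl := cut0_closed cut0.
have rE : rest s' = rest s.
  apply/setP => x; rewrite !in_rest /=; case xX: (x \in side s).
    by have := disjointFr sU xX; rewrite in_rest => ->; rewrite andbF.
  by case xA: (x \in s.2.1) => //; have := subsetP sA _ xA; rewrite xX.
have hZ1 : #|Z1| <= r by move: h4; clear; lia.
have hm Y2 : [exists y, (y \in Y2) && (y \in rest s)] -> measure s' Y2 < measure s Y.
  rewrite /measure rE => ->; rewrite cut0 cards0 ifF ?subn0; last first.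
    by apply/existsP => -[y /andP[yY]]; rewrite (disjointFr hY).
  by rewrite /=; clear; lia.
(* If the separator was to delete all of [rest s], no further deletion is needed, and all that
   remains of [T] forms one last block. *)
have [rZ|nrZ] := boolP (rest s \subset Z1).
  exists set0, setT; split; last first.
    by apply: hm; case/existsP: hfin => y yr; apply/existsP; exists y; rewrite inE.
  split; last by rewrite setU0 /=; apply: balanced_rest hI cut0 rZ hZ1.
  split=> //=.
  - by apply/subsetP => x; rewrite !inE.
  - by rewrite disjoint_subset; apply/subsetP => x; rewrite inE.
  - by rewrite cards0; move: h4; clear; lia.
  - by rewrite setTI cards0 addn0 rE; apply: leq_trans (subset_leq_card rZ) hZ1.
(* Nothing has to be deleted inside [side s], which is closed and already balanced. *)
pose Z2 := Z1 :\: side s; pose G := del D (s.1.2 :|: Z2).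
have hclG u v : u \in side s -> G u v -> v \in side s.
  move=> uX /and3P[]; rewrite !in_setU !negb_or => /andP[u1 _] /andP[v1 _] uv.
  by apply: hcl uX _; apply/and3P.
have hbal : balanced G (s.1.1 :\: (s.1.2 :|: Z2)) r.
  apply: balanced_swap hclG _ _ h6.
    by move=> u uX _ uZ; rewrite in_setD uX.
  by move=> x; apply: scc_in_S (disjoint_rest_sub sU) (Inv_balanced hI x).
pose Re t := [set y | connect G t y].
have [t0 t0r t0Z] : exists2 t, t \in rest s & t \notin Z1.
  by case/subsetPn: nrZ => t; exists t.
(* A vertex with fewest reachable vertices lies in a last relevant component: every vertex of
   [rest s] that it reaches also reaches it back. The next block therefore has at most [r]
   vertices. *)
have [t /andP[tr tZ] tmin] := @arg_minnP _ t0 [pred t | (t \in rest s) && (t \notin Z1)]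
  (fun t => #|Re t|) (introT andP (conj t0r t0Z)).
have tX : t \notin side s by rewrite (disjointFl sU).
have tZ2 : t \notin s.1.2 :|: Z2.
  rewrite in_setU negb_or in_setD negb_and tZ orbT andbT.
  by move: tr; rewrite inE => /andP[_]; rewrite negb_or => /andP[].
have ReZ y : y \in Re t -> y \notin s.1.2 :|: Z2.
  rewrite inE => ty; have [<- //|ne] := eqVneq t y.
  by case/andP: (connect_del_notin ty ne).
have hRe u : u \in rest s -> u \in Re t -> u \in scc_in G (s.1.1 :\: (s.1.2 :|: Z2)) t.
  move=> ur uR; have := ReZ _ uR => uZ; move: (uR); rewrite inE => tu.
  have uX : u \notin side s by rewrite (disjointFl sU).
  have uZ1 : u \notin Z1 by apply: contra uZ => h; rewrite in_setU in_setD uX h orbT.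
  have sub : Re u \subset Re t.
    by apply/subsetP => y; rewrite !inE; apply: connect_trans.
  have /eqP eR : Re u == Re t by rewrite eqEcard sub tmin //= ur.
  have : t \in Re u by rewrite eR inE connect0.
  rewrite inE => ut; rewrite in_scc_in tu ut in_setD uZ !andbT /=.
  by move: ur; rewrite inE => /andP[].
exists Z2, (side s :|: Re t); split; last first.
  by apply: hm; apply/existsP; exists t; rewrite in_setU [_ \in Re t]inE connect0 orbT.
split=> //; split=> /=.
- exact: subsetUl.
- apply/subsetP => y; rewrite inE in_setU negb_or => /andP[/andP[yX yR] /existsP[x /andP[]]].
  rewrite in_setU => /orP[xX /(hcl _ _ xX)|xR xy]; first by rewrite (negbTE yX).
  apply: contraR yR => yZ; have xZ := ReZ _ xR; move: xR; rewrite !inE => tx.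
  have /and3P[_ yZ' xy'] := xy; apply: connect_trans tx (connect1 _).
  by apply/and3P; split=> //; rewrite in_setU negb_or yZ' yZ.
- rewrite disjoint_sym; apply: disjointI => y; rewrite in_setU.
  case/orP => [yX|/ReZ]; first by rewrite in_setD yX.
  by rewrite in_setU negb_or => /andP[].
- by have := subset_leq_card (subsetDl Z1 (side s)); rewrite -/Z2; move: h4; clear; lia.
- rewrite cards0 addn0 rE; apply: leq_trans (hbal t); apply: subset_leq_card.
  apply/subsetP => u; rewrite in_setI in_setU => /andP[/orP[uX|uR] ur]; last exact: hRe.
  by rewrite (disjointFr sU uX) in ur.
Qed.

(* The pushing argument: by submodularity, replacing [outN Y] by [outN (side s :|: Y)] does not enlarge the separator. *)
Lemma Extends_push s Z1 Y : Inv s -> Extends s Z1 Y -> [disjoint Y & rest s] ->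
  exists Z2, [/\ Extends s Z2 (side s :|: Y) & [disjoint side s :|: Y & rest s]].
Proof.
move=> hI [[h1 h2 h3 h4 h5] h6] hY.
have [sA sU smin] := in_side s; set X := side s; set G := del D s.1.2.
pose Y2 := X :|: Y.
(* Dropping [X] keeps [Z2] disjoint from [Y2]; a vertex of [outN G Y] outside [X] comes back in
   [outN G Y2]. *)
pose Z2 := (Z1 :\: (outN G Y :|: X)) :|: outN G Y2.
have Y2U : [disjoint Y2 & rest s].
  apply: disjointI => x; rewrite in_setU => /orP[xX|xY].
    by rewrite (disjointFr sU).
  by rewrite (disjointFr hY).
exists Z2; split=> //; split; last first.
  have hcl u v : u \in Y2 -> del D (s.1.2 :|: Z2) u v -> v \in Y2.
    move=> uY /and3P[]; rewrite 4!in_setU !negb_or => /andP[uZ _] /andP[vZ /andP[_ vN]] uv.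
    apply: contraR vN => vY; rewrite inE vY; apply/existsP; exists u.
    by rewrite uY /G /del /= uZ vZ.
  apply: balanced_swap hcl _ _ h6.
    move=> u uY uZ uZ1; rewrite in_setU in_setD uZ1 andbT in_setU negb_or.
    have uX : u \notin X by apply: contra uY => h; rewrite in_setU h.
    rewrite uX andbT; case uN : (u \in outN G Y) => //=.
    move: uN; rewrite !in_outN => /andP[_ /existsP[y /andP[yY yu]]].
    by rewrite uY; apply/existsP; exists y; rewrite in_setU yY orbT.
  by move=> x; apply: scc_in_S (disjoint_rest_sub Y2U) (Inv_balanced hI x).
split=> //.
- exact: subset_trans sA (subsetUl _ _).
- exact: subsetUr.
- rewrite disjoint_sym; apply: disjointI => x; rewrite in_setU => xY2.
  rewrite in_setU in_setD in_setU [x \in outN G Y2]in_outN [x \in Y2]in_setU xY2 /= orbF.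
  case/orP: xY2 => [->|xY]; first by rewrite orbT.
  by rewrite (disjointFl h3) // andbF.
- have sAI : s.2.1 \subset X :&: Y by rewrite subsetI sA.
  have dI : [disjoint X :&: Y & rest s] by apply: disjointWl sU; apply: subsetIl.
  have [c1 _] := smin _ sAI dI.
  have c2 := card_outN_submod G X Y.
  have c3 : #|Z2| <= #|Z1 :\: outN G Y| + #|outN G Y2|.
    apply: leq_trans (leq_card_setU _ _) _; rewrite leq_add2r; apply: subset_leq_card.
    by apply: setDS; apply: subsetUl.
  have c4 : #|Z1 :\: outN G Y| + #|outN G Y| = #|Z1|.
    by rewrite addnC -(cardsID (outN G Y) Z1) (setIidPr h2).
  move: c1 c2 c3 c4 h4; rewrite /cut -/X -/G -/Y2; clear; lia.
- rewrite disjoint_setI0 // cards0 add0n.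
  by have [] := hI.
Qed.

Lemma measure_disjoint s Y : [disjoint Y & rest s] ->
  measure s Y = 2 * #|rest s| + 1 + 2 * (r - #|s.1.2|) - #|cut s|.
Proof.
move=> h; rewrite /measure ifF //.
by apply/existsP => -[y /andP[yY]]; rewrite (disjointFr h).
Qed.

Lemma cut_bound s Z1 Y : Extends s Z1 Y -> [disjoint Y & rest s] -> #|cut s| <= r - #|s.1.2|.
Proof.
move=> [[h1 h2 _ h4 _] _] hY; have [_ _ /(_ _ h1 hY) [c1 _]] := in_side s.
by have := subset_leq_card h2; move: c1 h4; clear; lia.
Qed.

Lemma Extends_delete s Z1 Y v : Inv s -> Extends s Z1 Y -> [disjoint Y & rest s] ->
  v \in cut s -> v \in Z1 ->
  let s' := ((s.1.1, add_vtx s.1.2 v), s.2) in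
  [/\ #|s.1.2| < r, Extends s' (Z1 :\ v) Y & measure s' Y < measure s Y].
Proof.
move=> hI hE hY vS vZ1 s'; have [v1 v2 v3] := in_cut vS.
have [[h1 h2 h3 h4 h5] h6] := hE.
have c1 : #|Z1| = #|Z1 :\ v|.+1 by rewrite (cardsD1 v) vZ1.
have sub : rest s' \subset rest s.
  by apply/subsetP => x; rewrite !inE /= !negb_or => /and3P[-> -> /andP[->]].
have hY' : [disjoint Y & rest s'] by apply: disjointWr hY.
have eN : outN (del D (add_vtx s.1.2 v)) Y \subset outN (del D s.1.2) Y :\ v.
  apply/subsetP => y; rewrite !inE => /andP[yY /existsP[x /andP[xY /and3P[]]]].
  rewrite !inE !negb_or => /andP[xZ xv] /andP[yZ yv] xy.
  by rewrite yv yY /=; apply/existsP; exists x; rewrite xY /del /= xZ yZ.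
have hE' : Extends s' (Z1 :\ v) Y.
  split; last first.
    rewrite /= (_ : add_vtx s.1.2 v :|: Z1 :\ v = s.1.2 :|: Z1) //.
    apply/setP => x; rewrite !inE; case: eqP => [->|_]; first by rewrite vZ1 !orbT.
    by rewrite orbF.
  split=> //=.
  - exact: subset_trans eN (setSD _ h2).
  - by apply: disjointWl h3; exact: subD1set.
  - by rewrite card_add_vtx //; move: c1 h4; clear; lia.
  - by rewrite disjoint_setI0 // cards0; have [] := hI.
split=> //; first by move: c1 h4; clear; lia.
rewrite !measure_disjoint //.
have b := cut_bound hE hY; have b' := cut_bound hE' hY'.
have [sA sU _] := in_side s'; have [_ _ smin] := in_side s.
(* The minimum cut drops by at most one: a side for [s'], without the deleted [v] that it may
   contain, is a side for [s] whose cut gains at most [v]. The budget term drops by 2. *)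
pose X'' := side s' :\ v.
have k1 : s.2.1 \subset X'' by rewrite subsetD1 sA.
have k2 : [disjoint X'' & rest s].
  apply: disjointI => x; rewrite !in_setD1 => /andP[xv xX].
  have := disjointFr sU xX; rewrite !inE /= => /negbT h; apply: contra h.
  by case/andP => -> /=; rewrite !negb_or xv andbT.
have [k3 _] := smin _ k1 k2.
have k4 : outN (del D s.1.2) X'' \subset v |: cut s'.
  apply/subsetP => y; rewrite in_setU1 inE => /andP[yX /existsP[x /andP[]]].
  rewrite in_setD1 => /andP[xv xX] /and3P[xZ yZ xy]; case: eqP => //= /eqP yv.
  rewrite inE; move: yX; rewrite in_setD1 yv /= => -> /=.
  by apply/existsP; exists x; rewrite xX /=; apply/and3P; rewrite /= !inE !negb_or xZ xv yZ yv.
have := subset_leq_card k4; have := cardsU1 v (cut s'); have := leq_b1 (v \notin cut s').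
have := subset_leq_card sub; move: b b' k3 h4 c1; rewrite /s' /= card_add_vtx //.
clear; lia.
Qed.

(** The new side contains [v], so it is not inside the furthest minimum side, and its cut is
    strictly larger. *)
Lemma Extends_advance s Z1 Y v : Inv s -> Extends s Z1 Y -> side s \subset Y ->
  [disjoint Y & rest s] -> v \in cut s -> v \in Y ->
  let s' := (s.1, (add_vtx (side s) v, s.2.2)) in
  [/\ v \notin s.1.1, Extends s' Z1 Y & measure s' Y < measure s Y].
Proof.
move=> hI hE sX hY vS vY s'; have [v1 v2 v3] := in_cut vS.
have [[h1 h2 h3 h4 h5] h6] := hE; have [sA sU smin] := in_side s.
have vT : v \notin s.1.1.
  by apply: contraFN (disjointFr hY vY) => vT; rewrite inE vT negb_or v3.
have rE : rest s' = rest s.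
  apply/setP => x; rewrite !in_rest /= [x \in add_vtx _ _]inE; case: eqP => [->|_]; first by rewrite (negbTE vT).
  case xX: (x \in side s); first by have := disjointFr sU xX; rewrite in_rest => ->; rewrite andbF.
  by case xA: (x \in s.2.1) => //; have := subsetP sA _ xA; rewrite xX.
have sY : add_vtx (side s) v \subset Y.
  by apply/subsetP => x; rewrite inE => /orP[/(subsetP sX)//|/eqP->].
split=> //.
  split=> //; split=> //.
  by rewrite rE.
have hY' : [disjoint Y & rest s'] by rewrite rE.
rewrite !measure_disjoint // rE.
have b := cut_bound hE hY.
have [sA' sU' _] := in_side s'; rewrite rE in sU'.
have vX' : v \in side s' by apply: (subsetP sA'); rewrite inE eqxx orbT.
have sAX : s.2.1 \subset side s'.
  apply: subset_trans sA _; apply: subset_trans sA'.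
  by apply/subsetP => x xX; rewrite inE xX.
have [_ lt] := smin _ sAX sU'.
have {}lt : #|cut s| < #|cut s'|.
  by apply: lt; apply/subsetPn; exists v.
by move: b lt; rewrite /=; clear; lia.
Qed.

Lemma Consistent_step m s : Consistent m s -> ~~ final s ->
  exists s' m', [/\ List.In s' (succ s), m' < m & Consistent m' s'].
Proof.
move=> [hT hI [Z1 [Y [hE ->]]]] hfin.
suff [s' [Z2 [Y2 [h1 h2 h3]]]] : exists s' Z2 Y2,
    [/\ List.In s' (moves s), Extends s' Z2 Y2 & measure s' Y2 < measure s Y].
  have hin : List.In s' (succ s) by rewrite /succ hT.
  exists s', (measure s' Y2); split=> //; split; last by exists Z2, Y2.
    suff -> : s'.1.1 = s.1.1 by [].
    have hp : List.In s' (picks s) -> s'.1.1 = s.1.1.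
      by move=> /In_picks [_ [t _ ->]].
    move: h1; rewrite /moves; case: pickP => [v _|_] /=; last by case=> [<-|/hp].
    by case: ifP => _; case: ifP => _ //=; intuition; subst.
  exact: Inv_succ hI hin.
case E: [exists y, (y \in Y) && (y \in rest s)].
  case/existsP: E => t /andP[tY tr].
  have [h1 h2 h3] := step_pick hE tY tr.
  exists (s.1, (add_vtx s.2.1 t, add_vtx s.2.2 t)), Z1, Y; split=> //.
  have hin := In_picks_mem h1 tr.
  rewrite /moves; case: pickP => [v _|_] /=; last by right.
  by case: ifP => _; case: ifP => _ /=; intuition.
have hY : [disjoint Y & rest s].
  apply: disjointI => y yY.
  by apply/negP => yr; case/existsP: E; exists y; rewrite yY.
rewrite /moves; case: pickP => [v vS|none]; last first.
  have cut0 : cut s = set0 by apply/setP => v; rewrite none inE.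
  have [Z2 [Y2 [h1 h2]]] := Consistent_close hI hE hY cut0 hfin.
  by exists (s.1, (side s, set0)), Z2, Y2; split=> //; left.
have [Z2 [hE2 hY2]] := Extends_push hI hE hY.
rewrite (measure_disjoint hY) -(measure_disjoint hY2).
case vZ : (v \in Z2).
  have [h1 h2 h3] := Extends_delete hI hE2 hY2 vS vZ.
  exists ((s.1.1, add_vtx s.1.2 v), s.2), (Z2 :\ v), (side s :|: Y); split=> //.
  by rewrite h1; left.
(* [v] is an out-neighbour of [side s], and all out-neighbours of [side s :|: Y] are in [Z2]. *)
have vY : v \in side s :|: Y.
  have [[_ h2 _ _ _] _] := hE2; apply: contraFT vZ => vY; apply: (subsetP h2).
  move: (vS); rewrite inE => /andP[_ /existsP[x /andP[xX xv]]].
  by rewrite inE vY; apply/existsP; exists x; rewrite in_setU xX.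
have [h1 h2 h3] := Extends_advance hI hE2 (subsetUl _ _) hY2 vS vY.
exists (s.1, (add_vtx (side s) v, s.2.2)), Z2, (side s :|: Y); split=> //.
by rewrite (negbTE h1); case: ifP => _ /=; [right; left | left].
Qed.

Lemma Inv_init T : Inv (init T).
Proof.
split; rewrite /= ?cards0 //; exists set0; split=> //=.
- by move=> x y; rewrite inE.
- move=> x; rewrite (_ : scc_in _ _ _ = set0) ?cards0 //.
  by apply/setP => y; rewrite in_scc_in !inE andbF.
- by rewrite set0I set0D set0D.
Qed.

Lemma search_T T s l n :
  (forall s', List.In s' l -> s'.1.1 = T) -> search final succ n l = Some s -> s.1.1 = T.
Proof.
move=> hl /(@search_sound _ _ _ (fun s' => s'.1.1 = T)) [] //.
move=> {hl}s1 s2 <- _; rewrite /succ; case: ifP => // _.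
have hp : List.In s2 (picks s1) -> s2.1.1 = s1.1.1.
  by move=> /In_picks [_ [t _ ->]].
rewrite /moves; case: pickP => [v _|_] /=; last by case=> [<-|/hp].
by case: ifP => _; case: ifP => _ //=; intuition; subst.
Qed.

Lemma find_separator_sound T s : find_separator T = Some s ->
  #|s.1.2| <= r /\ balanced_separator D T r s.1.2.
Proof.
move=> h; have hT : s.1.1 = T by apply: search_T h => s' /= [<-|].
have [hI hf] : Inv s /\ final s.
  apply: search_sound h => [s1 s2 h1 _ h2|s1 /= [<-|//]]; first exact: Inv_succ h1 h2.
  exact: Inv_init.
split; first by case: hI.
apply/balanced_separatorE => x; apply: scc_in_S (Inv_balanced hI x).
apply/subsetP => y; rewrite !inE hT => /andP[yZ yT]; rewrite yZ yT andbT /=.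
apply: contraNT hf => yA; apply/existsP; exists y.
by rewrite inE hT yT negb_or yA.
Qed.

Lemma find_separator_complete T Z : 0 < k -> #|T| < k + k ->
  balanced_separator D T r Z -> #|Z| <= r -> find_separator T <> None.
Proof.
move=> k0 hT /balanced_separatorE hb hZ.
apply: (@search_complete _ _ _ Consistent _ _ (init T) (measure (init T) set0)).
- exact: Consistent_step.
- by left.
- split=> //; first exact: Inv_init.
  exists Z, set0; split=> //; split; last by rewrite /= set0U.
  split=> //=.
  + by apply/subsetP => x; rewrite inE => /andP[_ /existsP[y]]; rewrite inE.
  + by rewrite disjoint_sym disjoint_subset; apply/subsetP => x; rewrite inE.
  + by rewrite cards0.
  + by rewrite set0I cards0.
(* The initial measure is at most [2 * (2 * k - 1) + 1 + 2 * (k - 1) = 6 * k - 3], whence the fuel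
   [6 * k]. *)
- rewrite measure_disjoint /= ?cards0; last first.
    by rewrite disjoint_subset; apply/subsetP => x; rewrite inE.
  have : #|rest (init T)| <= #|T|.
    by apply: subset_leq_card; apply/subsetP => x; rewrite inE => /andP[].
  by move: hT k0; rewrite /r; clear; lia.
Qed.

End Separator.

(** * Computability of the separator search *)

Lemma fpt_set0 A : @fpt A set_ty (fun I _ => set0).
Proof.
by apply: (fpt_cast (fpt_set (fpt_false _))) => I x; congr enc; apply/setP => v; rewrite !inE.
Qed.

Lemma fpt_ext A B (F G : forall I, car A I -> car B I) :
  fpt F -> (forall I x, F I x = G I x) -> fpt G.
Proof. by move=> h e; apply: (fpt_cast h) => I x; rewrite e. Qed.

Lemma fpt_cst_ext A m m' : @fpt A (cst_ty m) (fun _ _ => tt) -> (forall I, m I = m' I) ->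
  @fpt A (cst_ty m') (fun _ _ => tt).
Proof. by move=> h e; apply: (fpt_cast h) => I x /=; rewrite e. Qed.

(** Tries all chains of at most [n] projections that may lead to a component of the argument
    tuple. *)
Ltac jproj t n :=
  first [ exact t
        | lazymatch n with S ?m => first [ jproj (fpt_fst t) m | jproj (fpt_snd t) m ] end ].
Ltac jvar :=
  lazymatch goal with
  | |- @fpt ?A _ (fun I x => x) => exact (fpt_id A)
  | |- @fpt ?A _ (fun I x => fst _) => jproj (fpt_id A) 7
  | |- @fpt ?A _ (fun I x => snd _) => jproj (fpt_id A) 7
  | |- @fpt ?A _ (fun I x => let (_, _) := _ in _) => jproj (fpt_id A) 7
  end.
(** Follows the syntax of the function body; [jauto] adds the lemmas on functions treated
    earlier. *)
Ltac jbase :=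
  first
  [ jvar
  | lazymatch goal with
    | |- fpt (fun I x => [&& _ & _]) => apply: fpt_and
    | |- fpt (fun I x => _ && _) => apply: fpt_and
    | |- fpt (fun I x => _ || _) => apply: fpt_or
    | |- fpt (fun I x => ~~ FiniteQuant.quant0b _) => apply: fpt_ex
    | |- fpt (fun I x => ~~ _) => apply: fpt_neg
    | |- fpt (fun I x => (_, _)) => apply: fpt_pair
    | |- fpt (fun I x => Some _) => apply: fpt_some
    | |- fpt (fun I x => None) => apply: fpt_none
    | |- fpt (fun I x => true) => apply: fpt_true
    | |- fpt (fun I x => false) => apply: fpt_false
    | |- fpt (fun I x => set0) => apply: fpt_set0
    | |- fpt (fun I x => _ :: _) => apply: fpt_cons
    | |- fpt (fun I x => [::]) => apply: fpt_nil
    | |- fpt (fun I x => finset _) => apply: fpt_set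
    | |- fpt (fun I x => pick _) => apply: fpt_pick
    | |- fpt (fun I x v => _) => apply: fpt_tab
    end
  | apply: fpt_eq | apply: fpt_mem | apply: fpt_arcs
  | lazymatch goal with
    | |- fpt (fun I x => if _ then _ else _) => apply: fpt_if
    end
  | apply: (@fpt_opt _ vtx_ty) | apply: fpt_seq | apply: fpt_iter | eapply fpt_nth ]; cbn beta.
Ltac jauto lem := repeat (first [ lem | jbase ]; cbn beta).
Ltac jnone := fail.

Lemma fpt_del0 : @fpt (prod_ty (prod_ty set_ty vtx_ty) vtx_ty) bool_ty
  (fun I x => del (@arcs I) x.1.1 x.1.2 x.2).
Proof. by rewrite /del /=; jauto jnone. Qed.

Lemma fpt_del A (Z : forall I, car A I -> car set_ty I) (u v : forall I, car A I -> car vtx_ty I) :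
  fpt Z -> fpt u -> fpt v -> @fpt A bool_ty (fun I x => del (@arcs I) (Z I x) (u I x) (v I x)).
Proof. by move=> hZ hu hv; exact: (fpt_comp (fpt_pair (fpt_pair hZ hu) hv) fpt_del0). Qed.

Ltac jdel := apply: fpt_del.

Lemma iter_reach (V : finType) (G : rel V) x y :
  (y \in iter #|V| (fun S : {set V} => [set y | (y == x) || [exists z, (z \in S) && G z y]]) set0)
  = connect G x y.
Proof.
set F := fun S : {set V} => _.
have mono : {homo F : S S' / S \subset S'}.
  move=> S S' /subsetP h; apply/subsetP => z; rewrite !inE => /orP[->//|/existsP[u /andP[/h uS uz]]].
  by apply/orP; right; apply/existsP; exists u; rewrite uS.
have fixF : F (iter #|V| F set0) = iter #|V| F set0 := fixsetK mono.
apply/idP/idP.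
  elim: (#|V|) y => [|n IH] y; first by rewrite inE.
  rewrite iterS inE => /orP[/eqP->//|/existsP[z /andP[/IH xz zy]]].
  exact: connect_trans xz (connect1 zy).
move=> /closed_connect; apply; last by rewrite -fixF inE eqxx.
move=> u v uF uv; rewrite -fixF inE; apply/orP; right; apply/existsP; exists u.
by rewrite uF.
Qed.

Lemma fpt_connect0 : @fpt (prod_ty (prod_ty set_ty vtx_ty) vtx_ty) bool_ty
  (fun I x => connect (del (@arcs I) x.1.1) x.1.2 x.2).
Proof.
apply: (@fpt_ext (prod_ty (prod_ty set_ty vtx_ty) vtx_ty) bool_ty (fun I x => x.2 \in iter #|'I_(nvtx I)| (fun S : {set 'I_(nvtx I)} =>
   [set y | (y == x.1.2) || [exists z, (z \in S) && del (@arcs I) x.1.1 z y]]) set0)).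
  by jauto jdel.
by move=> I x; apply: iter_reach.
Qed.

Lemma fpt_connect A (Z : forall I, car A I -> car set_ty I) (u v : forall I, car A I -> car vtx_ty I) :
  fpt Z -> fpt u -> fpt v -> @fpt A bool_ty (fun I x => connect (del (@arcs I) (Z I x)) (u I x) (v I x)).
Proof. by move=> hZ hu hv; exact: (fpt_comp (fpt_pair (fpt_pair hZ hu) hv) fpt_connect0). Qed.

Lemma fpt_outN0 : @fpt (prod_ty set_ty set_ty) set_ty (fun I x => outN (del (@arcs I) x.1) x.2).
Proof. by rewrite /outN; jauto jdel. Qed.

Lemma fpt_outN A (Z X : forall I, car A I -> car set_ty I) :
  fpt Z -> fpt X -> @fpt A set_ty (fun I x => outN (del (@arcs I) (Z I x)) (X I x)).
Proof. by move=> hZ hX; exact: (fpt_comp (fpt_pair hZ hX) fpt_outN0). Qed.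

Ltac jout := first [ apply: fpt_outN | apply: fpt_del | apply: fpt_connect ].

Definition mcut_ty := prod_ty (prod_ty set_ty set_ty) set_ty.
Definition mate_ty := tab_ty (opt_ty vtx_ty).

Lemma fpt_hedge0 : @fpt (prod_ty (prod_ty (prod_ty set_ty set_ty) vtx_ty) vtx_ty) bool_ty
  (fun I x => hedge (del (@arcs I) x.1.1.1) x.1.1.2 x.1.2 x.2).
Proof. by rewrite /hedge; jauto jout. Qed.

Lemma fpt_hedge A (Z T : forall I, car A I -> car set_ty I)
   (v w : forall I, car A I -> car vtx_ty I) :
  fpt Z -> fpt T -> fpt v -> fpt w ->
  @fpt A bool_ty (fun I x => hedge (del (@arcs I) (Z I x)) (T I x) (v I x) (w I x)).
Proof.
by move=> hZ hT hv hw; exact: (fpt_comp (fpt_pair (fpt_pair (fpt_pair hZ hT) hv) hw) fpt_hedge0).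
Qed.

Lemma fpt_okw0 : @fpt (prod_ty (prod_ty mate_ty set_ty) vtx_ty) bool_ty
  (fun I x => okw x.1.1 x.1.2 x.2).
Proof. by rewrite /okw; jauto jnone. Qed.

Lemma fpt_okw A (M : forall I, car A I -> car mate_ty I) (S : forall I, car A I -> car set_ty I)
   (w : forall I, car A I -> car vtx_ty I) :
  fpt M -> fpt S -> fpt w -> @fpt A bool_ty (fun I x => okw (M I x) (S I x) (w I x)).
Proof. by move=> hM hS hw; exact: (fpt_comp (fpt_pair (fpt_pair hM hS) hw) fpt_okw0). Qed.

Lemma fpt_qstep0 : @fpt (prod_ty (prod_ty mcut_ty mate_ty) set_ty) set_ty
  (fun I x => qstep (del (@arcs I) x.1.1.1.1) x.1.1.1.2 x.1.1.2 x.1.2 x.2).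
Proof. by rewrite /qstep; jauto ltac:(first [ apply: fpt_hedge | apply: fpt_okw ]). Qed.

Lemma fpt_qstep A (Z T U S : forall I, car A I -> car set_ty I)
   (M : forall I, car A I -> car mate_ty I) :
  fpt Z -> fpt T -> fpt U -> fpt M -> fpt S ->
  @fpt A set_ty (fun I x => qstep (del (@arcs I) (Z I x)) (T I x) (U I x) (M I x) (S I x)).
Proof.
move=> hZ hT hU hM hS.
exact: (fpt_comp (fpt_pair (fpt_pair (fpt_pair (fpt_pair hZ hT) hU) hM) hS) fpt_qstep0).
Qed.

Lemma fpt_free0 : @fpt (prod_ty (prod_ty (prod_ty set_ty set_ty) mate_ty) vtx_ty) bool_ty
  (fun I x => free x.1.1.1 x.1.1.2 x.1.2 x.2).
Proof. by rewrite /free; jauto jnone. Qed.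

Lemma fpt_free A (T U : forall I, car A I -> car set_ty I)
   (M : forall I, car A I -> car mate_ty I) (v : forall I, car A I -> car vtx_ty I) :
  fpt T -> fpt U -> fpt M -> fpt v -> @fpt A bool_ty (fun I x => free (T I x) (U I x) (M I x) (v I x)).
Proof.
by move=> hT hU hM hv; exact: (fpt_comp (fpt_pair (fpt_pair (fpt_pair hT hU) hM) hv) fpt_free0).
Qed.

Ltac jq := first [ apply: fpt_hedge | apply: fpt_okw | apply: fpt_qstep | apply: fpt_free ].

Lemma fpt_low0 : @fpt (prod_ty mcut_ty mate_ty) set_ty
  (fun I x => low (del (@arcs I) x.1.1.1) x.1.1.2 x.1.2 x.2).
Proof. by rewrite /low /low_step; jauto jq. Qed.

Lemma fpt_low A (Z T U : forall I, car A I -> car set_ty I)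
   (M : forall I, car A I -> car mate_ty I) :
  fpt Z -> fpt T -> fpt U -> fpt M ->
  @fpt A set_ty (fun I x => low (del (@arcs I) (Z I x)) (T I x) (U I x) (M I x)).
Proof.
by move=> hZ hT hU hM; exact: (fpt_comp (fpt_pair (fpt_pair (fpt_pair hZ hT) hU) hM) fpt_low0).
Qed.

Lemma fpt_rotate0 : @fpt (prod_ty mcut_ty mate_ty) mate_ty
  (fun I x => rotate (del (@arcs I) x.1.1.1) x.1.1.2 x.1.2 x.2).
Proof. by rewrite /rotate; jauto ltac:(first [ apply: fpt_low | jq ]). Qed.

Lemma fpt_maxside0 : @fpt mcut_ty set_ty (fun I x => maxside (del (@arcs I) x.1.1) x.1.2 x.2).
Proof.
have hrot : @fpt (prod_ty mcut_ty mate_ty) mate_ty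
    (fun I x => rotates (del (@arcs I) x.1.1.1) x.1.1.2 x.1.2 x.2).
  rewrite /rotates.
  apply: (fpt_comp (fpt_pair (fpt_fst (@fpt_id _)) _) fpt_rotate0).
  by apply: fpt_iter; [exact: (fpt_comp (fpt_pair (fpt_fst (fpt_fst (@fpt_id _))) (fpt_snd (@fpt_id _))) fpt_rotate0) | exact: (fpt_snd (@fpt_id _))].
have hmat : @fpt mcut_ty mate_ty (fun I x => matching (del (@arcs I) x.1.1) x.1.2 x.2).
  rewrite /matching; apply: (fpt_comp (fpt_pair (@fpt_id _) _) hrot).
  by apply: fpt_iter; [exact: hrot | apply: fpt_tab; apply: fpt_none].
have hmain : @fpt (prod_ty mcut_ty mate_ty) set_ty
   (fun I p => [set v | (v \in p.1.1.2) || (v \notin p.1.2) &&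
      (v \notin iter #|'I_(nvtx I)| (qstep (del (@arcs I) p.1.1.1) p.1.1.2 p.1.2 p.2) set0)]).
  by jauto jq.
exact: (fpt_comp (fpt_pair (@fpt_id _) hmat) hmain).
Qed.

Lemma fpt_maxside A (Z T U : forall I, car A I -> car set_ty I) :
  fpt Z -> fpt T -> fpt U ->
  @fpt A set_ty (fun I x => maxside (del (@arcs I) (Z I x)) (T I x) (U I x)).
Proof. by move=> hZ hT hU; exact: (fpt_comp (fpt_pair (fpt_pair hZ hT) hU) fpt_maxside0). Qed.

Lemma fpt_param_pred A : @fpt A (cst_ty (fun I => (param I).-1)) (fun _ _ => tt).
Proof. exact: fpt_cst_pred (fpt_param A). Qed.

Lemma fpt_param_double A : @fpt A (cst_ty (fun I => param I + param I)) (fun _ _ => tt).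
Proof. exact: fpt_cst_add param_le_scale (fpt_param A) (fpt_param A). Qed.

Lemma fpt_fuel A : @fpt A (cst_ty (fun I => 6 * param I)) (fun _ _ => tt).
Proof.
have h := fpt_param A; have le := param_le_scale.
have := fpt_cst_add le h (fpt_cst_add le h (fpt_cst_add le h (fpt_cst_add le h (fpt_cst_add le h h)))).
by move/fpt_cst_ext; apply=> I; rewrite !mulSn addn0.
Qed.

Ltac jcard := first
  [ apply: (@fpt_card_lt _ _ _ (fpt_param_pred _)) | apply: (@fpt_card_lt _ _ _ (fpt_param_double _)) ].

Definition state_ty := prod_ty (prod_ty set_ty set_ty) (prod_ty set_ty set_ty).

Lemma fpt_rest0 : @fpt state_ty set_ty (fun I s => @rest _ s).
Proof. by rewrite /rest; jauto jnone. Qed.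

Lemma fpt_rest A (s : forall I, car A I -> car state_ty I) :
  fpt s -> @fpt A set_ty (fun I x => @rest _ (s I x)).
Proof. by move=> h; exact: (fpt_comp h fpt_rest0). Qed.

Lemma fpt_side0 : @fpt state_ty set_ty (fun I s => @side _ (@arcs I) s).
Proof. by rewrite /side; jauto ltac:(first [ apply: fpt_maxside | apply: fpt_rest ]). Qed.

Lemma fpt_side A (s : forall I, car A I -> car state_ty I) :
  fpt s -> @fpt A set_ty (fun I x => @side _ (@arcs I) (s I x)).
Proof. by move=> h; exact: (fpt_comp h fpt_side0). Qed.

Lemma fpt_cut0 : @fpt state_ty set_ty (fun I s => @cut _ (@arcs I) s).
Proof. by rewrite /cut; jauto ltac:(first [ apply: fpt_outN | apply: fpt_side ]). Qed.

Lemma fpt_cut A (s : forall I, car A I -> car state_ty I) :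
  fpt s -> @fpt A set_ty (fun I x => @cut _ (@arcs I) (s I x)).
Proof. by move=> h; exact: (fpt_comp h fpt_cut0). Qed.

Lemma fpt_add_vtx0 : @fpt (prod_ty set_ty vtx_ty) set_ty (fun I x => add_vtx x.1 x.2).
Proof. by rewrite /add_vtx; jauto jnone. Qed.

Lemma fpt_add_vtx A (S : forall I, car A I -> car set_ty I) (v : forall I, car A I -> car vtx_ty I) :
  fpt S -> fpt v -> @fpt A set_ty (fun I x => add_vtx (S I x) (v I x)).
Proof. by move=> hS hv; exact: (fpt_comp (fpt_pair hS hv) fpt_add_vtx0). Qed.

Lemma fpt_picks0 : @fpt state_ty (seq_ty state_ty) (fun I s => @picks _ (param I) s).
Proof. by rewrite /picks; jauto ltac:(first [ apply: fpt_rest | apply: fpt_add_vtx | jcard ]). Qed.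

Lemma fpt_picks A (s : forall I, car A I -> car state_ty I) :
  fpt s -> @fpt A (seq_ty state_ty) (fun I x => @picks _ (param I) (s I x)).
Proof. by move=> h; exact: (fpt_comp h fpt_picks0). Qed.

Lemma fpt_succ0 : @fpt state_ty (seq_ty state_ty) (fun I s => @succ _ (@arcs I) (param I) s).
Proof.
rewrite /succ /moves; jauto ltac:(first [ apply: fpt_side | apply: fpt_cut | apply: fpt_add_vtx
  | apply: fpt_picks | jcard ]).
Qed.

Lemma fpt_final0 : @fpt state_ty bool_ty (fun I s => @final _ s).
Proof. by rewrite /final; apply: fpt_neg; jauto ltac:(apply: fpt_rest). Qed.

(** Since [2k + 4 <= 2 ^ (3 + log k)], the exponent of 2 is at most [18k + 6k log k]. For [k > 1]
    this is at most [24k log k]; for [k = 1] it is 18, covered by the factor 2 in [scale]. *)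
Lemma fuel_bound I : (2 * param I + 2).+2 ^ (6 * param I) <= scale I ^ 24.
Proof.
have k0 := param_gt0 I; set k := param I in k0 *.
have h1 : (2 * k + 2).+2 <= 2 ^ (3 + up_log 2 k).
  have h : k <= 2 ^ up_log 2 k by apply: up_logP.
  by rewrite expnD; move: h k0; clear; set a := 2 ^ _; lia.
apply: leq_trans (_ : (2 ^ (3 + up_log 2 k)) ^ (6 * k) <= _).
  by rewrite leq_exp2r //; lia.
apply: leq_trans (_ : (2 * 2 ^ (k * up_log 2 k)) ^ 24 <= _); last first.
  rewrite leq_exp2r // /scale -/k leq_mul2r; apply/orP; right.
  by rewrite -[X in X <= _]muln1 leq_mul2l nvtx_gt0 orbT.
rewrite -expnS -!expnM leq_exp2l //.
have [->|k1] : k = 1 \/ 1 < k by lia.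
  by rewrite up_log1.
have h : 0 < up_log 2 k by rewrite up_log_gt0.
have : k * 1 <= k * up_log 2 k by rewrite leq_mul2l h orbT.
by rewrite mulnDl (mulnC (up_log _ _)) -mulnA; set a := k * up_log _ _; lia.
Qed.

Lemma fpt_find_separator0 :
  @fpt set_ty (opt_ty state_ty) (fun I T => find_separator (@arcs I) (param I) T).
Proof.
have hsz I s : size (@succ _ (@arcs I) (param I) s) <= 2 * param I + 2 by exact: size_succ.
have h := fpt_search fpt_final0 fpt_succ0 hsz fuel_bound.
have hi : @fpt set_ty state_ty (fun I T => init T) by rewrite /init; jauto jnone.
exact: (fpt_comp (fpt_pair (fpt_fuel _) hi) h).
Qed.

Lemma fpt_find_separator A (T : forall I, car A I -> car set_ty I) :
  fpt T -> @fpt A (opt_ty state_ty) (fun I x => find_separator (@arcs I) (param I) (T I x)).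
Proof. by move=> h; exact: (fpt_comp h fpt_find_separator0). Qed.

(** * Arboreal decompositions *)

Section Components.

Variables (V : finType) (D : rel V).
Implicit Types (X Y Z B C : {set V}).

Definition scc Z b : {set V} := scc_in (del D Z) setT b.

Lemma in_scc Z b y :
  (y \in scc Z b) = connect (del D Z) b y && connect (del D Z) y b.
Proof. by rewrite in_scc_in inE. Qed.

Lemma scc_refl Z b : b \in scc Z b.
Proof. by rewrite in_scc connect0. Qed.

Lemma scc_eq Z b c : c \in scc Z b -> scc Z c = scc Z b.
Proof.
rewrite in_scc => /andP[bc cb]; apply/setP => y; rewrite !in_scc.
apply/andP/andP => -[h1 h2]; split.
- exact: connect_trans bc h1.
- exact: connect_trans h2 cb.
- exact: connect_trans cb h1.
- exact: connect_trans h2 bc.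
Qed.

Lemma scc_notin Z b y : b \notin Z -> y \in scc Z b -> y \notin Z.
Proof.
rewrite in_scc => bZ /andP[h _]; have [<- //|ne] := eqVneq b y.
by case/andP: (connect_del_notin h ne).
Qed.

Lemma scc_sub Z Z' b : Z \subset Z' -> scc Z' b \subset scc Z b.
Proof.
move=> h; apply/subsetP => y; rewrite !in_scc => /andP[h1 h2].
by rewrite !(connect_delS h).
Qed.

Lemma strong_componentsP Z C :
  reflect (exists2 b, b \notin Z & C = scc Z b) (C \in strong_components D Z).
Proof.
apply: (iffP imsetP) => -[b]; rewrite ?inE => bZ ->; exists b; rewrite ?inE //.
  apply/setP => y; rewrite in_scc !inE; apply/andP/idP => [[_ //]|h].
  by split=> //; apply: scc_notin bZ _; rewrite in_scc.
apply/setP => y; rewrite in_scc !inE; apply/idP/andP => [h|[]//].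
by split=> //; apply: scc_notin bZ _; rewrite in_scc.
Qed.

Lemma guarded_strong_component Z C : C \in strong_components D Z -> guarded D Z C.
Proof.
case/strong_componentsP => b bZ ->; split.
  by apply: disjointI => x; apply: scc_notin.
case=> x [p [pth xC lC [y yp yZC]]].
have xy : connect (del D Z) x y.
  case/splitPl: yp pth => p1 p2 <-; rewrite cat_path => /andP[h _].
  by apply/connectP; exists p1.
have yl : connect (del D Z) y (last x p).
  case/splitPl: yp pth => p1 p2 <-; rewrite cat_path last_cat => /andP[_ h].
  by apply/connectP; exists p2.
case/negP: yZC; rewrite in_setU; apply/orP; right.
move: xC lC; rewrite !in_scc => /andP[h1 h2] /andP[h3 h4].
by rewrite (connect_trans h1 xy) (connect_trans yl h4).
Qed.

(** A closed walk through [b] avoiding [Z] stays in the component of [b] in [D] minus [Z], so only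
    the part of [X] in that component matters. This keeps the guards of children small. *)
Lemma scc_shrink Z X b : b \notin Z -> b \notin X ->
  scc (Z :|: (X :&: scc Z b)) b = scc (Z :|: X) b.
Proof.
move=> bZ bX; set Y := Z :|: _; set Z' := Z :|: X.
have sub : Y \subset Z' by rewrite setUS // subsetIl.
have bY : b \notin Y by rewrite !in_setU in_setI negb_or bZ (negbTE bX).
apply/eqP; rewrite eqEsubset; apply/andP; split; last exact: scc_sub.
apply/subsetP => y.
have inX x : connect (del D Y) b x -> connect (del D Y) x b -> x \notin Z'.
  move=> bx xb; have xY : x \notin Y by apply: scc_notin bY _; rewrite in_scc bx.
  have xK : x \in scc Z b by rewrite in_scc !(connect_delS (subsetUl _ _ : Z \subset Y)).
  by move: xY; rewrite /Y /Z' !in_setU in_setI xK andbT.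
have main x p : path (del D Y) x p -> connect (del D Y) b x -> connect (del D Y) (last x p) b ->
    connect (del D Z') x (last x p).
  elim: p x => //= z p IH x /andP[xz pth] bx lb.
  have bz := connect_trans bx (connect1 xz).
  have zb : connect (del D Y) z b.
    by apply: connect_trans lb; apply/connectP; exists p.
  have xb := connect_trans (connect1 xz) zb.
  apply: connect_trans (IH z pth bz lb); apply: connect1.
  by rewrite /del /= !inX //; case/and3P: xz.
rewrite !in_scc => /andP[by_ yb]; apply/andP; split.
  by case/connectP: (by_) => p pth e; rewrite e; apply: main => //; rewrite -e.
case/connectP: (yb) => p pth e.
by have := main y p pth by_; rewrite -e connect0; apply.
Qed.

End Components.

(** * Decompositions given by a parent function *)

Section Arborescence.

Variables (V N : finType) (D : rel V) (up : N -> option N) (r0 : N).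
Variables (X B W : N -> {set V}).

Hypothesis up_other : forall v, v != r0 -> up v <> None.
Hypothesis W_neq0 : forall v, W v != set0.
Hypothesis W_disj : forall u v, u != v -> [disjoint W u & W v].
Hypothesis B_root : B r0 = setT.
Hypothesis B_split : forall v x,
  x \in B v <-> x \in W v \/ exists2 c, up c = Some v & x \in B c.
Hypothesis B_disj : forall c v, up c = Some v -> [disjoint B c & W v].
Hypothesis B_comp : forall v u, up v = Some u -> B v \in strong_components D (X v).
Variable bound : nat.
(** One set [Z :|: X u] covers the bag and all guards at [u] while missing every child block; it
    yields both the width and the last condition of niceness. *)
Hypothesis hub : forall u, exists Z : {set V},
  [/\ W u \subset Z, #|X u :|: Z| <= bound.+1 &
  forall c, up c = Some u -> X c \subset Z :|: X u /\ [disjoint B c & Z :|: X u]].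

Definition child_of : rel N := [rel u v | up v == Some u].

Let Xe (e : N * N) := X e.2.

(** Bags are non-empty, so blocks shrink strictly along arcs; the inductions over the tree use the
    sizes of blocks. *)
Lemma B_child_lt u v : up v = Some u -> #|B v| < #|B u|.
Proof.
move=> uv; apply/proper_card/properP; split.
  by apply/subsetP => x xv; apply/B_split; right; exists v.
have /set0Pn [x xW] := W_neq0 u; exists x; first by apply/B_split; left.
by rewrite (disjointFl (B_disj uv)).
Qed.

Lemma connect_root v : connect child_of r0 v.
Proof.
have [m] := ubnP (#|V| - #|B v|); elim: m v => // m IH v hv.
have [->|ne] := eqVneq v r0; first exact: connect0.
case E : (up v) => [u|]; last by case: (up_other ne E).
apply: connect_trans (IH u _) (connect1 _); last by rewrite /child_of /= E.
have h1 := B_child_lt E; have h2 := subset_leq_card (subsetT (B u)).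
rewrite cardsT in h2; move: hv h1 h2; clear; lia.
Qed.

Lemma arborescence_child_of : arborescence child_of r0.
Proof.
have asym x y : child_of x y -> ~~ child_of y x.
  move=> /eqP/B_child_lt h; apply/negP => /eqP/B_child_lt h'.
  by have := ltn_trans h h'; rewrite ltnn.
split=> //; last exact: connect_root.
split.
- by move=> x y; rewrite /underlying /= orbC.
- move=> x; rewrite /underlying /= orbb; apply/negP => h.
  by have := asym _ _ h; rewrite h.
- have sub x y : connect child_of x y -> connect (underlying child_of) x y.
    by apply: connect_sub => u v uv; apply: connect1; rewrite /underlying /= uv.
  have sym : connect_sym (underlying child_of).
    by apply: sym_connect_sym => u v; rewrite /underlying /= orbC.
  move=> x y; apply: connect_trans (sub _ _ (connect_root y)).
  by rewrite sym; apply: sub; apply: connect_root.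
move=> s /andP[cyc un]; rewrite leqNgt; apply/negP => sz.
have [v0 v0s] : exists v, v \in s by case: s sz {cyc un} => // v s _; exists v; rewrite inE eqxx.
(* A vertex with a smallest block on the cycle has no child there, so both its neighbours are its
   parent and coincide. *)
have [v vs vmin] := @arg_minnP _ v0 [pred v | v \in s] (fun v => #|B v|) v0s.
have par z : z \in s -> underlying child_of v z -> up v = Some z.
  move=> zs /orP[/eqP/B_child_lt|/eqP//]; by rewrite ltnNge vmin.
case/rot_to: (vs) => i s' es.
have : cycle (underlying child_of) (v :: s') by rewrite -es rot_cycle.
have : uniq (v :: s') by rewrite -es rot_uniq.
have : size (v :: s') = size s by rewrite -es size_rot.
have : {subset v :: s' <= s} by move=> z; rewrite -es mem_rot.
case: s' {es} => [|a [|b s']]; try by move=> _ sz' *; rewrite -sz' in sz.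
move=> sub _ /and3P[_ nin _] /= /andP[va]; rewrite rcons_path -/(last b s').
case/and3P=> _ _ lv.
have la : last b s' \in b :: s' by apply: mem_last.
have e1 : up v = Some a by apply: par va; apply: sub; rewrite !inE eqxx orbT.
have e2 : up v = Some (last b s').
  by apply: par; [apply: sub; rewrite !(in_cons _ _ (last b s')) -in_cons la !orbT | rewrite /underlying /= orbC].
by move: e2 nin; rewrite e1 => -[->]; rewrite la.
Qed.

Lemma below_child_of e : child_of e.1 e.2 -> below child_of W e = B e.2.
Proof.
move=> _; apply/setP => x; rewrite /below; move: e.2 => v {e}.
apply/bigcupP/idP => [[r vr xr]|].
  have xr' : x \in B r by apply/B_split; left.
  case/connectP: vr xr' => p pth ->; elim: p v pth => //= z p IH v /andP[/eqP vz pth] xl.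
  by apply/B_split; right; exists z => //; apply: IH.
have [m] := ubnP #|B v|; elim: m v => // m IH v hv /B_split [xv|[c vc xc]].
  by exists v => //; apply: connect0.
have [|r cr xr] := IH c _ xc; first by have := B_child_lt vc; lia.
exists r => //; apply: connect_trans cr; apply: connect1.
by rewrite /child_of /= vc.
Qed.

Lemma nice_child_of : nice_arboreal_decomposition D child_of Xe W.
Proof.
have comps e : child_of e.1 e.2 -> below child_of W e \in strong_components D (Xe e).
  by move=> h; rewrite below_child_of //; move/eqP: h; apply: B_comp.
split=> //.
  split.
  - by exists r0; apply: arborescence_child_of.
  - split=> //; apply/setP => x; rewrite inE; apply/bigcupP.
    have : x \in B r0 by rewrite B_root inE.
    move: (r0) => v; have [m] := ubnP #|B v|; elim: m v => // m IH v hv /B_split [xv|[c vc xc]].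
      by exists v.
    by apply: IH xc; have := B_child_lt vc; lia.
  - by move=> e /comps; apply: guarded_strong_component.
move=> r; apply: disjoint_setI0; apply: disjointI => x /bigcupP[c /eqP rc xc].
have [Z [_ _ hZ]] := hub r; have xB : x \in B c by apply/B_split; left.
apply/negP => /bigcupP[[u v] /andP[/= /eqP uv inc] xX].
have {inc xX}: x \in Z :|: X r.
  case/orP: inc => /= /eqP er; subst.
    by have [/subsetP h _] := hZ _ uv; apply: h.
  by rewrite in_setU xX orbT.
by have [_ d] := hZ _ rc; rewrite (disjointFr d xB).
Qed.

Lemma width_child_of : width child_of Xe W <= bound.
Proof.
rewrite /width; suff: \max_r #|W r :|: guards child_of Xe r| <= bound.+1.
  by case: (\max_r _).
apply/bigmax_leqP => r _; have [Z [WZ hb hZ]] := hub r.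
apply: leq_trans hb; apply: subset_leq_card; apply/subsetP => x.
rewrite !in_setU => /orP[/(subsetP WZ)->|/bigcupP[[u v] /andP[/= /eqP uv inc] xX]].
  by rewrite orbT.
case/orP: inc => /= /eqP er; subst; last by rewrite xX.
by have [/subsetP h _] := hZ _ uv; have := h _ xX; rewrite in_setU orbC.
Qed.

End Arborescence.

(** * Partial decompositions and the splitting of a node *)

Section Layout.

Variables (V : finType) (D : rel V) (k : nat).

(* A partial decomposition whose nodes are named by vertices: [is_done] marks the nodes already split, and a node not yet split has [W v = B v]. *)
Record layout (is_node is_done : pred V) (up : V -> option V) (X B W : V -> {set V}) : Prop := Layout {
  l_root : exists r0, [/\ is_node r0, up r0 = None, B r0 = setT, X r0 = set0 &
     forall v, is_node v -> v != r0 -> exists2 u, up v = Some u & is_done u];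
  l_dn : forall u, is_done u -> is_node u;
  l_pend : forall u, is_node u -> ~~ is_done u -> W u = B u;
  l_self : forall v, is_node v -> v \in W v;
  l_disj : forall u v x, is_node u -> is_node v -> x \in W u -> x \in W v -> u = v;
  l_split : forall v x, is_node v ->
    (x \in B v <-> x \in W v \/ exists c, [/\ is_node c, up c = Some v & x \in B c]);
  l_bw : forall c v, is_node c -> up c = Some v -> [disjoint B c & W v];
  l_comp : forall v, is_node v -> up v <> None -> B v \in strong_components D (X v);
  l_X : forall v, is_node v -> #|X v| <= 2 * k - 1;
  l_hub : forall u, is_done u -> exists Z : {set V},
    [/\ W u \subset Z, #|X u :|: Z| <= 3 * k - 1 &
     forall c, is_node c -> up c = Some u -> X c \subset Z :|: X u /\ [disjoint B c & Z :|: X u]] }.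

Lemma layout_up is_node is_done up X B W c u : layout is_node is_done up X B W ->
  is_node c -> up c = Some u -> is_done u.
Proof.
move=> L dc uc; have [r0 [_ h _ _ hr]] := l_root L.
have [e|ne] := eqVneq c r0; first by rewrite e h in uc.
by have [u' h1 h2] := hr _ dc ne; rewrite h1 in uc; case: uc => <-.
Qed.

Lemma layout_closed is_node is_done up X B W v y : layout is_node is_done up X B W ->
  is_node v -> y \in B v -> y \notin X v /\ scc D (X v) y \subset B v.
Proof.
move=> L dv; have [r0 [_ h hB hX hr]] := l_root L.
have [->|ne] := eqVneq v r0; first by rewrite hB hX => _; rewrite inE subsetT.
have uv : up v <> None by case: (hr _ dv ne) => u ->.
have /strong_componentsP [b bX ->] := l_comp L dv uv => yb.
by split; [exact: scc_notin bX yb | rewrite (scc_eq yb)].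
Qed.

(** [pick] chooses the same vertex from a component whichever member defines it; this representative
    names the child node. *)
Definition child (X B Z : {set V}) b :=
  [&& b \in B, b \notin Z &
    if [pick y | y \in scc D (Z :|: X) b] is Some y then y == b else false].

Lemma child_exists (X B Z : {set V}) y : y \in B -> y \notin Z ->
  (forall x, x \in B -> scc D X x \subset B) -> y \notin X ->
  exists2 b, child X B Z b & y \in scc D (Z :|: X) b.
Proof.
move=> yB yZ cl yX; case E: [pick z | z \in scc D (Z :|: X) y] => [b|]; last first.
  by move: E; case: pickP => // /(_ y); rewrite scc_refl.
have hb : b \in scc D (Z :|: X) y by move: E; case: pickP => // z hz [<-].
have eb := scc_eq hb.
exists b; last by rewrite eb scc_refl.
apply/and3P; split.
- by apply: (subsetP (cl _ yB)); apply: (subsetP (scc_sub D y (subsetUr Z X))).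
- have yZX : y \notin Z :|: X by rewrite in_setU negb_or yZ.
  by have := scc_notin yZX hb; rewrite in_setU negb_or => /andP[].
- by rewrite eb E.
Qed.

Lemma child_inj (X B Z : {set V}) b c y : child X B Z b -> child X B Z c ->
  y \in scc D (Z :|: X) b -> y \in scc D (Z :|: X) c -> b = c.
Proof.
move=> /and3P[_ _ hb] /and3P[_ _ hc] yb yc; move: hb hc.
rewrite -(scc_eq yb) -(scc_eq yc); case: pick => // z /eqP -> /eqP //.
Qed.

(** The new data enter through pointwise equations, which leaves the representation of tables
    open. *)
Lemma layout_expand (is_node is_done : pred V) (up : V -> option V) (X B W : V -> {set V}) v
    (Z : {set V}) (is_node' is_done' : pred V) (up' : V -> option V) (X' B' W' : V -> {set V}) :
  layout is_node is_done up X B W -> is_node v -> ~~ is_done v -> v \in Z ->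
  #|X v :|: Z| <= 3 * k - 1 ->
  (forall b, b \in B v -> b \notin Z -> #|Z :|: (X v :&: scc D Z b)| <= 2 * k - 1) ->
  let ch := child (X v) (B v) Z in
  (forall p, is_node' p = is_node p || ch p) ->
  (forall p, is_done' p = (p == v) || is_done p) ->
  (forall p, up' p = if ch p then Some v else up p) ->
  (forall p, X' p = if ch p then Z :|: (X v :&: scc D Z p) else X p) ->
  (forall p, B' p = if ch p then scc D (Z :|: X v) p else B p) ->
  (forall p, W' p = if p == v then B v :&: Z else if ch p then scc D (Z :|: X v) p else W p) ->
  layout is_node' is_done' up' X' B' W'.
Proof.
move=> L dv pv vZ hub bnd ch edm edn eup eX eB eW.
have WB : W v = B v := l_pend L dv pv.
have cl y : y \in B v -> y \notin X v /\ scc D (X v) y \subset B v := layout_closed L dv.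
have chB b : ch b -> [/\ b \in B v, b \notin Z & b \notin X v].
  by move=> /and3P[h1 h2 _]; split=> //; case: (cl _ h1).
have chv : ch v = false by apply: contraTF vZ => /chB[].
have chcomp b y : ch b -> y \in scc D (Z :|: X v) b ->
    [/\ y \in B v, y \notin Z & y \notin X v].
  move=> hb yb; have [h1 h2 h3] := chB _ hb.
  have h : b \notin Z :|: X v by rewrite in_setU negb_or h2.
  have := scc_notin h yb; rewrite in_setU negb_or => /andP[yZ yX]; split=> //.
  have [_ /subsetP] := cl _ h1; apply.
  by apply: (subsetP (scc_sub D b (subsetUr Z (X v)))).
(* Child names are fresh: a node lies in its own bag, bags are disjoint, and in the bag of the
   unsplit [v] the only name is [v], which is in [Z]. *)
have chdm b : ch b -> is_node b = false.
  move=> hb; have [h1 h2 _] := chB _ hb; apply/negP => db.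
  have e : b = v by apply: (l_disj L db dv (l_self L db)); rewrite WB.
  by rewrite e vZ in h2.
have chdn b : ch b -> is_done b = false.
  by move=> hb; apply/negP => /(l_dn L); rewrite chdm.
have upv c u : is_node c -> up c = Some u -> u != v.
  by move=> dc /(layout_up L dc) du; apply: contraNneq pv => <-.
have cases p : is_node' p -> ch p \/ ch p = false /\ is_node p.
  by rewrite edm; case: (ch p); [left | rewrite orbF; right].
(* the blocks created below [v] stay inside the old block of [v] *)
have old p x : is_node' p -> x \in W' p -> exists2 q, is_node q /\ x \in W q & q = p \/ q = v /\ (p = v \/ ch p).
  move=> dp; rewrite eW; have [->|ne] := eqVneq p v.
    by rewrite inE => /andP[xB _]; exists v; [split; rewrite ?WB | left].
  case: (cases p dp) => [hp|[hp dp']]; rewrite hp.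
    by move=> /(chcomp _ _ hp)[xB _ _]; exists v; [split; rewrite ?WB | right; split; [|right]].
  by exists p; [|left].
split.
- have [r0 [h1 h2 h3 h4 h5]] := l_root L; exists r0.
  have cr : ch r0 = false by apply: contraTF h1 => /chdm->.
  split; rewrite ?edm ?eup ?eB ?eX ?cr ?h1 // => p.
  rewrite eup => /cases [hp _|[hp dp] /(h5 _ dp) [u hu du]]; rewrite hp.
    by exists v => //; rewrite edn eqxx.
  by exists u => //; rewrite edn du orbT.
- by move=> u; rewrite edn edm => /orP[/eqP->|/(l_dn L)->//]; rewrite dv.
- move=> u; rewrite edn negb_or eW eB => du /andP[/negbTE-> nu].
  by case: (cases u du) => [->//|[-> du']]; apply: (l_pend L).
- move=> u du; rewrite eW; have [->|ne] := eqVneq u v.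
    by rewrite inE vZ andbT -WB; exact: (l_self L dv).
  by case: (cases u du) => [->|[-> du']]; [exact: scc_refl | exact: (l_self L du')].
- move=> p q x dp dq xp xq.
  have [p' [dp' xp'] ep] := old _ _ dp xp; have [q' [dq' xq'] eq_] := old _ _ dq xq.
  have e := l_disj L dp' dq' xp' xq'; subst q'.
  have group r : is_node' r -> r = p' \/ p' = v /\ (r = v \/ ch r) -> p' = v -> r = v \/ ch r.
    by move=> _ [->|[_ //]] ->; left.
  have [ev|nv] := eqVneq p' v; last first.
    case: ep => [<-|[h _]]; last by rewrite h eqxx in nv.
    by case: eq_ => [<-//|[h _]]; rewrite h eqxx in nv.
  have {ep} gp : p = v \/ ch p by apply: group => //; case: ep => [<-|]; [left | right].
  have {eq_} gq : q = v \/ ch q by apply: group => //; case: eq_ => [<-|]; [left | right].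
  have Wv : W' v = B v :&: Z by rewrite eW eqxx.
  have Wc c : ch c -> W' c = scc D (Z :|: X v) c.
    by move=> hc; rewrite eW hc; case: eqP => // e; rewrite e chv in hc.
  case: gp => [e1|cp]; case: gq => [e2|cq]; rewrite ?e1 ?e2 //.
  + rewrite e1 Wv inE in xp; rewrite (Wc _ cq) in xq.
    by have [_ h _] := chcomp _ _ cq xq; rewrite (negbTE h) andbF in xp.
  + rewrite e2 Wv inE in xq; rewrite (Wc _ cp) in xp.
    by have [_ h _] := chcomp _ _ cp xp; rewrite (negbTE h) andbF in xq.
  + by rewrite (Wc _ cp) in xp; rewrite (Wc _ cq) in xq; apply: child_inj cp cq xp xq.
- move=> u x du; rewrite eB eW.
  case: (cases u du) => [hu|[hu du']]; rewrite hu.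
    have -> : (u == v) = false by apply: contraTF hu => /eqP->; rewrite chv.
    split=> [|[//|[c [dc]]]]; first by left.
    rewrite eup; case: (cases c dc) => [->[e]|[-> dc'] uc]; first by rewrite -e chv in hu.
    by have := l_dn L (layout_up L dc' uc); rewrite chdm.
  have [->|ne] := eqVneq u v.
    split=> [xB|[|[c [dc]]]].
    + case xZ: (x \in Z); first by left; rewrite inE xB.
      have [xX _] := cl _ xB.
      have [b hb xb] := child_exists xB (negbT xZ) (fun y h => (cl y h).2) xX.
      by right; exists b; have {}hb : ch b := hb; rewrite edm eup eB hb orbT.
    + by rewrite inE => /andP[].
    + rewrite eup eB; case: (cases c dc) => [hc|[-> dc']].
        by rewrite hc => _ /(chcomp _ _ hc)[].
      by move=> /(upv _ _ dc'); rewrite eqxx.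
  split=> [/(l_split L x du')[|[c [dc uc xc]]]|[xW|[c [dc]]]].
  + by left.
  + right; exists c; rewrite edm eup eB dc.
    by have -> : ch c = false by apply: contraTF dc => /chdm->.
  + by apply/(l_split L x du'); left.
  + rewrite eup eB; case: (cases c dc) => [->[e]|[-> dc'] uc xc]; first by rewrite e eqxx in ne.
    by apply/(l_split L x du'); right; exists c.
- move=> c u dc; rewrite eup eB eW; case: (cases c dc) => [hc|[-> dc']].
    rewrite hc => -[<-]; rewrite eqxx; apply: disjointI => x /(chcomp _ _ hc)[_ h _].
    by rewrite inE (negbTE h) andbF.
  move=> uc; rewrite (negbTE (upv _ _ dc' uc)).
  have -> : ch u = false.
    by apply: contraTF (l_dn L (layout_up L dc' uc)) => /chdm->.
  exact: (l_bw L dc' uc).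
- move=> u du; rewrite eup eB eX; case: (cases u du) => [hu|[-> du']]; last exact: (l_comp L du').
  rewrite hu => _; have [h1 h2 h3] := chB _ hu.
  apply/strong_componentsP; exists u; last by rewrite scc_shrink.
  by rewrite in_setU in_setI negb_or h2 (negbTE h3).
- move=> u du; rewrite eX; case: (cases u du) => [hu|[-> du']]; last exact: (l_X L du').
  by rewrite hu; have [h1 h2 _] := chB _ hu; apply: bnd.
move=> u; rewrite edn => /orP[/eqP->|du].
  exists Z; rewrite eW eX eqxx chv; split=> //; first exact: subsetIr.
  move=> c dc; rewrite eup eX eB; case: (cases c dc) => [hc|[-> dc'] /(upv _ _ dc')]; last by rewrite eqxx.
  rewrite hc => _; split; first by rewrite setUS // subsetIl.
  apply: disjointI => x /(chcomp _ _ hc)[_ h1 h2].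
  by rewrite in_setU negb_or h1.
have [Y [h1 h2 h3]] := l_hub L du; exists Y.
have uv : (u == v) = false by apply: contraTF du => /eqP->.
have cu : ch u = false by apply: contraTF (l_dn L du) => /chdm->.
rewrite eW eX uv cu; split=> // c dc; rewrite eup eX eB.
by case: (cases c dc) => [->[e]|[-> dc']]; [rewrite e eqxx in uv | exact: h3].
Qed.

End Layout.

(** * The decomposition algorithm *)

Section Tables.

Variables (V : finType) (D : rel V) (k : nat).

(* the parent, the guard [X], the block [B], and the bag [W] once the node has been split *)
Definition node (U : finType) : Type := ((option U * {set U}) * ({set U} * option {set U}))%type.

Definition table (U : finType) : Type := U -> option (node U).

Implicit Types (tb : table V) (nd : node V) (T X Z : {set V}).

Definition pending tb v :=
  if tb v is Some nd then (if nd.2.2 is Some W then false else true) else false.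

Definition fill_step T :=
  if #|T| < (k + k).-1 then
    if [pick v | v \notin T] is Some v then add_vtx T v else T
  else T.

Definition fill X := iter #|V| fill_step X.

Definition splitter X v : option {set V} :=
  if #|fill X| < (k + k).-1 then Some setT
  else if find_separator D k (fill X) is Some s then Some (add_vtx s.1.2 v) else None.

Definition expand tb v nd Z : table V := fun b =>
  if b == v then Some (nd.1, (nd.2.1, Some (nd.2.1 :&: Z)))
  else if child D nd.1.2 nd.2.1 Z b then
    Some ((Some v, Z :|: (nd.1.2 :&: scc D Z b)), (scc D (Z :|: nd.1.2) b, None))
  else tb b.

(** The second component freezes the loop once a linked set has been found. *)
Definition step (st : table V * option {set V}) : table V * option {set V} :=
  if st.2 is Some T then st else
  if [pick v | pending st.1 v] is Some v then
    if st.1 v is Some nd then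
      if splitter nd.1.2 v is Some Z then (expand st.1 v nd Z, None)
      else (st.1, Some (fill nd.1.2))
    else st
  else st.

Definition start : table V := fun b =>
  if [pick v : V | true] is Some r then
    if b == r then Some ((None, set0), (setT, None)) else None
  else None.

Definition decompose := iter #|V| step (start, None).

Definition is_node tb v := isSome (tb v).
Definition is_done tb v :=
  if tb v is Some nd then (if nd.2.2 is Some W then true else false) else false.
Definition up tb v := if tb v is Some nd then nd.1.1 else None.
Definition guard_of tb v := if tb v is Some nd then nd.1.2 else set0.
Definition block_of tb v := if tb v is Some nd then nd.2.1 else set0.
Definition bag_of tb v :=
  if tb v is Some nd then (if nd.2.2 is Some W then W else nd.2.1) else set0.

Definition good tb := layout D k (is_node tb) (is_done tb) (up tb) (guard_of tb) (block_of tb) (bag_of tb).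

Hypothesis k_gt0 : 0 < k.

Lemma fill_sub X : X \subset fill X.
Proof.
rewrite /fill; elim: #|V| => // n IH; apply: subset_trans IH _; rewrite /= /fill_step.
case: ifP => // _; case: pickP => // v _.
by apply/subsetP => x xT; rewrite inE xT.
Qed.

Lemma fill_card X : #|X| <= (k + k).-1 ->
  #|fill X| <= (k + k).-1 /\ (#|fill X| < (k + k).-1 -> #|V| < (k + k).-1).
Proof.
move=> hX; suff: forall n, let T := iter n fill_step X in
    #|T| <= (k + k).-1 /\ (#|T| < (k + k).-1 -> T = setT \/ n <= #|T|).
  move=> /(_ #|V|) [h1 h2]; split=> // h; case: (h2 h) => [e|le].
    by rewrite -/(fill X) in e; rewrite -cardsT -e.
  exact: leq_ltn_trans le h.
elim=> [|n [h1 h2]]; first by split=> // _; right.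
move: h1 h2; rewrite iterS; set T := iter n fill_step X => h1 h2 T'.
rewrite {}/T' /fill_step; case: ifP => [lt|ge]; last by split=> //; rewrite ge.
case: pickP => [v vT|full].
  rewrite card_add_vtx //; split=> // _; right; case: (h2 lt) => [e|//].
  by move: vT; rewrite e inE.
split=> // _; left; apply/setP => x; rewrite inE.
exact: negbFE (full x).
Qed.

Lemma pendingE tb v : pending tb v = is_node tb v && ~~ is_done tb v.
Proof. by rewrite /pending /is_node /is_done; case: (tb v) => [[a [b [w|]]]|]. Qed.

Lemma good_expand tb v nd Z : good tb -> tb v = Some nd -> pending tb v -> v \in Z ->
  #|nd.1.2 :|: Z| <= 3 * k - 1 ->
  (forall b, b \in nd.2.1 -> b \notin Z -> #|Z :|: (nd.1.2 :&: scc D Z b)| <= 2 * k - 1) ->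
  good (expand tb v nd Z).
Proof.
move=> L e; rewrite pendingE => /andP[dv pv] vZ h1 h2.
have eX : guard_of tb v = nd.1.2 by rewrite /guard_of e.
have eB : block_of tb v = nd.2.1 by rewrite /block_of e.
rewrite -eX -eB in h1 h2.
have chv : child D (guard_of tb v) (block_of tb v) Z v = false by rewrite /child vZ andbF.
have chdn p : child D (guard_of tb v) (block_of tb v) Z p -> is_node tb p = false.
  move=> /and3P[pB pZ _]; apply/negP => dp.
  have ee : p = v.
    by apply: (l_disj L dp dv (l_self L dp)); rewrite (l_pend L dv pv).
  by rewrite ee vZ in pZ.
have nd2 : nd.2.2 = None by move: pv; rewrite /is_done e; case: nd.2.2.
have eE p : expand tb v nd Z p =
    if p == v then Some (nd.1, (nd.2.1, Some (block_of tb v :&: Z)))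
    else if child D (guard_of tb v) (block_of tb v) Z p then
      Some ((Some v, Z :|: (guard_of tb v :&: scc D Z p)), (scc D (Z :|: guard_of tb v) p, None))
    else tb p by rewrite /expand eX eB.
apply: (layout_expand L dv pv vZ h1 h2) => p.
- rewrite /is_node eE; have [->|ne] := eqVneq p v; first by rewrite e.
  by case: ifP; rewrite ?orbT ?orbF.
- rewrite /is_done eE; have [->|ne] := eqVneq p v; first by [].
  case: ifP => // /chdn; rewrite /is_node /=; by case: (tb p).
- rewrite /up eE; have [->|ne] := eqVneq p v; first by rewrite chv e.
  by case: ifP.
- rewrite /guard_of eE -/(guard_of tb v) -/(guard_of tb p); have [->|ne] := eqVneq p v; first by rewrite chv eX.
  by case: ifP.
- rewrite /block_of eE -/(block_of tb v) -/(block_of tb p); have [->|ne] := eqVneq p v; first by rewrite chv eB.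
  by case: ifP.
- by rewrite /bag_of eE; case: (p == v) => //; case: ifP.
Qed.

Lemma good_start : 0 < #|V| -> good start.
Proof.
move=> n0; rewrite /good /start; case: pickP => [r _|none]; last first.
  by case/card_gt0P: n0 => x _; have := none x.
have only (T : Type) (f : node V -> T) (d : T) b :
    (if (if b == r then Some ((None, set0), (setT, None)) else None) is Some nd then f nd else d)
    = if b == r then f ((None, set0), (setT, None)) else d by case: eqP.
have dmE b : is_node (fun b => if b == r then Some ((None, set0), (setT, None)) else None) b -> b = r.
  by rewrite /is_node; case: eqP.
split.
- exists r; rewrite /is_node /up /block_of /guard_of eqxx; split=> // v; rewrite /is_node.
  by case: eqP => // ->; rewrite eqxx.
- by move=> u; rewrite /is_done only; case: eqP.
- by move=> u /dmE-> _; rewrite /bag_of /block_of eqxx.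
- by move=> v /dmE->; rewrite /bag_of eqxx inE.
- by move=> u v x /dmE-> /dmE->.
- move=> v x /dmE->; rewrite /block_of /bag_of eqxx /=; split=> [h|_]; [by left | by rewrite inE].
- by move=> c v /dmE->; rewrite /up eqxx.
- by move=> v /dmE->; rewrite /up eqxx.
- by move=> v /dmE->; rewrite /guard_of eqxx cards0.
- by move=> u; rewrite /is_done only; case: eqP.
Qed.

Lemma good_X tb v nd : good tb -> tb v = Some nd -> #|nd.1.2| <= (k + k).-1.
Proof.
move=> L e; have dv : is_node tb v by rewrite /is_node e.
by have := l_X L dv; rewrite /guard_of e => h; apply: leq_trans h _; lia.
Qed.

(** In the separator case [Z] has at most [k] vertices. The hub then has at most
    [(2k - 1) + k = 3k - 1] vertices, hence the width [3k - 2], and a child guard at most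
    [k + (k - 1) = 2k - 1], which restores the invariant on guards. *)
Lemma splitter_some tb v nd Z : good tb -> tb v = Some nd -> splitter nd.1.2 v = Some Z ->
  [/\ v \in Z, #|nd.1.2 :|: Z| <= 3 * k - 1 &
   forall b, b \in nd.2.1 -> b \notin Z -> #|Z :|: (nd.1.2 :&: scc D Z b)| <= 2 * k - 1].
Proof.
move=> L e; have hX := good_X L e; have [c1 c2] := fill_card hX.
rewrite /splitter; case: ifP => [/c2 lt [<-]|ge].
  split=> [| |b _]; rewrite ?inE //.
  by rewrite setUT cardsT; move: lt k_gt0; clear; lia.
case E: find_separator => [s|] // [<-].
have [hZ hb] := find_separator_sound E.
have c3 := card_add_vtx_le s.1.2 v; set Y := add_vtx _ _ in c3 *.
have sub : s.1.2 \subset Y by apply/subsetP => x xs; rewrite inE xs.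
split; first by rewrite inE eqxx orbT.
  by have := (leq_card_setU nd.1.2 Y).1; move: hX hZ c3 k_gt0; clear; lia.
move=> b _ bZ; apply: leq_trans (leq_card_setU _ _) _.
have bs : b \notin s.1.2 by apply: contra bZ; apply: subsetP.
have hC : scc D s.1.2 b \in strong_components D s.1.2 by apply/strong_componentsP; exists b.
have := hb _ hC.
(* Balance is known without [v]; adding [v] to the separator only shrinks components. *)
have : #|nd.1.2 :&: scc D Y b| <= #|scc D s.1.2 b :&: fill nd.1.2|.
  apply: subset_leq_card; rewrite setIC; apply: setISS; first exact: scc_sub.
  exact: fill_sub.
by move: hZ c3 k_gt0; clear; lia.
Qed.

Lemma splitter_none tb v nd : good tb -> tb v = Some nd -> splitter nd.1.2 v = None ->
  #|fill nd.1.2| = 2 * k - 1 /\ linked D (k - 1) (k - 1) (fill nd.1.2).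
Proof.
move=> L e; have hX := good_X L e; have [c1 c2] := fill_card hX.
rewrite /splitter; case: ifP => // /negbT; rewrite -leqNgt => ge.
case E: find_separator => [s|] // _; split; first by move: c1 ge k_gt0; clear; lia.
move=> Z hZ; rewrite addn1 ltnNge; apply/negP => le.
rewrite subn1 in hZ le.
have lt : #|fill nd.1.2| < k + k by move: c1 k_gt0; clear; lia.
by have := find_separator_complete k_gt0 lt hZ le; rewrite E.
Qed.

(** Each step without a linked set completes a pending node, if any is left. Nodes are named by
    vertices, so [#|V|] steps suffice. *)
Lemma decompose_inv : 0 < #|V| ->
  let st := decompose in
  good st.1 /\
  (if st.2 is Some T then #|T| = 2 * k - 1 /\ linked D (k - 1) (k - 1) T
   else forall v, ~~ pending st.1 v).
Proof.
move=> n0; suff: forall m, let st := iter m step (start, None) in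
  good st.1 /\
  (if st.2 is Some T then #|T| = 2 * k - 1 /\ linked D (k - 1) (k - 1) T
   else (forall v, ~~ pending st.1 v) \/ m <= #|[set v | is_done st.1 v]|).
  move=> /(_ #|V|) [h1 h2]; split=> //; rewrite -/decompose in h1 h2 *.
  case: decompose.2 h2 => // -[//|le] v.
  rewrite pendingE negb_and negbK; apply/orP; right.
  have /eqP/setP/(_ v) : [set v | is_done decompose.1 v] == setT.
    by rewrite eqEcard subsetT cardsT.
  by rewrite !inE.
elim=> [|m [h1 h2]]; first by split; [exact: good_start | right].
move: h1 h2; rewrite iterS; set st := iter m step _ => h1 h2 st'; rewrite {}/st'.
rewrite /step; case E2: st.2 h2 => [T|] h2; first by rewrite E2.
case: pickP => [v pv|none]; last first.
  by rewrite E2; split=> //; left => v; rewrite none.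
case E: (st.1 v) => [nd|]; last by move: pv; rewrite /pending E.
case ES: splitter => [Z|]; last by split=> //; apply: splitter_none h1 E ES.
have [vZ b1 b2] := splitter_some h1 E ES.
split; first exact: good_expand h1 E pv vZ b1 b2.
right; case: h2 => [h2|le]; first by have := h2 v; rewrite pv.
apply: leq_ltn_trans le _; apply/proper_card/properP.
have nv : v \notin [set v | is_done st.1 v].
  by move: pv; rewrite pendingE inE => /andP[].
split; last by exists v => //; rewrite inE /= /is_done /expand eqxx.
apply/subsetP => u; rewrite !inE /= => du; rewrite /is_done /expand.
case: eqP => // ne; case: ifP => [/and3P[uB uZ _]|_]; last by move: du; rewrite /is_done.
have dmu := l_dn h1 du; have dv : is_node st.1 v by rewrite /is_node E.
have pdv : ~~ is_done st.1 v by move: pv; rewrite pendingE => /andP[].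
case: ne; apply: (l_disj h1 dmu dv (l_self h1 dmu)).
by rewrite (l_pend h1 dv pdv) /block_of E.
Qed.

End Tables.

(** * Computability of the decomposition algorithm and of its output *)

Definition node_ty := prod_ty (prod_ty (opt_ty vtx_ty) set_ty) (prod_ty set_ty (opt_ty set_ty)).
Definition table_ty := tab_ty (opt_ty node_ty).

Ltac jopt := first [ apply: (@fpt_opt _ vtx_ty) | apply: (@fpt_opt _ set_ty)
  | apply: (@fpt_opt _ node_ty) | apply: (@fpt_opt _ state_ty) ].

Lemma fpt_scc0 : @fpt (prod_ty set_ty vtx_ty) set_ty (fun I x => @scc _ (@arcs I) x.1 x.2).
Proof.
apply: (@fpt_ext (prod_ty set_ty vtx_ty) set_ty (fun I x =>
   [set y | connect (del (@arcs I) x.1) x.2 y && connect (del (@arcs I) x.1) y x.2])).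
  by jauto ltac:(apply: fpt_connect).
by move=> I x; apply/setP => y; rewrite inE in_scc.
Qed.

Lemma fpt_scc A (Z : forall I, car A I -> car set_ty I) (v : forall I, car A I -> car vtx_ty I) :
  fpt Z -> fpt v -> @fpt A set_ty (fun I x => @scc _ (@arcs I) (Z I x) (v I x)).
Proof. by move=> hZ hv; exact: (fpt_comp (fpt_pair hZ hv) fpt_scc0). Qed.

Lemma fpt_setU A (X Y : forall I, car A I -> car set_ty I) :
  fpt X -> fpt Y -> @fpt A set_ty (fun I x => X I x :|: Y I x).
Proof.
move=> hX hY.
have h : @fpt (prod_ty set_ty set_ty) set_ty (fun I x => [set v | (v \in x.1) || (v \in x.2)]).
  by jauto jnone.
by apply: (fpt_ext (fpt_comp (fpt_pair hX hY) h)) => I x; apply/setP => v; rewrite !inE.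
Qed.

Lemma fpt_setI A (X Y : forall I, car A I -> car set_ty I) :
  fpt X -> fpt Y -> @fpt A set_ty (fun I x => X I x :&: Y I x).
Proof.
move=> hX hY.
have h : @fpt (prod_ty set_ty set_ty) set_ty (fun I x => [set v | (v \in x.1) && (v \in x.2)]).
  by jauto jnone.
by apply: (fpt_ext (fpt_comp (fpt_pair hX hY) h)) => I x; apply/setP => v; rewrite !inE.
Qed.

Lemma fpt_setT A : @fpt A set_ty (fun I _ => setT).
Proof.
have h : @fpt A set_ty (fun I _ => [set v | true]) by apply: fpt_set; apply: fpt_true.
by apply: (fpt_ext h) => I x; apply/setP => v; rewrite !inE.
Qed.

Ltac jset := first [ apply: fpt_setU | apply: fpt_setI | apply: fpt_setT | apply: fpt_scc
  | apply: fpt_add_vtx ].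

Lemma fpt_child0 : @fpt (prod_ty (prod_ty (prod_ty set_ty set_ty) set_ty) vtx_ty) bool_ty
  (fun I x => @child _ (@arcs I) x.1.1.1 x.1.1.2 x.1.2 x.2).
Proof. by rewrite /child; jauto jset. Qed.

Lemma fpt_child A (X B Z : forall I, car A I -> car set_ty I) (v : forall I, car A I -> car vtx_ty I) :
  fpt X -> fpt B -> fpt Z -> fpt v ->
  @fpt A bool_ty (fun I x => @child _ (@arcs I) (X I x) (B I x) (Z I x) (v I x)).
Proof.
by move=> hX hB hZ hv; exact: (fpt_comp (fpt_pair (fpt_pair (fpt_pair hX hB) hZ) hv) fpt_child0).
Qed.

Lemma fpt_param_target A : @fpt A (cst_ty (fun I => (param I + param I).-1)) (fun _ _ => tt).
Proof. exact: fpt_cst_pred (fpt_param_double A). Qed.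

Ltac jtarget := apply: (@fpt_card_lt _ _ _ (fpt_param_target _)).

Lemma fpt_fill0 : @fpt set_ty set_ty (fun I X => fill (param I) X).
Proof. by rewrite /fill /fill_step; jauto ltac:(first [ jtarget | jset ]). Qed.

Lemma fpt_fill A (X : forall I, car A I -> car set_ty I) :
  fpt X -> @fpt A set_ty (fun I x => fill (param I) (X I x)).
Proof. by move=> hX; exact: (fpt_comp hX fpt_fill0). Qed.

Lemma fpt_splitter0 : @fpt (prod_ty set_ty vtx_ty) (opt_ty set_ty)
  (fun I x => @splitter _ (@arcs I) (param I) x.1 x.2).
Proof.
rewrite /splitter.
by jauto ltac:(first [ jtarget | jset | apply: fpt_fill | apply: fpt_find_separator
  | apply: (@fpt_opt _ state_ty) ]).
Qed.

Lemma fpt_splitter A (X : forall I, car A I -> car set_ty I) (v : forall I, car A I -> car vtx_ty I) :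
  fpt X -> fpt v -> @fpt A (opt_ty set_ty) (fun I x => @splitter _ (@arcs I) (param I) (X I x) (v I x)).
Proof. by move=> hX hv; exact: (fpt_comp (fpt_pair hX hv) fpt_splitter0). Qed.

Lemma fpt_expand0 : @fpt (prod_ty (prod_ty (prod_ty table_ty vtx_ty) node_ty) set_ty) table_ty
  (fun I x => @expand _ (@arcs I) x.1.1.1 x.1.1.2 x.1.2 x.2).
Proof. by rewrite /expand; jauto ltac:(first [ apply: fpt_child | jset ]). Qed.

Lemma fpt_expand A (tb : forall I, car A I -> car table_ty I) (v : forall I, car A I -> car vtx_ty I)
   (nd : forall I, car A I -> car node_ty I) (Z : forall I, car A I -> car set_ty I) :
  fpt tb -> fpt v -> fpt nd -> fpt Z ->
  @fpt A table_ty (fun I x => @expand _ (@arcs I) (tb I x) (v I x) (nd I x) (Z I x)).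
Proof.
by move=> h1 h2 h3 h4; exact: (fpt_comp (fpt_pair (fpt_pair (fpt_pair h1 h2) h3) h4) fpt_expand0).
Qed.

Lemma fpt_pending0 : @fpt (prod_ty table_ty vtx_ty) bool_ty (fun I x => pending x.1 x.2).
Proof. by rewrite /pending; jauto jopt. Qed.

Lemma fpt_pending A (tb : forall I, car A I -> car table_ty I) (v : forall I, car A I -> car vtx_ty I) :
  fpt tb -> fpt v -> @fpt A bool_ty (fun I x => pending (tb I x) (v I x)).
Proof. by move=> h1 h2; exact: (fpt_comp (fpt_pair h1 h2) fpt_pending0). Qed.

Definition loop_ty := prod_ty table_ty (opt_ty set_ty).

Lemma fpt_step0 : @fpt loop_ty loop_ty (fun I st => @step _ (@arcs I) (param I) st).
Proof.
rewrite /step.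
by jauto ltac:(first [ jopt | apply: fpt_pending | apply: fpt_expand | apply: fpt_splitter | apply: fpt_fill ]).
Qed.

Lemma fpt_start A : @fpt A table_ty (fun I _ => @start _).
Proof. by rewrite /start; jauto ltac:(first [ jopt | jset ]). Qed.

Lemma fpt_decompose A : @fpt A loop_ty (fun I _ => @decompose _ (@arcs I) (param I)).
Proof.
rewrite /decompose; apply: fpt_iter; first exact: (fpt_comp (fpt_snd (@fpt_id _)) fpt_step0).
by apply: fpt_pair; [exact: fpt_start | exact: fpt_none].
Qed.

Definition nodes (V : finType) (tb : table V) : {set V} := [set v | is_node tb v].

Definition output_ty :=
  prod_ty bool_ty (prod_ty (seq_ty (seq_ty bool_ty))
    (prod_ty (seq_ty (seq_ty set_ty)) (seq_ty set_ty))).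

Definition output (V : finType) (tb : table V) :=
  (true, ([seq [seq (if up tb v is Some w then w == u else false) | v <- enum (nodes tb)]
            | u <- enum (nodes tb)],
   ([seq [seq guard_of tb v | v <- enum (nodes tb)] | u <- enum (nodes tb)],
    [seq bag_of tb v | v <- enum (nodes tb)]))).

Lemma fpt_nodes A (tb : forall I, car A I -> car table_ty I) :
  fpt tb -> @fpt A set_ty (fun I x => nodes (tb I x)).
Proof.
move=> h; suff h0 : @fpt table_ty set_ty (fun I tb => nodes tb) by exact: (fpt_comp h h0).
have h1 : @fpt table_ty set_ty (fun I tb => [set v | if tb v is Some nd then true else false]).
  by jauto jopt.
apply: (fpt_ext h1) => I t; apply/setP => v; rewrite !inE /is_node; by case: (t v).
Qed.

Lemma fpt_output : @fpt table_ty output_ty (fun I tb => @output _ tb).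
Proof. by rewrite /output /up /guard_of /bag_of; jauto ltac:(first [ apply: fpt_nodes | jopt ]). Qed.

(** The two outcomes differ in shape, so the result is a raw tree and the encoders are arguments. *)
Definition answer (V : finType) (st : table V * option {set V}) (encs : {set V} -> tree)
    (enco : table V -> tree) : tree :=
  if st.2 is Some T then Node (enc_bool false) (encs T) else enco st.1.

Lemma fpt_answer : @fpt unit_ty tree_ty (fun I _ =>
  answer (@decompose _ (@arcs I) (param I)) (enc (t:=set_ty) I)
    (fun tb => enc (t:=output_ty) I (output tb))).
Proof.
have hd := fpt_decompose unit_ty.
have h1 : @fpt (prod_ty unit_ty set_ty) tree_ty (fun I p => Node (enc_bool false) (enc I p.2)).
  by apply: (fpt_cast (fpt_pair (fpt_false _) (fpt_snd (@fpt_id _)))).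
have h2 : @fpt unit_ty tree_ty (fun I _ =>
    enc (t:=output_ty) I (output (@decompose _ (@arcs I) (param I)).1)).
  by apply: (fpt_cast (fpt_comp (fpt_fst hd) fpt_output)).
exact: (@fpt_opt _ set_ty _ _ _ _ (fpt_snd hd) h2 h1).
Qed.

(** * From tables to decompositions with numbered nodes *)

Section Final.

Variables (n k : nat) (D : rel 'I_n).
Hypotheses (n_gt0 : 0 < n) (k_gt0 : 0 < k).
Variable tb : table 'I_n.
Hypothesis tb_good : good D k tb.
Hypothesis tb_done : forall v, ~~ pending tb v.

Let m := #|nodes tb|.
(** This numbering agrees with the order in which [output] lists the nodes. *)
Let name (i : 'I_m) : 'I_n := enum_val i.
Let parent (i : 'I_m) : option 'I_m := [pick j | up tb (name i) == Some (name j)].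

Lemma name_dm i : is_node tb (name i).
Proof. by have := enum_valP i; rewrite inE. Qed.

Lemma dm_name v : is_node tb v -> exists i, name i = v.
Proof.
move=> dv; have hv : v \in nodes tb by rewrite inE.
by exists (enum_rank_in hv v); rewrite /name enum_rankK_in.
Qed.

Lemma name_dn i : is_done tb (name i).
Proof. by have := tb_done (name i); rewrite pendingE name_dm negbK. Qed.

Lemma parentP i j : (parent i == Some j) = (up tb (name i) == Some (name j)).
Proof.
rewrite /parent; case: pickP => [j' /eqP ->|none].
  by apply/eqP/eqP => [[->//]|[] /enum_val_inj ->].
by rewrite none; apply/eqP.
Qed.

Lemma parent_Some i j : parent i = Some j <-> up tb (name i) = Some (name j).
Proof. by split=> [/eqP|/eqP]; [rewrite parentP | rewrite -parentP] => /eqP. Qed.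

Lemma map_name : [seq name i | i <- enum 'I_m] = enum (nodes tb).
Proof.
apply: (@eq_from_nth _ (Ordinal n_gt0)); first by rewrite size_map size_enum_ord -cardE.
move=> i; rewrite size_map size_enum_ord => im.
rewrite (nth_map (Ordinal im)) ?size_enum_ord // /name.
by rewrite (enum_val_nth (Ordinal n_gt0)) nth_enum_ord.
Qed.

Lemma map_nodes (A B : Type) (f : 'I_n -> A) (g : A -> B) :
  map g [seq f v | v <- enum (nodes tb)] = [seq g (f (name i)) | i <- enum 'I_m].
Proof. by rewrite -map_name -(map_comp f) -map_comp. Qed.

Lemma final_decomposition :
  exists (m : nat) (R : rel 'I_m) (X : 'I_m * 'I_m -> {set 'I_n}) (W : 'I_m -> {set 'I_n}),
    [/\ nice_arboreal_decomposition D R X W, width R X W <= 3 * k - 2 &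
        enc (t:=output_ty) (@Inst n k D n_gt0 k_gt0) (output tb) = enc_decomposition R X W].
Proof.
have L := tb_good; have [r0 [r1 r2 r3 r4 r5]] := l_root L; have [i0 e0] := dm_name r1.
pose X i := guard_of tb (name i); pose B i := block_of tb (name i); pose W i := bag_of tb (name i).
have po v : v != i0 -> parent v <> None.
  move=> ne; have nr : name v != r0 by apply: contraNneq ne => e; apply/eqP/enum_val_inj; rewrite -/(name v) e -e0.
  have [u hu /(l_dn L)/dm_name [j ej]] := r5 _ (name_dm v) nr.
  by have /parent_Some-> : up tb (name v) = Some (name j) by rewrite hu ej.
have h0 v : W v != set0.
  by apply/set0Pn; exists (name v); apply: (l_self L (name_dm v)).
have hd u v : u != v -> [disjoint W u & W v].
  move=> ne; apply: disjointI => x xu; apply: contraNN ne => xv.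
  by apply/eqP/enum_val_inj; apply: (l_disj L (name_dm u) (name_dm v) xu xv).
have hB : B i0 = setT by rewrite /B e0.
have hs v x : x \in B v <-> x \in W v \/ exists2 c, parent c = Some v & x \in B c.
  rewrite (l_split L x (name_dm v)); split=> -[h|h]; try by left.
    right; have [c [/dm_name[j <-] h1 h2]] := h; exists j => //; exact/parent_Some.
  by right; have [c /parent_Some h1 h2] := h; exists (name c); rewrite name_dm.
have hbw c v : parent c = Some v -> [disjoint B c & W v].
  by move=> /parent_Some h; apply: (l_bw L (name_dm c) h).
have hc v u : parent v = Some u -> B v \in strong_components D (X v).
  by move=> /parent_Some h; apply: (l_comp L (name_dm v)); rewrite h.
have hh u : exists Z : {set 'I_n},
  [/\ W u \subset Z, #|X u :|: Z| <= (3 * k - 2).+1 &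
  forall c, parent c = Some u -> X c \subset Z :|: X u /\ [disjoint B c & Z :|: X u]].
  have [Z [h1 h2 h3]] := l_hub L (name_dn u); exists Z; split=> //.
    by apply: leq_trans h2 _; move: k_gt0; clear; lia.
  by move=> c /parent_Some; apply: h3; apply: name_dm.
exists m, (child_of parent), (fun e => X e.2), W; split.
- exact: (nice_child_of po h0 hd hB hs hbw hc hh).
- exact: (width_child_of hh).
rewrite /enc_decomposition /output /enc_rel /enc_set /=; congr (Node _ (Node _ (Node _ _))).
- rewrite map_nodes; congr enc_seq; apply: eq_map => u.
  rewrite map_nodes; congr enc_seq; apply: eq_map => v.
  by rewrite inE /child_of /= parentP.
- rewrite map_nodes; congr enc_seq; apply: eq_map => u.
  by rewrite map_nodes.
- by rewrite map_nodes.
Qed.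

End Final.

(** The time bound uses one constant as a factor and in both exponents; [2 ^ e], being at least [e],
    serves in all three places. *)
Lemma scale_pow I e :
  scale I ^ e <= 2 ^ e * 2 ^ (2 ^ e * (param I * up_log 2 (param I))) * nvtx I ^ (2 ^ e).
Proof.
have le : e <= 2 ^ e by apply: ltnW; apply: ltn_expl.
rewrite /scale !expnMn -expnM -mulnA -[in leqRHS]mulnA leq_mul2l mulnC; apply/orP; right.
apply: leq_mul; last by rewrite leq_pexp2l ?nvtx_gt0.
by rewrite leq_exp2l // mulnC leq_mul2r le orbT.
Qed.

Theorem mainTheorem1 :
  exists (P : program) (c : nat),
  forall (n k : nat) (D : rel 'I_n),
    0 < n -> 0 < k ->
    exists (out : tree) (t : nat),
      [/\ runs P (enc_input D k) out t,
          t <= c * 2 ^ (c * (k * up_log 2 k)) * n ^ c &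
          (exists (m : nat) (R : rel 'I_m) (X : 'I_m * 'I_m -> {set 'I_n})
                  (W : 'I_m -> {set 'I_n}),
              [/\ nice_arboreal_decomposition D R X W,
                  width R X W <= 3 * k - 2 &
                  out = enc_decomposition R X W])
          \/
          (exists T : {set 'I_n},
              [/\ linked D (k - 1) (k - 1) T,
                  #|T| = 2 * k - 1 &
                  out = enc_linked_set T])].
Proof.
have [g [c h]] := fpt_answer.
(* Function 0 pairs the input with the unit argument, encoded as [Nil], and calls the generated code
   at offset 1; the 8 added to the exponent below pays for this wrapper. *)
pose main := Call 1 (MkNode (Var 0) MkNil).
exists (main :: g 1), (2 ^ (c + 0 + 8)) => n k D n0 k0.
pose I := @Inst n k D n0 k0.
have [t ht lt] : evt (main :: g 1) [:: enc_input D k] (Call 0 (Var 0))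
    (answer (@decompose _ D k) (enc (t:=set_ty) I) (fun tb => enc (t:=output_ty) I (output tb)))
    (scale I ^ (c + 0 + 8)).
  eapply evt_le.
    eapply evt_call; first by ev.
    eapply evt_call; first by ev.
    have hc := h (main :: g 1) [:: main] [::] 1 erefl.
    by apply: (hc _ I tt); rewrite cats0.
  by have := scale_expD I c 0; rewrite expn0; lia.
exists (answer (@decompose _ D k) (enc (t:=set_ty) I) (fun tb => enc (t:=output_ty) I (output tb))), t.
split=> //; first exact: leq_trans lt (scale_pow _ _).
have n0' : 0 < #|'I_n| by rewrite card_ord.
have [hg] := decompose_inv D k0 n0'; rewrite /answer.
case: (decompose D k).2 => [T [hT hl]|hp]; first by right; exists T.
left; exact: final_decomposition.
Qed.
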